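(* Let $w(x)=\sup_{\tau}\limsup_{T\to\infty}\mathbb E^x\{\int_0^{\tau\wedge T}f(X_s)\,ds+g(X_{\tau\wedge T})\}$ and assume $\mu(f)<0$. Assume (D1): there are $K:E\to(0,\infty)$ bounded on compact sets and $h:[0,\infty)\to[0,\infty)$ with $\int_0^\infty h(t)dt<\infty$ such that $\|P_t(x,\cdot)-\mu(\cdot)\|_{TV}<K(x)h(t)$ for all $x,t$; and (D2): $\mathbb E^x\{K(X_T)\}<\infty$ for all $x\in E$, $T\ge0$. Assume moreover one of: (a) $(X_t)$ is strongly Feller; or (b) for every compact $L\subset E$ there is $\alpha>0$ with $\sup_{x\in L,T\ge0}\mathbb E^x\{K(X_T)^{1+\alpha}\}<\infty$. Then $w$ is continuous.
   Context: $E$ is a locally compact separable metric space in which every closed ball is compact. $(X_t)$ is a right-continuous time-homogeneous (standard) Markov process on $E$ with laws $\mathbb P^x$, expectations $\mathbb E^x$, transition probabilities $P_t(x,\cdot)$, semigroup $P_t\phi(x)=\mathbb E^x\phi(X_t)$. Standing assumptions: (weak Feller) $P_t\mathcal C_0\subseteq\mathcal C_0$ ($\mathcal C_0$: continuous bounded functions vanishing at infinity); (ergodicity) there is a unique probability measure $\mu$ with $\|P_t(x,\cdot)-\mu\|_{TV}\to0$ for all $x$; $f,g$ continuous and bounded; $\mu(f)=\int f\,d\mu$. Strongly Feller: $P_t$, $t>0$, maps bounded measurable functions to continuous functions. Stopping times may be infinite. *)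

(* Defs.v *)
From HB Require Import structures.
From mathcomp Require Import all_boot all_order all_algebra.
From mathcomp Require Import all_classical all_reals all_analysis.
From mathcomp Require Import measurable_realfun.
Set Implicit Arguments. Unset Strict Implicit. Unset Printing Implicit Defensive.
Import Order.TTheory GRing.Theory Num.Theory.
Import numFieldNormedType.Exports.
Local Open Scope classical_set_scope.
Local Open Scope ring_scope.

Notation borelE E := (g_sigma_algebraType (@open E)).

Section Space.
Context {R : realType} {E : pseudoPMetricType R}.

(* metric closed ball {y | d(x,y) <= r} = intersection of the open balls of radius > r *)
Definition metric_closed_ball (x : E) (r : R) : set E :=
  [set y | forall e, r < e -> ball x e y].

Definition paper_space : Prop :=
  [/\ hausdorff_space E,
      (exists D : set E, countable D /\ dense D),
      locally_compact [set: E]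
    & forall (x : E) (r : R), compact (metric_closed_ball x r)].

Definition bdd_fun (phi : E -> R) := exists M : R, forall x, `|phi x| <= M.

Definition borel_bounded (phi : E -> R) :=
  measurable_fun [set: borelE E] (phi : borelE E -> R) /\ bdd_fun phi.

Definition vanish_at_infinity (phi : E -> R) :=
  forall e : R, 0 < e -> exists C : set E, compact C /\ forall x, ~ C x -> `|phi x| < e.

Definition C0 (phi : E -> R) :=
  [/\ continuous phi, bdd_fun phi & vanish_at_infinity phi].

End Space.

Section Process.
Context {R : realType} {E : pseudoPMetricType R} {d : measure_display}
  {Omega : measurableType d}.
Variables (P : E -> probability Omega R) (X : R -> Omega -> E)
  (F : R -> set (set Omega)).

Local Open Scope ereal_scope.

Definition trans (t : R) (x : E) (A : set E) : \bar R := P x (X t @^-1` A).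

Definition sgrp (t : R) (phi : E -> R) (x : E) : \bar R :=
  \int[P x]_w (phi (X t w))%:E.

Definition sgrpR (t : R) (phi : E -> R) (x : E) : R := fine (sgrp t phi x).

Definition tv (mu : probability (borelE E) R) (t : R) (x : E) : \bar R :=
  ereal_sup [set `| trans t x A - mu A | | A in [set A | @measurable _ (borelE E) A]].

Definition stopping_time (tau : Omega -> \bar R) : Prop :=
  (forall w, 0 <= tau w) /\
  (forall t : R, (0 <= t)%R -> F t [set w | tau w <= t%:E]).

Definition F_at (sigma : Omega -> \bar R) : set (set Omega) :=
  [set A | measurable A /\
    forall t : R, (0 <= t)%R -> F t (A `&` [set w | sigma w <= t%:E])].

Definition X_at (sigma : Omega -> \bar R) (w : Omega) : E := X (fine (sigma w)) w.

Definition standard_markov : Prop :=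
      (forall t : R, (0 <= t)%R -> sigma_algebra setT (F t) /\ F t `<=` measurable) /\
      (forall s t : R, (0 <= s)%R -> (s <= t)%R -> F s `<=` F t) /\
      (forall t : R, (0 <= t)%R -> F t = [set A | forall s : R, (t < s)%R -> F s A]) /\
      (forall t : R, (0 <= t)%R -> forall A : set E,
         @measurable _ (borelE E) A -> F t (X t @^-1` A)) /\
      (forall w (t : R), (0 <= t)%R -> (fun s => X s w) @ t^'+ --> X t w) /\
      (forall x, P x [set w | X 0 w = x] = 1) /\
      (forall t : R, (0 <= t)%R -> forall A : set E, @measurable _ (borelE E) A ->
         measurable_fun [set: borelE E] ((fun x : borelE E => trans t x A) : borelE E -> \bar R)) /\
      (forall x sigma, stopping_time sigma -> forall A, F_at sigma A ->
         forall s : R, (0 <= s)%R -> forall phi : E -> R, borel_bounded phi ->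
         \int[P x]_(w in A `&` [set w | sigma w < +oo])
            (phi (X (fine (sigma w) + s)%R w))%:E =
         \int[P x]_(w in A `&` [set w | sigma w < +oo]) sgrp s phi (X_at sigma w)) /\
      (forall x (sn : nat -> Omega -> \bar R) sigma,
         (forall n, stopping_time (sn n)) -> stopping_time sigma ->
         (forall w n, sn n w <= sn n.+1 w) ->
         (forall w, (fun n => sn n w) @ \oo --> sigma w) ->
         (P x).-negligible [set w | sigma w < +oo /\
            ~ ((fun n => X_at (sn n) w) @ \oo --> X_at sigma w)]).

Definition weak_feller : Prop :=
  forall t : R, (0 <= t)%R -> forall phi : E -> R, C0 phi -> C0 (sgrpR t phi).

Definition strong_feller : Prop :=
  forall t : R, (0 < t)%R -> forall phi : E -> R, borel_bounded phi ->
    continuous (sgrpR t phi).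

Definition ergodic_to (mu : probability (borelE E) R) : Prop :=
  forall x, tv mu t x @[t --> +oo%R] --> 0.

Definition stopT (tau : Omega -> \bar R) (T : R) (w : Omega) : R :=
  fine (Order.min (tau w) T%:E).

Definition payoff (f g : E -> R) (x : E) (tau : Omega -> \bar R) (T : R) : \bar R :=
  \int[P x]_w ((\int[@lebesgue_measure R]_(s in `[0%R, stopT tau T w])
                    (f (X s w))%:E)
               + (g (X (stopT tau T w) w))%:E).

Definition value_fun (f g : E -> R) (x : E) : \bar R :=
  ereal_sup [set limf_esup (payoff f g x tau) +oo%R | tau in [set tau | stopping_time tau]].

End Process.

(* Main.v *)
(** The value [w x] is the supremum of [E^x (\int_0^sigma f + g (X_sigma))] over bounded stopping
    times.  When [sigma] is restricted to a finite time grid, backward induction shows that the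
    optimal value is attained and, by the Feller property, continuous in [x].  Grid values lie
    below [w], so it suffices to approximate [w] by them from below, uniformly on compact sets.

    Truncation of the horizon: replace the one-step reward by a majorant which differs from a
    function [phi] with [mu phi = 0] by a negative constant, where [phi >= 0] off a compact set.
    The corrector [Q_N = \sum_(k < N) P_k phi] is bounded below by a minimum principle, so
    Dynkin's formula bounds the expectation of near-optimal stopping times.  The corrector is
    not bounded above, but since [mu] is invariant, Fatou's lemma along [P_m] shows that the
    part of [Q_N (X_T)] exceeding a level [n] has small expectation for large [T].

    Discretization of time: [E^x g (X_sigma)] need not vary continuously with [sigma], but for
    the averages [g_r = r^-1 \int_0^r P_s g] it is Lipschitz in [sigma].  The measures
    [law of X_sigma - law of X_sigma'], taken along an ultrafilter of stopping times [sigma] and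
    their grid roundings [sigma'], have limits that are functionals on bounded continuous
    functions; for these, [g_r -> g] follows from the bounded convergence theorem, in
    Luxemburg's version for functionals satisfying a tightness condition. *)
Require Import Defs.

From HB Require Import structures.
From mathcomp Require Import all_boot all_order all_algebra.
From mathcomp Require Import all_classical all_reals all_analysis.
From mathcomp Require Import measurable_realfun.
From mathcomp Require Import ring lra.
Import Order.TTheory GRing.Theory Num.Theory.
Import numFieldNormedType.Exports.
Local Open Scope classical_set_scope.
Local Open Scope ring_scope.
Set Implicit Arguments.
Unset Strict Implicit.

(** * Integrals of bounded functions *)

(** The obstacle is that [K] is bounded only on compact sets, while stopping times carry the process
    everywhere: the estimates from (D1) are uniform in the starting point on compact sets only. This
    is why the corrector needs a minimum principle, and why the reward is first raised off a compact
    set, for which a negative [mu f] leaves room.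

    After a shift by [CB] the corrector is a nonnegative [W_N], and two bounds squeeze its upper
    part. On one side [P_T W_N <= CB + small], because [P_T Q_N] is a piece of the tail of a
    summable series. On the other, [P_T min(W_N, n)] is close to [mu (min(W_N, n))], which is nearly
    [CB] or more once [n] is large. The difference is what [W_N] carries above the level [n].

    One inequality is used twice. At time 0, for a stopping time that beats immediate stopping, it
    bounds the sum of the survival probabilities, so that survival beyond [T] has probability
    [O(1/T)]. At time [T] it bounds the loss from truncation by a constant times this probability,
    plus the part above [n]. *)

Section BoundedIntegrals.
Context d (T : measurableType d) (R : realType).
Implicit Types (Z : T -> R) (D A : set T).

Lemma bounded_integrable (m : {measure set T -> \bar R}) D Z (M : R) :
  measurable D -> (m D < +oo)%E -> measurable_fun D Z ->
  (forall w, D w -> `|Z w| <= M) -> m.-integrable D (EFin \o Z).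
Proof.
move=> mD mDf mZ bZ; apply: measurable_bounded_integrable => //.
exists M; split; first exact: num_real.
by move=> N MN w /= Dw; exact: le_trans (bZ _ Dw) (ltW MN).
Qed.

Lemma dominated_cvg_Rintegral (m : {measure set T -> \bar R}) D (Zn : nat -> T -> R)
    Z (G : T -> R) :
  measurable D -> m.-integrable D (EFin \o G) -> (forall n, measurable_fun D (Zn n)) ->
  (forall n w, D w -> `|Zn n w| <= G w) ->
  (forall w, D w -> Zn ^~ w @ \oo --> Z w) ->
  \int[m]_(w in D) Zn n w @[n --> \oo] --> \int[m]_(w in D) Z w.
Proof.
move=> mD iG mZn bZn cvZ.
have mZ : measurable_fun D Z by exact: measurable_fun_cvg mZn cvZ.
have bZ w : D w -> `|Z w| <= G w.
  move=> Dw; have cvN : `|Zn n w| @[n --> \oo] --> `|Z w|.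
    by apply: cvg_norm; exact: cvZ.
  rewrite -(cvg_lim (@Rhausdorff _) cvN); apply: limr_le.
    by apply/cvg_ex; exists `|Z w|.
  by apply: nearW => n; exact: bZn.
have dom (Y : T -> R) : measurable_fun D Y -> (forall w, D w -> `|Y w| <= G w) ->
    m.-integrable D (EFin \o Y).
  move=> mY bY; apply: le_integrable iG => //; first exact/measurable_EFinP.
  by move=> w Dw; rewrite /= lee_fin (le_trans (bY w Dw))// ler_norm.
apply: fine_cvg; rewrite fineK; last exact: integrable_fin_num (dom _ mZ bZ).
apply: (@dominated_cvg _ _ _ _ _ mD (fun n w => (Zn n w)%:E) _ (EFin \o G)) => //=.
- by move=> n; apply/measurable_EFinP.
- move=> w Dw; apply: cvg_EFin; first exact: nearW.
  exact: cvZ.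
Qed.

Lemma bounded_cvg_Rintegral (m : {measure set T -> \bar R}) D (Zn : nat -> T -> R)
    Z (M : R) :
  measurable D -> (m D < +oo)%E -> (forall n, measurable_fun D (Zn n)) ->
  (forall n w, D w -> `|Zn n w| <= M) ->
  (forall w, D w -> Zn ^~ w @ \oo --> Z w) ->
  \int[m]_(w in D) Zn n w @[n --> \oo] --> \int[m]_(w in D) Z w.
Proof.
move=> mD mDf mZn bZn cvZ; apply: (@dominated_cvg_Rintegral _ _ _ _ (fun=> M)) => //.
by apply: (@bounded_integrable _ _ _ `|M|) => // ? _; rewrite normr_id.
Qed.

(** The integral of a nonnegative function is a supremum over the simple functions below it, hence
    monotone for arbitrary functions. This is how (D2) is exploited for a [K] that may fail to be
    measurable. *)
Lemma ge0_le_nonmeasurable_integral (m : {measure set T -> \bar R}) (Y Z : T -> \bar R) :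
  (forall w, (0 <= Y w)%E) -> (forall w, (Y w <= Z w)%E) ->
  (\int[m]_w Y w <= \int[m]_w Z w)%E.
Proof.
move=> Y0 YZ; have Z0 w : (0 <= Z w)%E by exact: le_trans (YZ w).
rewrite !ge0_integralTE//; apply: ereal_sup_le => _ [h hY <-].
by exists h => // w; exact: le_trans (YZ w).
Qed.

Lemma Rintegral_sum (m : {measure set T -> \bar R}) D (I : Type) (s : seq I)
    (Z : I -> T -> R) :
  measurable D -> (forall i, m.-integrable D (EFin \o Z i)) ->
  \int[m]_(w in D) (\sum_(i <- s) Z i w) = \sum_(i <- s) \int[m]_(w in D) Z i w.
Proof.
move=> mD iZ; have iS (r : seq I) : m.-integrable D (EFin \o (fun w => \sum_(i <- r) Z i w)).
  elim: r => [|i r IH].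
    rewrite (_ : _ \o _ = cst 0%E); first exact: integrable0.
    by apply/funext => w /=; rewrite big_nil.
  rewrite (_ : _ \o _ = ((EFin \o Z i) \+ (EFin \o (fun w => \sum_(i <- r) Z i w)%R))%E).
    exact: integrableD.
  by apply/funext => w /=; rewrite big_cons.
elim: s => [|i s IH].
  by rewrite big_nil; under eq_Rintegral do rewrite big_nil; rewrite Rintegral_cst// mul0r.
rewrite big_cons -IH -RintegralD//.
by apply: eq_Rintegral => w _; rewrite big_cons.
Qed.

(** The working class of integrands: closed under the algebraic operations and integrable under
    every probability, so that expectations can be computed in [R]. On [borelE E] it unfolds to
    [borel_bounded], so the closure lemmas serve for both. *)
Definition bmeas Z := measurable_fun setT Z /\ exists M : R, forall w, `|Z w| <= M.

Lemma bmeas_cst (c : R) : bmeas (fun=> c).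
Proof. by split => //; exists `|c|. Qed.

Lemma bmeasD Z1 Z2 : bmeas Z1 -> bmeas Z2 -> bmeas (fun w => Z1 w + Z2 w).
Proof.
move=> [m1 [M1 b1]] [m2 [M2 b2]]; split; first exact: measurable_funD.
by exists (M1 + M2) => w; rewrite (le_trans (ler_normD _ _))// lerD.
Qed.

Lemma bmeasM Z1 Z2 : bmeas Z1 -> bmeas Z2 -> bmeas (fun w => Z1 w * Z2 w).
Proof.
move=> [m1 [M1 b1]] [m2 [M2 b2]]; split; first exact: measurable_funM.
by exists (M1 * M2) => w; rewrite normrM ler_pM.
Qed.

Lemma bmeasN Z : bmeas Z -> bmeas (fun w => - Z w).
Proof.
by move=> [m1 [M b]]; split; [exact: measurable_funN|exists M => w; rewrite normrN].
Qed.

Lemma bmeasB Z1 Z2 : bmeas Z1 -> bmeas Z2 -> bmeas (fun w => Z1 w - Z2 w).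
Proof. by move=> b1 b2; apply: bmeasD => //; exact: bmeasN. Qed.

Lemma bmeas_norm Z : bmeas Z -> bmeas (fun w => `|Z w|).
Proof.
move=> [m1 [M b]]; split; last by exists M => w; rewrite normr_id.
exact: measurableT_comp.
Qed.

Lemma bmeas_indic A : measurable A -> bmeas (\1_A : T -> R).
Proof.
move=> mA; split; first exact: measurable_indic.
by exists 1 => w; rewrite indicE; case: (w \in A); rewrite /= ?normr1 ?normr0.
Qed.

Lemma bmeas_sum (I : Type) (s : seq I) (Z : I -> T -> R) :
  (forall i, bmeas (Z i)) -> bmeas (fun w => \sum_(i <- s) Z i w).
Proof.
move=> bZ; elim: s => [|i s IH].
  rewrite (_ : (fun _ => _) = (fun=> 0)); first exact: bmeas_cst.
  by apply/funext => w; rewrite big_nil.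
rewrite (_ : (fun _ => _) = (fun w => Z i w + \sum_(j <- s) Z j w)).
  exact: bmeasD.
by apply/funext => w; rewrite big_cons.
Qed.

Variable P : probability T R.

Lemma bmeas_integrable Z : bmeas Z -> P.-integrable setT (EFin \o Z).
Proof.
move=> [mZ [M bZ]]; apply: (@bounded_integrable _ _ _ M) => //.
by rewrite (le_lt_trans (probability_le1 P measurableT))// ltry.
Qed.

Lemma EFin_expect Z : bmeas Z -> (\int[P]_w (Z w)%:E)%E = (\int[P]_w Z w)%:E.
Proof.
by move=> /bmeas_integrable iZ; rewrite /Rintegral fineK//; exact: integrable_fin_num.
Qed.

Lemma expect_cst (c : R) : \int[P]_w c = c.
Proof. rewrite Rintegral_cst// -[RHS]mulr1; congr (_ * _).
by have /= := congr1 fine (probability_setT P). Qed.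

Lemma expectD Z1 Z2 : bmeas Z1 -> bmeas Z2 ->
  \int[P]_w (Z1 w + Z2 w) = \int[P]_w Z1 w + \int[P]_w Z2 w.
Proof. by move=> b1 b2; rewrite RintegralD//; exact: bmeas_integrable. Qed.

Lemma expectB Z1 Z2 : bmeas Z1 -> bmeas Z2 ->
  \int[P]_w (Z1 w - Z2 w) = \int[P]_w Z1 w - \int[P]_w Z2 w.
Proof. by move=> b1 b2; rewrite RintegralB//; exact: bmeas_integrable. Qed.

Lemma expectZ (c : R) Z : bmeas Z -> \int[P]_w (c * Z w) = c * \int[P]_w Z w.
Proof. by move=> b; rewrite RintegralZl//; exact: bmeas_integrable. Qed.

Lemma le_expect Z1 Z2 : bmeas Z1 -> bmeas Z2 -> (forall w, Z1 w <= Z2 w) ->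
  \int[P]_w Z1 w <= \int[P]_w Z2 w.
Proof. by move=> b1 b2 le12; apply: le_Rintegral => //; exact: bmeas_integrable. Qed.

Lemma expect_le Z (M : R) : bmeas Z -> (forall w, Z w <= M) -> \int[P]_w Z w <= M.
Proof.
move=> b leM; rewrite -[leRHS]expect_cst; apply: le_expect => //.
exact: bmeas_cst.
Qed.

Lemma expect_ge Z (M : R) : bmeas Z -> (forall w, M <= Z w) -> M <= \int[P]_w Z w.
Proof.
move=> b leM; rewrite -[leLHS]expect_cst; apply: le_expect => //.
exact: bmeas_cst.
Qed.

Lemma norm_expect_le Z (M : R) : bmeas Z -> (forall w, `|Z w| <= M) ->
  `|\int[P]_w Z w| <= M.
Proof.
move=> b leM; rewrite (le_trans (le_normr_Rintegral _ _))//.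
  exact: bmeas_integrable.
by apply: expect_le => //; exact: bmeas_norm.
Qed.

Lemma expect_sum (I : Type) (s : seq I) (Z : I -> T -> R) :
  (forall i, bmeas (Z i)) ->
  \int[P]_w (\sum_(i <- s) Z i w) = \sum_(i <- s) \int[P]_w Z i w.
Proof. by move=> bZ; apply: Rintegral_sum => // i; exact: bmeas_integrable. Qed.

Lemma cvg_expect (Zn : nat -> T -> R) Z (M : R) : (forall n, measurable_fun setT (Zn n)) ->
  (forall n w, `|Zn n w| <= M) -> (forall w, Zn ^~ w @ \oo --> Z w) ->
  \int[P]_w Zn n w @[n --> \oo] --> \int[P]_w Z w.
Proof.
move=> mZ bZ cZ; apply: (@bounded_cvg_Rintegral _ _ _ _ M) => //.
by rewrite (le_lt_trans (probability_le1 P measurableT))// ltry.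
Qed.

Lemma expect_indic A : measurable A -> \int[P]_w (\1_A w : R) = fine (P A).
Proof. by move=> mA; rewrite /Rintegral integral_indic// setIT. Qed.

End BoundedIntegrals.

Lemma lebesgue_itv_fin (R : realType) (b1 b2 : bool) (a b : R) :
  (@lebesgue_measure R [set` Interval (BSide b1 a) (BSide b2 b)] < +oo)%E.
Proof. by rewrite lebesgue_measure_itv /=; case: ifP => _; rewrite ?ltry. Qed.

Lemma fine_lebesgue_itv (R : realType) (b1 b2 : bool) (a b : R) : a <= b ->
  fine ((@lebesgue_measure R : {measure set (measurableTypeR R) -> \bar R})
    [set` Interval (BSide b1 a) (BSide b2 b)]) = b - a.
Proof.
move=> ab; have -> : (@lebesgue_measure R : {measure set (measurableTypeR R) -> \bar R})
    [set` Interval (BSide b1 a) (BSide b2 b)] =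
    @lebesgue_measure R [set` Interval (BSide b1 a) (BSide b2 b)] by [].
rewrite lebesgue_measure_itv /= lte_fin; case: ltP => //= ba.
by apply/esym/eqP; rewrite subr_eq0 eq_le ab ba.
Qed.

(** * Riemann sums of bounded right-continuous functions *)

Section RiemannSums.
Context {R : realType}.
Notation leb := (@lebesgue_measure R).
Variables (u : R -> R) (a t M : R).
Hypothesis t0 : 0 <= t.
Hypothesis u_right : forall s, a <= s -> u x @[x --> s^'+] --> u s.
Hypothesis u_bound : forall s, a <= s -> `|u s| <= M.

Lemma grid_cell (dl y : R) (N : nat) : 0 < y -> y <= N%:R * dl ->
  exists2 i, (i < N)%N & i%:R * dl < y <= i.+1%:R * dl.
Proof.
move=> y0; elim: N => [|N IH] yN; first by move: yN; rewrite mul0r leNgt y0.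
have [yle|ylt] := leP y (N%:R * dl).
  by have [i iN] := IH yle; exists i => //; exact: ltnW.
by exists N => //; rewrite ylt.
Qed.

Let mesh n : R := t / n.+1%:R.
Let cell n i : set R := `]a + i%:R * mesh n, a + i.+1%:R * mesh n].
(** Each cell carries the value at its right endpoint: the evaluation points then approach [s] from
    the right, the only side on which [u] is controlled. *)
Let step n (s : R) : R :=
  \sum_(i < n.+1) u (a + i.+1%:R * mesh n) * \1_(cell n i) s.

Let mesh_ge0 n : 0 <= mesh n.
Proof. by rewrite divr_ge0. Qed.

Let mesh_total n : n.+1%:R * mesh n = t.
Proof. by rewrite /mesh mulrC divfK. Qed.

Let cellP n s : s \in `]a, (a + t)] -> exists q,
  [/\ step n s = u q, s <= q & q <= s + mesh n].
Proof.
rewrite in_itv /= => /andP[as_ sat].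
have [||i iN /andP[lo hi]] := @grid_cell (mesh n) (s - a) n.+1.
- by rewrite subr_gt0.
- by rewrite mesh_total lerBlDl.
exists (a + i.+1%:R * mesh n); split.
- rewrite /step (bigD1 (Ordinal iN))//= big1 ?addr0.
    rewrite indicE mem_set ?mulr1//= /cell /= in_itv /=.
    by apply/andP; split; lra.
  move=> j ji; rewrite indicE memNset ?mulr0// /cell /= in_itv /= => /andP[jlo jhi].
  have [jlti|iltj|jeqi] := ltngtP j i.
  + have : j.+1%:R * mesh n <= i%:R * mesh n by rewrite ler_wpM2r// ler_nat.
    lra.
  + have : i.+1%:R * mesh n <= j%:R * mesh n by rewrite ler_wpM2r// ler_nat.
    lra.
  + by move/eqP: ji; apply; apply/val_inj.
- lra.
- move: lo hi; rewrite -(addn1 i) natrD mulrDl mul1r; lra.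
Qed.

Let step_measurable n : measurable_fun setT (step n).
Proof.
apply: measurable_sum => i; apply: measurable_funM => //.
apply: measurable_indic; exact: measurable_itv.
Qed.

Let step_bound n s : s \in `]a, (a + t)] -> `|step n s| <= M.
Proof.
move=> /[dup] si /(cellP n)[q [-> sq _]]; apply: u_bound.
by move: si; rewrite in_itv /= => /andP[]; lra.
Qed.

Let step_cvg s : s \in `]a, (a + t)] -> step ^~ s @ \oo --> u s.
Proof.
move=> si; have as_ : a <= s by move: si; rewrite in_itv /= => /andP[]; lra.
apply/cvgrPdist_lt => e e0.
have /cvgrPdist_lt/(_ e e0) := u_right as_.
rewrite near_withinE => -[r /= r0 ru].
have /cvgrPdist_lt/(_ r r0) : mesh n @[n --> \oo] --> 0.
  rewrite -(mulr0 t); apply: cvgMr; exact: cvg_harmonic.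
apply: filterS => n; rewrite sub0r normrN ger0_norm// => mr.
have [q [-> sq qs]] := cellP n si.
have [->|sneq] := eqVneq q s; first by rewrite subrr normr0.
apply: ru => /=; last by rewrite lt_neqAle eq_sym sneq.
by rewrite ler0_norm; lra.
Qed.

Lemma right_continuous_measurable : measurable_fun `]a, (a + t)] u.
Proof.
apply: (measurable_fun_cvg (h := step)); last by move=> s; exact: step_cvg.
by move=> n; exact: measurable_funTS.
Qed.

Lemma right_continuous_integrable : leb.-integrable `[a, (a + t)] (EFin \o u).
Proof.
apply: (@bounded_integrable _ _ _ _ _ _ M) => //.
- exact: lebesgue_itv_fin.
- apply/measurable_fun_itv_obnd_cbndP; exact: right_continuous_measurable.
- by move=> w /=; rewrite in_itv /= => /andP[aw _]; exact: u_bound.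
Qed.

Let step_integral n : \int[leb]_(s in `]a, (a + t)]) step n s =
  mesh n * \sum_(i < n.+1) u (a + i.+1%:R * mesh n).
Proof.
have ci i : leb.-integrable `]a, (a + t)] (EFin \o (\1_(cell n i) : R -> R)).
  apply: (@bounded_integrable _ _ _ _ _ _ 1) => //.
    exact: lebesgue_itv_fin.
    apply: measurable_indic; exact: measurable_itv.
  by move=> w _; rewrite indicE; case: (_ \in _); rewrite ?normr1 ?normr0.
rewrite /step Rintegral_sum//; last first.
  move=> i; apply: (@bounded_integrable _ _ _ _ _ _ `|u (a + i.+1%:R * mesh n)|) => //.
    exact: lebesgue_itv_fin.
    by apply: measurable_funM => //; apply: measurable_indic; exact: measurable_itv.
  move=> w _; rewrite indicE normrM; case: (_ \in _); rewrite ?normr1 ?normr0.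
    by rewrite mulr1.
  by rewrite mulr0.
rewrite mulr_sumr; apply: eq_bigr => i _; rewrite RintegralZl// mulrC; congr (_ * _).
rewrite /Rintegral integral_indic//; last exact: measurable_itv.
rewrite setIidl; last first.
  move=> s; rewrite /cell /= !in_itv /= => /andP[lo hi]; apply/andP; split.
    by rewrite (le_lt_trans _ lo)// lerDl mulr_ge0.
  rewrite (le_trans hi)// lerD2l -[leRHS](mesh_total n) ler_wpM2r// ler_nat.
  exact: ltn_ord.
have e : a + i.+1%:R * mesh n = a + i%:R * mesh n + mesh n.
  by rewrite -(addn1 i) natrD mulrDl mul1r addrA.
have -> : mesh n = (a + i%:R * mesh n + mesh n) - (a + i%:R * mesh n).
  by rewrite addrAC subrr add0r.
rewrite /cell e; apply: fine_lebesgue_itv.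
by rewrite lerDl.
Qed.

(** The sums are the integrals of the step functions, which converge pointwise and boundedly on the
    half-open interval; the left endpoint is a null set. *)
Lemma cvg_riemann_sum :
  (t / n.+1%:R) * (\sum_(i < n.+1) u (a + i.+1%:R * (t / n.+1%:R))) @[n --> \oo]
  --> \int[leb]_(s in `[a, (a + t)]) u s.
Proof.
rewrite -Rintegral_itv_obnd_cbnd; last first.
  by apply: integrableS right_continuous_integrable => //; apply: subset_itv_oc_cc.
rewrite (_ : (fun n => _) = (fun n => \int[leb]_(s in `]a, (a + t)]) step n s)); last first.
  by apply/funext => n; rewrite step_integral.
apply: (@bounded_cvg_Rintegral _ _ _ _ _ _ _ M) => //.
- exact: lebesgue_itv_fin.
- by move=> n; apply: measurable_funTS; exact: step_measurable.
Qed.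

Lemma norm_integral_le : `|\int[leb]_(s in `[a, (a + t)]) u s| <= M * t.
Proof.
have int_u := right_continuous_integrable.
rewrite (le_trans (le_normr_Rintegral _ _))//.
rewrite (@le_trans _ _ (\int[leb]_(s in `[a, (a + t)]) M))//; last first.
  rewrite Rintegral_cst// (fine_lebesgue_itv _ _ (_ : a <= a + t)) ?lerDl//.
  by rewrite addrAC subrr add0r.
apply: le_Rintegral => //.
- exact: integrable_norm.
- apply: (@bounded_integrable _ _ _ _ _ _ `|M|) => //.
  exact: lebesgue_itv_fin.
- by move=> w /=; rewrite in_itv /= => /andP[aw _]; exact: u_bound.
Qed.

End RiemannSums.

(** * Dini's theorem and cutoff functions *)

Section Topology.
Context {R : realType} {E : pseudoPMetricType R}.

(** Balls of radius [1/(n+1)] form a local base, so sequences suffice. Continuity of an integral in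
    a parameter can then be read off from convergence theorems stated for sequences. *)
Lemma sequentially_continuous_at (u : E -> R) (x : E) :
  (forall y : nat -> E, y @ \oo --> x -> u (y n) @[n --> \oo] --> u x) ->
  {for x, continuous u}.
Proof.
move=> su; apply/cvgrPdist_lt => e e0; apply: contrapT => Nn.
have ex n : exists y, ball x n.+1%:R^-1 y /\ e <= `|u x - u y|.
  apply: contrapT => Ny; apply: Nn; apply/nbhs_ballP.
  exists n.+1%:R^-1; first by rewrite /= invr_gt0.
  move=> y xy /=; rewrite ltNge; apply/negP => ey; apply: Ny; by exists y.
have [y yP] := choice ex.
have yx : y @ \oo --> x.
  apply/cvg_ballP => r r0.
  have /cvgrPdist_lt/(_ r r0) : n.+1%:R^-1 @[n --> \oo] --> (0 : R) by exact: cvg_harmonic.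
  apply: filterS => n; rewrite sub0r normrN ger0_norm ?invr_ge0// => nr.
  exact: le_ball (ltW nr) _ (yP n).1.
have /cvgrPdist_lt/(_ e e0) [N _ NP] := su y yx.
by have := NP N (leqnn N); rewrite /= ltNge (yP N).2.
Qed.

(** By monotonicity the single open condition [v N < e] persists for all later indices, which is the
    local statement that the covering form of compactness asks for. *)
Lemma dini (L : set E) (v : nat -> E -> R) (e : R) : compact L -> 0 < e ->
  (forall n, continuous (v n)) -> (forall n x, v n.+1 x <= v n x) ->
  (forall x, L x -> v ^~ x @ \oo --> 0) ->
  exists N, forall n x, (N <= n)%N -> L x -> v n x < e.
Proof.
move=> cL e0 cv dv v0.
have dv' x n m : (n <= m)%N -> v m x <= v n x.
  move=> /subnK <-; elim: (m - n)%N => [|k IH]; first by rewrite add0n.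
  by rewrite addSn (le_trans (dv _ _)).
have H x : L x -> \forall x' \near x & n \near \oo, v n x' < e.
  move=> Lx; have /cvgrPdist_lt/(_ e e0)[N _ NP] := v0 x Lx.
  have vN : v N x < e by have := NP N (leqnn N); rewrite /= sub0r normrN => /ltr_normlW.
  exists ([set x' | v N x' < e], [set n | (N <= n)%N]); last first.
    by move=> [x' n] [/= vx Nn]; exact: le_lt_trans (dv' _ _ _ Nn) vx.
  split => /=; last by exists N.
  by have := cv N x; move=> /(_ [set r | r < e]); apply; exact: lt_nbhsl.
have /compact_near_coveringP/(_ nat \oo (fun n x => v n x < e) _ H)[N _ NP] := cL.
by exists N => n x Nn Lx; exact: NP.
Qed.

(** Multiplication by [eta n] brings a bounded continuous function into [C0], where the weak Feller
    property applies; the monotonicity in [n] is there for Dini's theorem. *)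
Definition cutoffs (C : nat -> set E) (eta : nat -> E -> R) :=
  [/\ forall n, compact (C n), forall n, continuous (eta n),
      forall n x, 0 <= eta n x <= 1, forall n x, ~ C n x -> eta n x = 0 &
      (forall n x, eta n x <= eta n.+1 x) /\ forall x, eta ^~ x @ \oo --> (1 : R)].

Fixpoint max_upto (z : nat -> E -> R) (n : nat) (x : E) : R :=
  if n is n'.+1 then Num.max (max_upto z n' x) (z n' x) else 0.

Lemma max_upto_continuous z n : (forall i, continuous (z i)) -> continuous (max_upto z n).
Proof.
move=> cz; elim: n => [|n IH] x; first exact: cvg_cst.
exact: (@continuous_max _ _ (max_upto z n) (z n) x (IH x) (cz n x)).
Qed.

Lemma bump (a : E) : exists z : E -> R,
  [/\ continuous z, forall x, 0 <= z x <= 1, forall x, ball a 1 x -> z x = 1 &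
      forall x, ~ ball a 2 x -> z x = 0].
Proof.
pose A := ~` ball a 2; pose B : set E := ball a 1.
have sep : uniform_separator A B.
  apply: (@uniform_separatorW _ A B).
  exists [set xy | ball xy.1 1 xy.2]; first exact: (entourage_ball _ 1%:pos).
  apply/seteqP; split => // -[x y] /= [[nx By] xy]; apply: nx.
  by rewrite (_ : 2 = 1 + 1)//; apply: ball_triangle By _; exact: ball_sym.
exists (@Urysohn E R A B); split.
- exact: Urysohn_continuous.
- by move=> x; have := @Urysohn_range E R A B _ (ex_intro2 _ _ x I erefl); rewrite /= in_itv.
- by move=> x Bx; have /(_ _ (ex_intro2 _ _ x Bx erefl)) := (@Urysohn_sub1 E R A B sep).
- by move=> x Ax; have /(_ _ (ex_intro2 _ _ x Ax erefl)) := @Urysohn_sub0 E R A B sep.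
Qed.

(** The unit balls about a countable dense set cover the space, and the closed balls of radius 2
    about its points are compact; finite maxima of the corresponding bumps do the rest. *)
Lemma exists_cutoffs : @paper_space R E -> exists C eta, cutoffs C eta.
Proof.
move=> [_ [D [cD dD]] _ cb].
have [f finj] := elimT (countable_injP _) cD.
(* Inverts the enumeration of [D]. An index that is not hit yields the default [point], whose bump
   does no harm. *)
pose d i : E := xget point [set x | D x /\ f x = i].
have dE x : D x -> d (f x) = x.
  move=> Dx; rewrite /d; case: xgetP => [y _ [Dy fy]|/(_ x)[]//].
  by apply: finj; rewrite ?inE.
have [z zP] := choice (fun i => bump (d i)).
exists (fun n => \big[setU/set0]_(i < n) metric_closed_ball (d i) 2), (max_upto z).
have z01 n x : 0 <= max_upto z n x <= 1.
  elim: n => [|n /andP[h0 h1]] /=; first by rewrite lexx ler01.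
  have [_ /(_ x)/andP[z0 z1] _ _] := zP n.
  by rewrite le_max h0 ge_max h1 z1.
have zS n x : max_upto z n x <= max_upto z n.+1 x by rewrite /= le_max lexx.
split.
- by move=> n; apply: bigsetU_compact => i _; exact: cb.
- by move=> n; apply: max_upto_continuous => i; have [] := zP i.
- exact: z01.
- move=> n x; elim: n => [//|n IH]; rewrite big_ord_recr /= => nC.
  rewrite IH; last by move=> h; apply: nC; left.
  have [_ _ _ ->] := zP n; first by rewrite maxxx.
  by move=> xn; apply: nC; right => e e2; exact: le_ball (ltW e2) _ xn.
- split; first exact: zS.
  move=> x; have [| |y [/= yx Dy]] := dD (ball x 1)^°.
  + by exists x; apply: nbhsx_ballx.
  + exact: (@open_interior E).
  + have xy : ball (d (f y)) 1 x by rewrite (dE _ Dy); apply: ball_sym; exact: interior_subset.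
    apply: cvg_near_cst; exists (f y).+1 => // n /= fn.
    apply/eqP; rewrite eq_le (andP (z01 n x)).2 /=.
    move: fn => /subnK <-; elim: (n - _)%N => [|k IH].
      by rewrite add0n /= le_max; have [_ _ /(_ x xy) -> _] := zP (f y); rewrite lexx orbT.
    by rewrite addSn (le_trans IH).
Qed.

End Topology.

(** * Bounded convergence for functionals on bounded continuous functions *)

Section BoundedContinuous.
Context {R : realType} {E : pseudoPMetricType R}.

Definition Cb (phi : E -> R) := continuous phi /\ bdd_fun phi.

Lemma Cb_cst (c : R) : Cb (fun=> c).
Proof. by split; [move=> x; exact: cvg_cst | exists `|c|]. Qed.

Lemma CbD a b : Cb a -> Cb b -> Cb (fun x => a x + b x).
Proof.
move=> [ca [A bA]] [cb [B bB]]; split; first by move=> x; apply: cvgD; [exact: ca|exact: cb].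
by exists (A + B) => x; rewrite (le_trans (ler_normD _ _))// lerD.
Qed.

Lemma CbM a b : Cb a -> Cb b -> Cb (fun x => a x * b x).
Proof.
move=> [ca [A bA]] [cb [B bB]]; split; first by move=> x; apply: cvgM; [exact: ca|exact: cb].
by exists (A * B) => x; rewrite normrM ler_pM.
Qed.

Lemma CbN a : Cb a -> Cb (fun x => - a x).
Proof.
by move=> [ca [A bA]]; split; [move=> x; apply: cvgN; exact: ca|exists A => x; rewrite normrN].
Qed.

Lemma CbB a b : Cb a -> Cb b -> Cb (fun x => a x - b x).
Proof. by move=> Ca Cb_; apply: CbD => //; exact: CbN. Qed.

Lemma Cb_norm a : Cb a -> Cb (fun x => `|a x|).
Proof.
move=> [ca [A bA]]; split; first by move=> x; apply: cvg_norm; exact: ca.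
by exists A => x; rewrite normr_id.
Qed.

Lemma Cb_max a b : Cb a -> Cb b -> Cb (fun x => Num.max (a x) (b x)).
Proof.
move=> [ca [A bA]] [cb [B bB]]; split.
  by move=> x; exact: (@continuous_max _ _ a b x (ca x) (cb x)).
exists (Num.max A B) => x.
by rewrite le_max /Order.max; case: ifP; rewrite ?bA ?bB ?orbT.
Qed.

Lemma Cb_min a b : Cb a -> Cb b -> Cb (fun x => Num.min (a x) (b x)).
Proof.
move=> [ca [A bA]] [cb [B bB]]; split.
  by move=> x; exact: (@continuous_min _ _ a b x (ca x) (cb x)).
exists (Num.max A B) => x.
by rewrite le_max /Order.min; case: ifP; rewrite ?bA ?bB ?orbT.
Qed.

End BoundedContinuous.

Section Luxemburg.
Context {R : realType} {E : pseudoPMetricType R}.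
Variables (Lam : (E -> R) -> R) (phi : nat -> E -> R) (M : R).
Hypothesis Lam_le : forall a b, Cb a -> Cb b -> (forall x, a x <= b x) -> Lam a <= Lam b.
Hypothesis Lam_modular : forall a b, Cb a -> Cb b ->
  Lam (fun x => Num.max (a x) (b x)) + Lam (fun x => Num.min (a x) (b x)) = Lam a + Lam b.
Hypothesis Lam_tight : forall e : R, 0 < e -> exists2 C : set E, compact C &
  forall a (B c : R), Cb a -> 0 <= B -> 0 <= c -> (forall x, a x <= B) ->
    (forall x, C x -> a x <= c) -> Lam a <= c + e * B.
Hypothesis phi_Cb : forall k, Cb (phi k).
Hypothesis phi_bound : forall k x, 0 <= phi k x <= M.
Hypothesis phi_cvg : forall x, phi ^~ x @ \oo --> 0.

(** Says [psi <= sup_{n >= m} phi n] through upper bounds, so that the tail supremum, which need not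
    be continuous, is never formed. *)
Let below m (psi : E -> R) := Cb psi /\
  forall x c, (forall n, (m <= n)%N -> phi n x <= c) -> psi x <= c.
Let S m : set R := [set Lam psi | psi in below m].

Let M0 : 0 <= M.
Proof. by have /andP[h1 h2] := phi_bound 0 point; exact: le_trans h2. Qed.

Let below_phi m n : (m <= n)%N -> below m (phi n).
Proof. by move=> mn; split => // x c; exact. Qed.

Let below_leM m psi : below m psi -> forall x, psi x <= M.
Proof. by move=> [_ h] x; apply: h => n _; case/andP: (phi_bound n x). Qed.

Let below_mono m psi : below m.+1 psi -> below m psi.
Proof. by move=> [Cp h]; split => // x c hc; apply: h => n /ltnW; exact: hc. Qed.

Let S_ub m : has_ubound (S m).
Proof.
exists (Lam (fun=> M)) => _ [psi /[dup] bp [Cp _] <-].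
by apply: Lam_le => //; [exact: Cb_cst|exact: below_leM bp].
Qed.

Let S_sup m : has_sup (S m).
Proof. by split; [exists (Lam (phi m)), (phi m) => //; exact: below_phi|exact: S_ub]. Qed.

Let le_sup_S m psi : below m psi -> Lam psi <= sup (S m).
Proof. by move=> bp; apply: ub_le_sup => //; exists psi. Qed.

(* Luxemburg's elementary proof of the Arzela bounded convergence theorem: near-optimal
   continuous minorants of the tails sup_{n >= m} phi_n have near-optimal running minima by
   modularity, and those decrease to 0 uniformly on compact sets by Dini. *)
Lemma bounded_cvg_functional (e : R) : 0 < e ->
  exists N, forall n, (N <= n)%N -> Lam (phi n) < e.
Proof.
(* The defects [r / 2^(m+1)] add up to less than [r], and tightness together with Dini contributes
   [r + r M]; the total stays below [r (3 + M) = e]. *)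
move=> e0; pose r := e / (3 + M).
have r0 : 0 < r by rewrite divr_gt0// ltr_pwDl.
have exm m : exists psi, below m psi /\ sup (S m) - r * 2^-1 ^+ m.+1 < Lam psi.
  have [|_ [psi bp <-] lt] := @sup_adherent _ (S m) (r * 2^-1 ^+ m.+1) _ (S_sup m).
    by rewrite mulr_gt0// exprn_gt0.
  by exists psi.
have [psi psiP] := choice exm.
pose fix chi (m : nat) (x : E) {struct m} : R :=
  if m is m'.+1 then Num.min (chi m' x) (psi m x) else psi 0 x.
have chi_Cb m : Cb (chi m).
  by elim: m => [|m IH]; [case: (psiP 0) => -[]|apply: Cb_min => //; case: (psiP m.+1) => -[]].
have chi_psi m x : chi m x <= psi m x by case: m => //= m; rewrite ge_min lexx orbT.
have chi_below m : below m (chi m).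
  split => // x c hc; rewrite (le_trans (chi_psi m x))//.
  by have [[_ h] _] := psiP m; exact: h.
(* The maximum of [chi m] and [psi m.+1] is still below the tail from [m], so its value is at most
   [sup (S m)]. By modularity, passing to the minimum then costs only the defect of [psi m.+1]. *)
have chi_lb m : sup (S m) - r * (1 - 2^-1 ^+ m.+1) <= Lam (chi m).
  elim: m => [|m IH].
    have [_ /ltW] := psiP 0; apply: le_trans; rewrite expr1; lra.
  have [bp lt] := psiP m.+1.
  have : Lam (fun x => Num.max (chi m x) (psi m.+1 x)) <= sup (S m).
    apply: le_sup_S; split; first by apply: Cb_max => //; case: bp.
    move=> x c hc; rewrite ge_max; apply/andP; split; first exact: (chi_below m).2.
    exact: (below_mono bp).2.
  have := Lam_modular (chi_Cb m) bp.1.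
  move: lt IH; rewrite /= [_ ^+ m.+2]exprS; set q := _ ^+ m.+1; lra.
have [C cC CP] := Lam_tight r0.
pose v m x := Num.max (chi m x) 0.
have [|m x|x Cx|N NP] := @dini _ _ C v r cC r0.
- by move=> m; have [] := Cb_max (chi_Cb m) (Cb_cst 0).
- by rewrite /v ge_max !le_max lexx orbT andbT /= ge_min lexx.
- apply/cvgrPdist_le => d d0.
  have /cvgrPdist_le/(_ d d0)[N _ NP] := phi_cvg x.
  exists N => // m /= Nm; rewrite sub0r normrN ger0_norm ?le_max ?lexx ?orbT//.
  rewrite ge_max (ltW d0) andbT; apply: (chi_below m).2 => n mn.
  have := NP n (leq_trans Nm mn); rewrite /= sub0r normrN ger0_norm//.
  by case/andP: (phi_bound n x).
exists N => n Nn; rewrite (@le_lt_trans _ _ (sup (S N)))//.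
  by apply: le_sup_S; exact: below_phi.
have chN : Lam (chi N) <= r + r * M.
  apply: CP => //; [exact: ltW|exact: below_leM (chi_below N)|].
  by move=> x Cx; rewrite ltW// (le_lt_trans _ (NP N x _ Cx))// /v le_max lexx.
have rq0 : 0 < r * 2^-1 ^+ N.+1 by rewrite mulr_gt0// exprn_gt0.
have -> : e = r * 3 + r * M by rewrite -mulrDr /r divfK// gt_eqF// ltr_pwDl.
move: (chi_lb N) chN; rewrite mulrBr mulr1; lra.
Qed.

End Luxemburg.

Lemma ultrafilter_bounded_cvg {R : realType} (U : set_system nat) (b : nat -> R) (M : R) :
  UltraFilter U -> (forall n, `|b n| <= M) -> b @ U --> lim (b @ U).
Proof.
move=> UF bM; have PU := @ultra_proper _ _ UF.
have bs : (b @ U) [set` `[- M, M]].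
  by apply: (@filterE nat U) => n /=; rewrite in_itv /= -ler_norml; exact: bM.
have [l [_ cl]] := @segment_compact R (- M) M (b @ U) _ bs.
suff bl : b @ U --> l by apply/cvg_ex; exists l.
move=> V Vl; have [//|UnV] := in_ultra_setVsetC (b @^-1` V) UF.
by have [y []] := cl (~` V) V UnV Vl.
Qed.

(** * Ultrafilter limits of expectation functionals *)

Section AsymptoticEquality.
Context {R : realType} {E : pseudoPMetricType R}.

Definition expectation_functional (l : (E -> R) -> R) :=
  [/\ forall a b, Cb a -> Cb b -> (forall x, a x <= b x) -> l a <= l b,
      forall a b, Cb a -> Cb b -> l (fun x => a x + b x) = l a + l b &
      forall c, l (fun=> c) = c].

(** Tightness is phrased with test functions because it has to survive the passage to an ultrafilter
    limit, a functional that comes with no measure. *)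
Definition uniformly_tight (l : nat -> (E -> R) -> R) :=
  forall e : R, 0 < e -> exists2 C : set E, compact C &
    forall n a (B c : R), Cb a -> 0 <= B -> 0 <= c -> (forall x, a x <= B) ->
      (forall x, C x -> a x <= c) -> l n a <= c + e * B.

Lemma expectation_functional_norm l a (M : R) : expectation_functional l -> Cb a ->
  (forall x, `|a x| <= M) -> `|l a| <= M.
Proof.
move=> [lle ladd lcst] Ca aM; rewrite ler_norml; apply/andP; split.
  rewrite -[leLHS]lcst; apply: lle => //; first exact: Cb_cst.
  by move=> x; have := aM x; rewrite ler_norml => /andP[].
rewrite -[leRHS]lcst; apply: lle => //; first exact: Cb_cst.
by move=> x; have := aM x; rewrite ler_norml => /andP[].
Qed.

Lemma expectation_functional_dist l a b : expectation_functional l -> Cb a -> Cb b ->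
  `|l a - l b| <= l (fun x => `|a x - b x|).
Proof.
move=> [lle ladd lcst] Ca Cb_; have Cd := Cb_norm (CbB Ca Cb_).
rewrite ler_norml; apply/andP; split.
  rewrite lerBrDl -lerBrDr opprK -ladd//; apply: lle => //; first exact: CbD.
  by move=> x; have := ler_norm (b x - a x); rewrite distrC; lra.
rewrite lerBlDl -ladd//; apply: lle => //; first exact: CbD.
by move=> x; have := ler_norm (a x - b x); lra.
Qed.

Section UltraLimit.
Variables (U : set_system nat) (UF : UltraFilter U).
Variable l : nat -> (E -> R) -> R.
Hypothesis l_exp : forall n, expectation_functional (l n).
Hypothesis l_tight : uniformly_tight l.

(** The limit of the functionals along [U] inherits order, modularity and tightness, so bounded
    convergence holds for it. The strict inequality for the limit then passes back, for each fixed
    [k], to [U]-many [n]. *)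
Lemma ultra_limit_small (phi : nat -> E -> R) (M e : R) :
  (forall k, Cb (phi k)) -> (forall k x, 0 <= phi k x <= M) ->
  (forall x, phi ^~ x @ \oo --> 0) -> 0 < e ->
  exists N, forall k, (N <= k)%N -> \forall n \near U, l n (phi k) < e.
Proof.
have PU := @ultra_proper _ _ UF.
move=> phiC phiM phi0 e0; pose Lam a := lim (l n a @[n --> U]).
have cvL a : Cb a -> l n a @[n --> U] --> Lam a.
  move=> /[dup] Ca [_ [B aB]]; apply: (@ultrafilter_bounded_cvg _ _ _ B) => n.
  exact: expectation_functional_norm.
have [|||N NP] := @bounded_cvg_functional _ _ Lam phi M _ _ _ phiC phiM phi0 e e0.
- move=> a b Ca Cb_ ab; apply: ler_cvg_to (cvL a Ca) (cvL b Cb_) _.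
  by apply: nearW => n; have [h _ _] := l_exp n; exact: h.
- move=> a b Ca Cb_; have Cmx := Cb_max Ca Cb_; have Cmn := Cb_min Ca Cb_.
  have h1 : l n (fun x => Num.max (a x) (b x)) + l n (fun x => Num.min (a x) (b x)) @[n --> U]
      --> Lam (fun x => Num.max (a x) (b x)) + Lam (fun x => Num.min (a x) (b x)).
    by apply: cvgD; exact: cvL.
  have h2 : l n a + l n b @[n --> U] --> Lam a + Lam b by apply: cvgD; exact: cvL.
  rewrite -(cvg_lim (@Rhausdorff R) h1) -(cvg_lim (@Rhausdorff R) h2).
  congr (lim (_ @ U)); apply/funext => n /=; have [_ h _] := l_exp n.
  by rewrite -!h//; congr (l n _); apply/funext => x; rewrite addr_max_min.
- move=> r r0; have [C cC CP] := l_tight r0; exists C => // a B c Ca B0 c0 aB ac.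
  apply: limr_le; first by apply/cvg_ex; exists (Lam a); exact: cvL.
  by apply: nearW => n; exact: CP.
- exists N => k Nk; have /cvgrPdist_lt := cvL _ (phiC k).
  have d0 : 0 < e - Lam (phi k) by rewrite subr_gt0; exact: NP.
  move=> /(_ _ d0); apply: filterS => n; rewrite ltr_norml => /andP[]; lra.
Qed.

End UltraLimit.

(** The index [k] is fixed before [n], so no uniformity in [n] of the convergence of [gk] is
    claimed. The three errors are each below [e / 3] for [U]-many [n]: two by bounded convergence
    for the limit functionals, the third because [U] refines the eventual filter. One good [n] is
    enough for the argument by contradiction that this serves. *)
Lemma asymptotically_equal (l l' : nat -> (E -> R) -> R) (gk : nat -> E -> R) (g : E -> R)
    (M e : R) :
  (forall n, expectation_functional (l n)) -> (forall n, expectation_functional (l' n)) ->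
  uniformly_tight l -> uniformly_tight l' ->
  Cb g -> (forall k, Cb (gk k)) -> (forall k x, `|gk k x - g x| <= M) ->
  (forall x, gk ^~ x @ \oo --> g x) ->
  (forall k, l n (gk k) - l' n (gk k) @[n --> \oo] --> 0) ->
  0 < e -> exists n, `|l n g - l' n g| < e.
Proof.
move=> le le' lt lt' Cg Cgk gM gkg ll' e0.
have [U [UF ooU]] := ultraFilterLemma (@eventually_filter).
have PU := @ultra_proper _ _ UF.
have e3 : 0 < e / 3 by rewrite divr_gt0.
pose phi k x := `|gk k x - g x|.
have phiC k : Cb (phi k) by exact: Cb_norm (CbB _ _).
have phiM k x : 0 <= phi k x <= M by rewrite /phi normr_ge0 gM.
have phi0 x : phi ^~ x @ \oo --> 0.
  by rewrite -(normr0 R) -(subrr (g x)); apply: cvg_norm; apply: cvgB => //; exact: cvg_cst.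
have [N NP] := ultra_limit_small UF le lt phiC phiM phi0 e3.
have [N' NP'] := ultra_limit_small UF le' lt' phiC phiM phi0 e3.
pose k := maxn N N'.
have /cvgrPdist_lt/(_ _ e3)/ooU h := ll' k.
have /filter_ex[n [[h1 h2] h3]] : U (([set n | l n (phi k) < e / 3] `&`
    [set n | l' n (phi k) < e / 3]) `&` [set n | `|0 - (l n (gk k) - l' n (gk k))| < e / 3]).
  apply: filterI => //; apply: filterI; [apply: NP|apply: NP'].
    exact: leq_maxl.
  exact: leq_maxr.
exists n; move: h3 => /=; rewrite sub0r normrN => h3.
have d1 := expectation_functional_dist (le n) (Cgk k) Cg.
have d2 := expectation_functional_dist (le' n) (Cgk k) Cg.
move: h1 h2 h3 (le_trans d1 (lexx (l n (phi k)))) (le_trans d2 (lexx (l' n (phi k)))) => /=.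
rewrite !ltr_norml !ler_norml => h1 h2 /andP[? ?] /andP[? ?] /andP[? ?].
apply/andP; split; lra.
Qed.

End AsymptoticEquality.

(** * Layer-cake approximation of functions with values in the unit interval *)

Section LayerCake.
Context d (T : measurableType d) (R : realType).

Lemma count_levels (N : nat) (y : R) : 0 <= y -> y <= N%:R ->
  `|\sum_(i < N) (i.+1%:R <= y)%R%:R - y| <= 1.
Proof.
move=> y0 yN; have : [/\ \sum_(i < N) (i.+1%:R <= y)%R%:R <= y,
    \sum_(i < N) (i.+1%:R <= y)%R%:R <= N%:R :> R &
    y - 1 <= \sum_(i < N) (i.+1%:R <= y)%R%:R \/ \sum_(i < N) (i.+1%:R <= y)%R%:R = N%:R :> R].
  elim: N {yN} => [|N [h1 h2 h3]]; first by rewrite big_ord0; split => //; right.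
  rewrite big_ord_recr /=; set S := \sum_(_ < _) _ in h1 h2 h3 *.
  have NS : N.+1%:R = N%:R + 1 :> R by rewrite -addn1 natrD.
  have [] := leP N.+1%:R y => /=; rewrite !NS => Ny.
    by split; [lra|lra|case: h3 => h3; [left; lra|right; rewrite h3]].
  by split; [lra|lra|left; case: h3 => h3; lra].
move=> [h1 h2 h3]; rewrite ler_norml; apply/andP; split; last lra.
by case: h3 => [|->]; lra.
Qed.

(** Total variation and the measurability of the kernel are given on sets; averages of indicators of
    level sets carry them over to functions, with uniform error [1/(n+1)]. The weights add up to 1,
    so a bound valid for all sets passes to functions without loss in the constant. *)
Definition layers (phi : T -> R) (n : nat) (x : T) : R :=
  n.+1%:R^-1 * \sum_(i < n.+1) \1_[set y | i.+1%:R / n.+1%:R <= phi y] x.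

Variable phi : T -> R.
Hypothesis mphi : measurable_fun setT phi.
Hypothesis phi01 : forall x, 0 <= phi x <= 1.

Lemma measurable_level (c : R) : measurable [set y | c <= phi y].
Proof.
have := mphi measurableT (measurable_itv `[c, +oo[).
by rewrite setTI; congr measurable; apply/seteqP; split => y /=; rewrite in_itv /= andbT.
Qed.

Lemma layers_dist n x : `|layers phi n x - phi x| <= n.+1%:R^-1.
Proof.
have n0 : 0 < n.+1%:R :> R by rewrite ltr0n.
have := @count_levels n.+1 (phi x * n.+1%:R) _ _.
have /andP[p0 p1] := phi01 x.
move=> /(_ (mulr_ge0 p0 (ltW n0))); rewrite ger_pMl// => /(_ p1) h.
have -> : layers phi n x - phi x =
    n.+1%:R^-1 * (\sum_(i < n.+1) (i.+1%:R <= phi x * n.+1%:R)%R%:R - phi x * n.+1%:R).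
  rewrite mulrBr [_ * (phi x * _)]mulrC mulfK ?lt0r_neq0//; congr (_ * _ - _).
  apply: eq_bigr => i _; rewrite indicE -ler_pdivrMr//; congr (nat_of_bool _)%:R.
  by apply/idP/idP; rewrite inE.
rewrite normrM ger0_norm ?invr_ge0 ?(ltW n0)//.
by rewrite -[leRHS]mulr1 ler_wpM2l// invr_ge0 ltW.
Qed.

Lemma layers_bmeas n : bmeas (layers phi n).
Proof.
apply: bmeasM; first exact: bmeas_cst.
by apply: bmeas_sum => i; apply: bmeas_indic; exact: measurable_level.
Qed.

Lemma layers_cvg x : layers phi ^~ x @ \oo --> phi x.
Proof.
apply/cvgrPdist_le => e e0.
have /cvgrPdist_le/(_ e e0) : n.+1%:R^-1 @[n --> \oo] --> (0 : R) by exact: cvg_harmonic.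
apply: filterS => n; rewrite sub0r normrN ger0_norm ?invr_ge0// => ne.
by rewrite distrC (le_trans (layers_dist n x)).
Qed.

Lemma cvg_expect_layers (P : probability T R) :
  \int[P]_x layers phi n x @[n --> \oo] --> \int[P]_x phi x.
Proof.
apply: (@cvg_expect _ _ _ _ _ _ 2) => [n|n x|x]; last exact: layers_cvg.
  exact: (layers_bmeas n).1.
have := layers_dist n x; have /andP[p0 p1] := phi01 x.
have : n.+1%:R^-1 <= 1 :> R by rewrite invf_le1 ?ltr0n// ler1n.
rewrite !ler_norml; move: (layers _ _ _) (_^-1) p0 p1 => a b p0 p1 n1 /andP[? ?].
by apply/andP; split; lra.
Qed.

Lemma expect_layers (P : probability T R) n : \int[P]_x layers phi n x =
  n.+1%:R^-1 * \sum_(i < n.+1) fine (P [set y | i.+1%:R / n.+1%:R <= phi y]).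
Proof.
have bi i : bmeas (\1_[set y | i%:R / n.+1%:R <= phi y] : T -> R).
  by apply: bmeas_indic; exact: measurable_level.
rewrite expectZ; last by apply: bmeas_sum => i; exact: bi.
rewrite expect_sum; last by move=> i; exact: bi.
by congr (_ * _); apply: eq_bigr => i _; rewrite expect_indic//; exact: measurable_level.
Qed.

End LayerCake.

(** * Stopping times and the strong Markov property *)

Lemma continuous_borel_measurable {R : realType} {E : ptopologicalType} (phi : E -> R) :
  continuous phi -> measurable_fun [set: borelE E] (phi : borelE E -> R).
Proof.
move=> /continuousP cphi; apply: (measurability _ (RGenOpens.measurableE R)).
move=> _ [_ [a [b ->] <-]]; rewrite setTI; apply: sub_sigma_algebra.
exact/cphi/interval_open.
Qed.

Section Semigroup.
Context {R : realType} {E : pseudoPMetricType R} {d : measure_display}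
  {Omega : measurableType d}.
Variables (P : E -> probability Omega R) (X : R -> Omega -> E)
  (F : R -> set (set Omega)).
Hypothesis PS : @paper_space R E.
Hypothesis SM : standard_markov P X F.
Implicit Types (phi : E -> R) (s t : R) (x : E).
Notation Pt t phi := (sgrpR P X t phi).

Lemma Cb_borel phi : Cb phi -> borel_bounded phi.
Proof. by move=> [cphi bphi]; split=> //; exact: continuous_borel_measurable. Qed.

Lemma filtration_measurable t A : 0 <= t -> F t A -> measurable A.
Proof. by case: SM => [SF _] /SF[_]; exact. Qed.

Lemma filtration_mono s t A : 0 <= s -> s <= t -> F s A -> F t A.
Proof. by case: SM => [_ [Fm _]] s0 st; exact: Fm. Qed.

Lemma filtrationT t : 0 <= t -> F t setT.
Proof.
case: SM => [SF _] /SF[[F0 FC _] _].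
by rewrite -(setD0 setT); exact: FC.
Qed.

Lemma filtrationC t A : 0 <= t -> F t A -> F t (~` A).
Proof.
by case: SM => [SF _] /SF[[F0 FC _] _] FA; rewrite -setTD; exact: FC.
Qed.

Lemma filtration_bigcup t (A : nat -> set Omega) : 0 <= t -> (forall i, F t (A i)) ->
  F t (\bigcup_i A i).
Proof. by case: SM => [SF _] /SF[[_ _ FU] _]; exact: FU. Qed.

Lemma filtration0 t : 0 <= t -> F t set0.
Proof. by case: SM => [SF _] /SF[[]]. Qed.

Lemma adapted t (A : set E) : 0 <= t -> @measurable _ (borelE E) A -> F t (X t @^-1` A).
Proof. by case: SM => _ [_ [_ [Fa _]]] t0 mA; exact: Fa. Qed.

Lemma path_right_continuous w t : 0 <= t -> X s w @[s --> t^'+] --> X t w.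
Proof. by case: SM => _ [_ [_ [_ [Xr _]]]] t0; exact: Xr. Qed.

Lemma borel_comp_measurable t phi : 0 <= t ->
  measurable_fun [set: borelE E] (phi : borelE E -> R) ->
  measurable_fun setT (fun w => phi (X t w)).
Proof.
move=> t0 mphi _ Y mY; rewrite setTI; apply: (@filtration_measurable t) => //.
rewrite -[X in F t X]/(X t @^-1` (phi @^-1` Y)); apply: adapted => //.
by have := mphi measurableT _ mY; rewrite setTI.
Qed.

Lemma bmeas_comp t phi : 0 <= t -> borel_bounded phi -> bmeas (fun w => phi (X t w)).
Proof.
move=> t0 [mphi [M bM]]; split; first exact: borel_comp_measurable.
by exists M => w; exact: bM.
Qed.

Lemma sgrpRE t phi x : Pt t phi x = \int[P x]_w phi (X t w).
Proof. by []. Qed.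

Lemma EFin_sgrpR t phi x : 0 <= t -> borel_bounded phi -> sgrp P X t phi x = (Pt t phi x)%:E.
Proof. by move=> t0 bphi; rewrite sgrpRE -EFin_expect//; exact: bmeas_comp. Qed.

Lemma sgrpR_bound t phi (M : R) x : 0 <= t -> borel_bounded phi ->
  (forall y, `|phi y| <= M) -> `|Pt t phi x| <= M.
Proof. by move=> t0 bphi bM; apply: norm_expect_le => //; exact: bmeas_comp. Qed.

Lemma sgrpR_cst t (c : R) x : Pt t (fun=> c) x = c.
Proof. by rewrite sgrpRE expect_cst. Qed.

Lemma sgrpRD t phi psi x : 0 <= t -> borel_bounded phi -> borel_bounded psi ->
  Pt t (fun y => phi y + psi y) x = Pt t phi x + Pt t psi x.
Proof. by move=> t0 b1 b2; rewrite !sgrpRE expectD//; exact: bmeas_comp. Qed.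

Lemma sgrpRB t phi psi x : 0 <= t -> borel_bounded phi -> borel_bounded psi ->
  Pt t (fun y => phi y - psi y) x = Pt t phi x - Pt t psi x.
Proof. by move=> t0 b1 b2; rewrite !sgrpRE expectB//; exact: bmeas_comp. Qed.

Lemma sgrpRZ t (c : R) phi x : 0 <= t -> borel_bounded phi ->
  Pt t (fun y => c * phi y) x = c * Pt t phi x.
Proof. by move=> t0 b1; rewrite !sgrpRE expectZ//; exact: bmeas_comp. Qed.

Lemma le_sgrpR t phi psi x : 0 <= t -> borel_bounded phi -> borel_bounded psi ->
  (forall y, phi y <= psi y) -> Pt t phi x <= Pt t psi x.
Proof.
by move=> t0 b1 b2 le12; rewrite !sgrpRE; apply: le_expect => //; exact: bmeas_comp.
Qed.

Lemma cvg_sgrpR t (phin : nat -> E -> R) phi (M : R) x : 0 <= t ->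
  (forall n, measurable_fun [set: borelE E] (phin n : borelE E -> R)) ->
  (forall n y, `|phin n y| <= M) ->
  (forall y, phin ^~ y @ \oo --> phi y) -> Pt t (phin n) x @[n --> \oo] --> Pt t phi x.
Proof.
move=> t0 mphi bphi cphi; apply: (@cvg_expect _ _ _ _ _ _ M) => // n.
exact: borel_comp_measurable.
Qed.

Lemma sgrpR_indic_measurable t (A : set (borelE E)) : 0 <= t -> measurable A ->
  measurable_fun [set: borelE E] (fun x : borelE E => Pt t (\1_A : E -> R) x).
Proof.
move=> t0 mA; case: SM => _ [_ [_ [Fa [_ [_ [mtr _]]]]]].
rewrite (_ : (fun _ => _) = fine \o (fun x : borelE E => trans P X t x A)).
  apply: measurableT_comp; first exact: fine_measurable.
  exact: mtr.
apply/funext => x; rewrite sgrpRE /= /trans.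
rewrite -expect_indic//; last exact: filtration_measurable t0 (adapted t0 mA).
Qed.

Lemma sgrpR_unit_measurable t phi : 0 <= t ->
  measurable_fun [set: borelE E] (phi : borelE E -> R) -> (forall y, 0 <= phi y <= 1) ->
  measurable_fun [set: borelE E] (fun x : borelE E => Pt t phi x).
Proof.
move=> t0 mphi p01.
apply: (@measurable_fun_cvg _ (borelE E) R setT
    (fun n x => Pt t (layers (phi : borelE E -> R) n) x)).
  move=> n; rewrite (_ : (fun _ => _) = (fun x => n.+1%:R^-1 *
      \sum_(i < n.+1) Pt t (\1_[set y | i.+1%:R / n.+1%:R <= phi y] : E -> R) x)).
    apply: measurable_funM => //; apply: measurable_sum => i.
    by apply: sgrpR_indic_measurable => //; exact: (@measurable_level _ (borelE E)).
  have bi i : borel_bounded (\1_[set y | i%:R / n.+1%:R <= phi y] : E -> R).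
    apply: (@bmeas_indic _ (borelE E)).
    exact: (@measurable_level _ (borelE E)).
  apply/funext => x; rewrite sgrpRZ//; last first.
    by apply: (@bmeas_sum _ (borelE E)) => i; exact: bi.
  rewrite sgrpRE expect_sum//.
  by move=> i; apply: bmeas_comp.
move=> x _; apply: (@cvg_sgrpR _ _ _ 2) => //.
- by move=> n; exact: (layers_bmeas (T := borelE E) mphi n).1.
- move=> n y; have := @layers_dist _ (borelE E) R phi p01 n y; have /andP[p0 p1] := p01 y.
  have : n.+1%:R^-1 <= 1 :> R by rewrite invf_le1 ?ltr0n// ler1n.
  rewrite !ler_norml; move: (layers _ _ _) (_^-1) p0 p1 => a b p0 p1 n1 /andP[? ?].
  by apply/andP; split; lra.
- by move=> y; exact: (@layers_cvg _ (borelE E)).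
Qed.

Lemma unit_rescale phi : borel_bounded phi -> exists (M : R) (psi : E -> R),
  [/\ 0 < M, measurable_fun [set: borelE E] (psi : borelE E -> R),
      forall y, 0 <= psi y <= 1 & phi = (fun y => 2 * M * psi y - M)].
Proof.
move=> [mphi [M0 bM0]]; pose M := `|M0| + 1; have M_gt0 : 0 < M by rewrite ltr_pwDr.
have bM y : `|phi y| <= M by rewrite (le_trans (bM0 y))// /M (le_trans (ler_norm _))// lerDl.
exists M, (fun y => (2 * M)^-1 * (phi y + M)); split => //.
- by apply: measurable_funM => //; exact: measurable_funD.
- move=> y; have := bM y; rewrite ler_norml => /andP[h1 h2].
  rewrite mulr_ge0 ?invr_ge0 ?mulr_ge0 ?(ltW M_gt0)//=; last lra.
  by rewrite mulrC ler_pdivrMr ?mulr_gt0// mul1r; lra.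
- apply/funext => y; rewrite mulrA mulfV ?mul1r ?addrK// mulf_neq0 ?lt0r_neq0//.
Qed.

Lemma sgrpR_borel t phi : 0 <= t -> borel_bounded phi -> borel_bounded (Pt t phi).
Proof.
move=> t0 bphi; split; last first.
  by have [M bM] := bphi.2; exists M => x; exact: sgrpR_bound.
have [M [psi [M0 mpsi psi01 ->]]] := unit_rescale bphi.
have bpsi : borel_bounded psi.
  split => //; exists 1 => y; have /andP[p0 p1] := psi01 y.
  by rewrite ger0_norm.
rewrite (_ : sgrpR P X t _ = (fun x => 2 * M * Pt t psi x - M)).
  by apply: measurable_funB => //; apply: measurable_funM => //; exact: sgrpR_unit_measurable.
apply/funext => x; rewrite sgrpRB//; first by rewrite sgrpRZ// sgrpR_cst.
  by apply: (@bmeasM _ (borelE E)) => //; exact: (@bmeas_cst _ (borelE E)).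
exact: (@bmeas_cst _ (borelE E)).
Qed.

Lemma sgrpR0 phi x : borel_bounded phi -> Pt 0 phi x = phi x.
Proof.
move=> bphi; case: SM => _ [_ [_ [_ [_ [X0 _]]]]].
have [hE _ _ _] := PS.
have mx : measurable [set w | X 0 w = x].
  apply: (@filtration_measurable 0) => //.
  rewrite -[X in F 0 X]/(X 0 @^-1` [set x]); apply: adapted => //.
  (* In a Hausdorff space the singleton is closed, hence Borel, so the event of full mass [X 0 = x]
     is measurable. *)
  rewrite -(setCK [set x]); apply: measurableC; apply: sub_sigma_algebra.
  rewrite openC; exact: accessible_closed_set1 (hausdorff_accessible hE) x.
have bc : bmeas (fun w => phi (X 0 w)) by exact: bmeas_comp.
rewrite sgrpRE -[RHS](expect_cst (P x)) /Rintegral; congr fine.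
apply: ae_eq_integral => //.
- by apply/measurable_EFinP; exact: bc.1.
exists (~` [set w | X 0 w = x]); split; first exact: measurableC.
  by have := probability_setC (P x) mx; rewrite X0 subee.
by move=> w /= nw; apply: contra_not nw => -> _.
Qed.

(** Finite stopping times, kept in [R]: the value turns out to be a supremum over bounded ones. *)
Definition rst (sigma : Omega -> R) := (forall w, 0 <= sigma w) /\
  forall t, 0 <= t -> F t [set w | sigma w <= t].

Lemma rst_cst t : 0 <= t -> rst (fun=> t).
Proof.
move=> t0; split=> // s s0; have [ts|st] := leP t s.
  by rewrite (_ : [set _ | _] = setT); [exact: filtrationT|apply/seteqP].
rewrite (_ : [set _ | _] = set0); first exact: filtration0.
by apply/seteqP; split => // w.
Qed.

Lemma rst_min sigma t : 0 <= t -> rst sigma -> rst (fun w => Num.min (sigma w) t).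
Proof.
move=> t0 [s0 sF]; split=> [w|s s_ge0]; first by rewrite le_min s0.
have [ts|st] := leP t s.
  rewrite (_ : [set _ | _] = setT); first exact: filtrationT.
  by apply/seteqP; split => // w _ /=; rewrite ge_min ts orbT.
rewrite (_ : [set _ | _] = [set w | sigma w <= s]); first exact: sF.
by apply/seteqP; split => w /=; rewrite ge_min [t <= s]leNgt st orbF.
Qed.

Lemma strong_markov_raw sigma (A : set Omega) s phi x : rst sigma -> measurable A ->
  (forall t, 0 <= t -> F t (A `&` [set w | sigma w <= t])) ->
  0 <= s -> borel_bounded phi ->
  \int[P x]_(w in A) phi (X (sigma w + s) w) =
  \int[P x]_(w in A) Pt s phi (X (sigma w) w).
Proof.
move=> [s0 sF] mA FA s_ge0 bphi.
case: SM => _ [_ [_ [_ [_ [_ [_ [/(_ x (EFin \o sigma)) MK _]]]]]]].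
have st : stopping_time F (EFin \o sigma).
  split=> [w|t t0]; first by rewrite /= lee_fin.
  rewrite (_ : [set _ | _] = [set w | sigma w <= t]); first exact: sF.
  by apply/seteqP; split => w /=; rewrite lee_fin.
have FatA : F_at F (EFin \o sigma) A by split.
have := MK st A FatA s s_ge0 phi bphi.
rewrite (_ : A `&` _ = A); last by apply/seteqP; split => [w []//|w Aw]; split => //=; rewrite ltry.
move=> /(congr1 fine) e; rewrite [LHS]e; congr fine.
by apply: eq_integral => w _; rewrite EFin_sgrpR.
Qed.

Lemma Rintegral_indic (m : probability Omega R) (A : set Omega) (Z : Omega -> R) :
  \int[m]_(w in A) Z w = \int[m]_w (\1_A w * Z w).
Proof.
rewrite Rintegral_mkcond; apply: eq_Rintegral => w _.
by rewrite /patch indicE; case: (w \in A); rewrite ?mul1r ?mul0r.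
Qed.

Lemma markov t s (A : set Omega) phi x : 0 <= t -> 0 <= s -> F t A -> borel_bounded phi ->
  \int[P x]_w (\1_A w * phi (X (t + s) w)) = \int[P x]_w (\1_A w * Pt s phi (X t w)).
Proof.
move=> t0 s0 FA bphi; rewrite -!Rintegral_indic.
apply: (@strong_markov_raw (fun=> t)) => //; first exact: rst_cst.
  exact: filtration_measurable FA.
move=> u u0 /=; have [tu|ut] := leP t u.
  by rewrite (_ : [set w : Omega | true] = setT) ?setIT; [exact: filtration_mono FA|apply/seteqP].
rewrite (_ : [set w : Omega | false] = set0) ?setI0; first exact: filtration0.
by apply/seteqP; split.
Qed.

Lemma sgrpR_comp t s phi x : 0 <= t -> 0 <= s -> borel_bounded phi ->
  Pt (t + s) phi x = Pt t (Pt s phi) x.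
Proof.
move=> t0 s0 bphi; have := @markov t s setT phi x t0 s0 (filtrationT t0) bphi.
by rewrite -!Rintegral_indic.
Qed.

Lemma comp_path_right_continuous phi w t : continuous phi -> 0 <= t ->
  phi (X s w) @[s --> t^'+] --> phi (X t w).
Proof.
move=> cphi t0; apply: continuous_cvg; first exact: cphi.
exact: path_right_continuous.
Qed.

Lemma sgrpR_right_continuous phi x t : Cb phi -> 0 <= t ->
  Pt s phi x @[s --> t^'+] --> Pt t phi x.
Proof.
move=> Cphi t0; have [_ [M bM]] := Cphi.
apply/cvg_at_rightP => u [ut cu]; apply: (@cvg_expect _ _ _ _ _ _ M) => // [n|w].
  apply: borel_comp_measurable; first exact: ltW (le_lt_trans t0 (ut n)).
  exact: (Cb_borel Cphi).1.
have /cvg_at_rightP := comp_path_right_continuous (w := w) Cphi.1 t0.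
by move=> /(_ u); apply.
Qed.

End Semigroup.

(** * Rounding up to a time grid *)

Section CeilGrid.
Context {R : realType}.
Implicit Types s dl : R.

(** Times are rounded up, since this keeps them stopping times and lets them approach the original
    from the right, where the paths are continuous. *)
Definition ceil_grid dl s : nat := `|Num.ceil (s / dl)|%N.

Lemma ceil_grid_le dl s j : 0 < dl -> 0 <= s -> (ceil_grid dl s <= j)%N = (s <= j%:R * dl).
Proof.
move=> d0 s0; rewrite /ceil_grid -lez_nat gez0_abs; last first.
  by rewrite ceil_ge0 (lt_le_trans (ltrN10 R))// divr_ge0// ltW.
by rewrite ceil_le_int ler_pdivrMr.
Qed.

Lemma le_ceil_grid dl s : 0 < dl -> 0 <= s -> s <= (ceil_grid dl s)%:R * dl.
Proof. by move=> d0 s0; rewrite -ceil_grid_le. Qed.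

Lemma ceil_grid_lt dl s : 0 < dl -> 0 <= s -> (ceil_grid dl s)%:R * dl < s + dl.
Proof.
move=> d0 s0; case e : (ceil_grid dl s) => [|k]; first by rewrite mul0r ltr_wpDl.
have : ~~ (ceil_grid dl s <= k)%N by rewrite e ltnn.
by rewrite ceil_grid_le// -ltNge -addn1 natrD mulrDl mul1r ltrD2r.
Qed.

Lemma ceil_grid_natmul dl n : 0 < dl -> ceil_grid dl (n%:R * dl) = n.
Proof.
move=> d0; have nd0 : 0 <= n%:R * dl by rewrite mulr_ge0// ltW.
apply/eqP; rewrite eqn_leq ceil_grid_le// lexx /=.
by have := le_ceil_grid d0 nd0; rewrite ler_pM2r// ler_nat.
Qed.

Lemma ceil_grid_dist dl s : 0 < dl -> 0 <= s -> `|s - (ceil_grid dl s)%:R * dl| <= dl.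
Proof.
move=> d0 s0; have := le_ceil_grid d0 s0; have := ceil_grid_lt d0 s0.
by move=> h1 h2; rewrite ler0_norm; lra.
Qed.

Lemma right_continuous_seq (u : R -> R) (s : R) (q : nat -> R) :
  u x @[x --> s^'+] --> u s -> (forall n, s <= q n) -> q @ \oo --> s ->
  u (q n) @[n --> \oo] --> u s.
Proof.
move=> cu sq cq; apply/cvgrPdist_lt => e e0.
have /cvgrPdist_lt/(_ e e0) := cu; rewrite near_withinE => -[r /= r0 ru].
have /cvgrPdist_lt/(_ r r0) := cq; apply: filterS => n qr.
have [->|sneq] := eqVneq (q n) s; first by rewrite subrr normr0.
by apply: ru => //=; rewrite lt_neqAle eq_sym sneq sq.
Qed.

Lemma ceil_grid_cvg s : 0 <= s ->
  (ceil_grid n.+1%:R^-1 s)%:R * n.+1%:R^-1 @[n --> \oo] --> s.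
Proof.
move=> s0; apply/cvgrPdist_lt => r r0.
have /cvgrPdist_lt/(_ r r0) : n.+1%:R^-1 @[n --> \oo] --> (0 : R) by exact: cvg_harmonic.
apply: filterS => n; rewrite sub0r normrN ger0_norm ?invr_ge0// => nr.
by rewrite (le_lt_trans _ nr)// ceil_grid_dist// invr_gt0.
Qed.

End CeilGrid.

(** * Feller continuity, potentials and stopped processes *)

Section Feller.
Context {R : realType} {E : pseudoPMetricType R} {d : measure_display}
  {Omega : measurableType d}.
Variables (P : E -> probability Omega R) (X : R -> Omega -> E)
  (F : R -> set (set Omega)).
Hypothesis PS : @paper_space R E.
Hypothesis SM : standard_markov P X F.
Hypothesis WF : weak_feller P X.
Implicit Types (phi : E -> R) (s t : R) (x : E).
Notation Pt t phi := (sgrpR P X t phi).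
Notation leb := (@lebesgue_measure R).

Lemma cutoff_C0 (C : set E) (eta phi : E -> R) : compact C -> continuous eta ->
  (forall x, 0 <= eta x <= 1) -> (forall x, ~ C x -> eta x = 0) -> Cb phi ->
  C0 (fun x => eta x * phi x).
Proof.
move=> cC ceta e01 e0 Cphi.
have Ceta : Cb eta by split => //; exists 1 => x; have /andP[? ?] := e01 x; rewrite ger0_norm.
have [c b] := CbM Ceta Cphi; split => // e e_gt0; exists C; split => // x nC.
by rewrite (e0 _ nC) mul0r normr0.
Qed.

(** The weak Feller property speaks of functions vanishing at infinity. Replacing [phi] by
    [eta k * phi] costs at most [M (1 - Pt t (eta k))], and this bound is itself continuous: small
    at [x], it stays small near [x]. *)
Lemma sgrpR_Cb t phi : 0 <= t -> Cb phi -> Cb (Pt t phi).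
Proof.
move=> t0 Cphi; have [C [eta [cC ceta eta01 eta0 [etaS eta1]]]] := exists_cutoffs PS.
have bphi := Cb_borel Cphi; split; last exact: (sgrpR_borel SM t0 bphi).2.
have [_ [M0 bM0]] := Cphi; pose M := `|M0| + 1; have M_gt0 : 0 < M by rewrite ltr_pwDr.
have bM y : `|phi y| <= M by rewrite (le_trans (bM0 y))// /M (le_trans (ler_norm _))// lerDl.
have Ceta k : Cb (eta k).
  by split => //; exists 1 => y; have /andP[? ?] := eta01 k y; rewrite ger0_norm.
have Feta k : continuous (Pt t (eta k)).
  have := cutoff_C0 (cC k) (ceta k) (eta01 k) (eta0 k) (Cb_cst 1) => /(WF t0)[+ _ _].
  by rewrite (_ : (fun x => _) = eta k)//; apply/funext => y; rewrite mulr1.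
have Fphi k : continuous (Pt t (fun y => eta k y * phi y)).
  by have [] := WF t0 (cutoff_C0 (cC k) (ceta k) (eta01 k) (eta0 k) Cphi).
have dist k y : `|Pt t phi y - Pt t (fun y => eta k y * phi y) y| <= M * (1 - Pt t (eta k) y).
  rewrite -(sgrpRB SM)//; last by apply: Cb_borel; exact: CbM.
  rewrite -[1](@sgrpR_cst _ _ _ _ P X t 1 y) -(sgrpRB SM)//; [|exact: Cb_borel (Cb_cst 1)|exact: Cb_borel].
  rewrite -(sgrpRZ SM)//; last by apply: Cb_borel; apply: CbB => //; exact: Cb_cst.
  have b1 : bmeas (fun w => phi (X t w) - eta k (X t w) * phi (X t w)).
    apply: (bmeas_comp SM t0 (phi := fun z => phi z - eta k z * phi z)).
    by apply: Cb_borel; apply: CbB => //; exact: CbM.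
  rewrite (le_trans (le_normr_Rintegral _ _))//; first exact: bmeas_integrable.
  apply: le_expect; first exact: bmeas_norm.
    apply: (bmeas_comp SM t0 (phi := fun z => M * (1 - eta k z))).
    by apply: Cb_borel; apply: CbM; [exact: Cb_cst|apply: CbB => //; exact: Cb_cst].
  move=> w; rewrite -{1}[phi _]mul1r -mulrBl normrM mulrC.
  have /andP[? ?] := eta01 k (X t w).
  by rewrite [`|1 - _|]ger0_norm ?subr_ge0// ler_wpM2r// subr_ge0.
move=> x; apply/cvgrPdist_lt => e e0.
have e3 : 0 < e / 3 by rewrite divr_gt0.
have [k kP] : exists k, M * (1 - Pt t (eta k) x) < e / 3.
  have cv : M * (1 - Pt t (eta k) x) @[k --> \oo] --> M * (1 - Pt t (fun=> 1) x).
    apply: cvgMr; apply: cvgB; first exact: cvg_cst.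
    apply: (@cvg_sgrpR _ _ _ _ _ _ _ SM t eta (fun=> 1) 1 x t0) => // k.
      exact: (Cb_borel (Ceta k)).1.
    by move=> y; have /andP[? ?] := eta01 k y; rewrite ger0_norm.
  move: cv; rewrite sgrpR_cst subrr mulr0 => /cvgrPdist_lt/(_ _ e3)[N _ NP].
  by exists N; have := NP N (leqnn N); rewrite /= sub0r normrN => /ltr_normlW.
have near1 : \forall y \near x, M * (1 - Pt t (eta k) y) < e / 3.
  have cv : M * (1 - Pt t (eta k) y) @[y --> x] --> M * (1 - Pt t (eta k) x).
    by apply: cvgMr; apply: cvgB; [exact: cvg_cst|exact: Feta].
  exact: cvgr_lt cv _ kP.
have /cvgrPdist_lt/(_ _ e3) near2 := Fphi k x.
near=> y.
have h1 : M * (1 - Pt t (eta k) y) < e / 3 by near: y; exact: near1.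
have h2 : `|Pt t (fun y => eta k y * phi y) x - Pt t (fun y => eta k y * phi y) y| < e / 3.
  by near: y; exact: near2.
move: (dist k x) (dist k y) h2; rewrite !ler_norml !ltr_norml.
by move=> /andP[? ?] /andP[? ?] /andP[? ?]; apply/andP; split; lra.
Unshelve. all: by end_near. Qed.

Definition potential phi t x := \int[leb]_(s in `[0, t]) Pt s phi x.

Lemma riemann_potential phi t x : 0 <= t -> Cb phi ->
  (t / n.+1%:R) * (\sum_(i < n.+1) Pt (i.+1%:R * (t / n.+1%:R)) phi x) @[n --> \oo]
  --> potential phi t x.
Proof.
move=> t0 Cphi; have [_ [M bM]] := Cphi.
have h := @cvg_riemann_sum _ (fun s => Pt s phi x) 0 t M t0 _ _.
rewrite /potential -[X in `[0, X]](add0r t).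
under eq_fun do under eq_bigr do rewrite -[_ * (_ / _)]add0r.
apply: h => s s0; first exact: (sgrpR_right_continuous SM).
by apply: (sgrpR_bound SM) => //; exact: Cb_borel.
Qed.

Lemma potential_bound phi t x M : 0 <= t -> Cb phi -> (forall y, `|phi y| <= M) ->
  `|potential phi t x| <= M * t.
Proof.
move=> t0 Cphi bM; rewrite /potential -[X in `[0, X]](add0r t).
apply: (@norm_integral_le _ (fun s => Pt s phi x)) => // s s0.
  exact: (sgrpR_right_continuous SM).
by apply: (sgrpR_bound SM) => //; exact: Cb_borel.
Qed.

Lemma sgrpR_path_integrable phi t x : 0 <= t -> Cb phi ->
  leb.-integrable `[0, t] (EFin \o (fun s => Pt s phi x)).
Proof.
move=> t0 Cphi; have [_ [M bM]] := Cphi; rewrite -[X in `[0, X]](add0r t).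
apply: (@right_continuous_integrable _ _ _ _ M) => // s s0.
  exact: (sgrpR_right_continuous SM).
by apply: (sgrpR_bound SM) => //; exact: Cb_borel.
Qed.

Lemma potential_Cb phi t : 0 <= t -> Cb phi -> Cb (potential phi t).
Proof.
move=> t0 Cphi; have [_ [M bM]] := Cphi; split; last first.
  by exists (M * t) => x; exact: potential_bound.
move=> x; apply: sequentially_continuous_at => y yx.
apply: (@bounded_cvg_Rintegral _ _ _ leb `[0, t] _ _ M) => //.
- exact: lebesgue_itv_fin.
- by move=> n; apply/measurable_EFinP; exact: measurable_int (sgrpR_path_integrable _ t0 Cphi).
- move=> n s; rewrite /= in_itv /= => /andP[s0 _].
  by apply: (sgrpR_bound SM) => //; exact: Cb_borel.
- move=> s; rewrite /= in_itv /= => /andP[s0 _].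
  by apply: continuous_cvg => //; exact: (sgrpR_Cb s0 Cphi).1.
Qed.

Lemma rst_level_measurable sigma t : rst F sigma -> 0 <= t ->
  measurable [set w | sigma w <= t].
Proof. by move=> [_ sF] t0; apply: (filtration_measurable SM t0); exact: sF. Qed.

Lemma rst_add sigma s : rst F sigma -> 0 <= s -> rst F (fun w => sigma w + s).
Proof.
move=> [s0 sF] s_ge0; split=> [w|t t0]; first by rewrite addr_ge0.
have [st|ts] := leP s t.
  rewrite (_ : [set _ | _] = [set w | sigma w <= t - s]).
    apply: (filtration_mono SM (s := t - s)); rewrite ?subr_ge0// ?gerBl//.
    by apply: sF; rewrite subr_ge0.
  by apply/seteqP; split => w /=; rewrite lerBrDr.
rewrite (_ : [set _ | _] = set0); first exact: (filtration0 SM).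
apply/seteqP; split => // w /=; rewrite leNgt => /negP; apply.
by rewrite (lt_le_trans ts)// lerDr.
Qed.

Lemma ceil_grid_eq_measurable sigma dl k : rst F sigma -> 0 < dl ->
  measurable [set w | ceil_grid dl (sigma w) = k].
Proof.
move=> rs d0; have [s0 _] := rs.
have mle j : measurable [set w | (ceil_grid dl (sigma w) <= j)%N].
  rewrite (_ : [set _ | _] = [set w | sigma w <= j%:R * dl]).
    by apply: rst_level_measurable => //; rewrite mulr_ge0// ltW.
  by apply/seteqP; split => w /=; rewrite ceil_grid_le.
case: k => [|k].
  rewrite (_ : [set _ | _] = [set w | (ceil_grid dl (sigma w) <= 0)%N])//.
  by apply/seteqP; split => w /=; rewrite leqn0 => /eqP.
rewrite (_ : [set _ | _] = [set w | (ceil_grid dl (sigma w) <= k.+1)%N] `\`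
    [set w | (ceil_grid dl (sigma w) <= k)%N]); first exact: measurableD.
apply/seteqP; split => w /=; first by move=> ->; rewrite ltnn.
by move=> [h1 /negP]; rewrite -ltnNge => h2; apply/eqP; rewrite eqn_leq h1.
Qed.

(** [sigma] is approached from the right by grid times, for which the preimage splits into countably
    many pieces, one for each grid value. *)
Lemma stopped_measurable sigma phi : rst F sigma -> Cb phi ->
  measurable_fun setT (fun w => phi (X (sigma w) w)).
Proof.
move=> rs Cphi; have [s0 _] := rs.
apply: (@measurable_fun_cvg _ _ _ _
  (fun n w => phi (X ((ceil_grid n.+1%:R^-1 (sigma w))%:R * n.+1%:R^-1) w))).
  move=> n; have d0 : 0 < n.+1%:R^-1 :> R by rewrite invr_gt0.
  move=> _ Y mY; rewrite setTI.
  rewrite (_ : _ @^-1` Y = \bigcup_k ([set w | ceil_grid n.+1%:R^-1 (sigma w) = k] `&`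
      (fun w => phi (X (k%:R * n.+1%:R^-1) w)) @^-1` Y)).
    apply: bigcupT_measurable => k; apply: measurableI; first exact: ceil_grid_eq_measurable.
    have k0 : 0 <= k%:R * n.+1%:R^-1 :> R by rewrite mulr_ge0// ltW.
    by have := borel_comp_measurable SM k0 (Cb_borel Cphi).1 measurableT mY; rewrite setTI.
  apply/seteqP; split => w /=; first by move=> Yw; exists (ceil_grid n.+1%:R^-1 (sigma w)).
  by move=> [k _ [/= <-]].
move=> w _; apply: (@right_continuous_seq _ (fun s => phi (X s w))).
- by apply: (comp_path_right_continuous SM) => //; exact: Cphi.1.
- by move=> n; apply: le_ceil_grid => //; rewrite invr_gt0.
- exact: ceil_grid_cvg.
Qed.

Lemma stopped_bmeas sigma phi : rst F sigma -> Cb phi ->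
  bmeas (fun w => phi (X (sigma w) w)).
Proof.
move=> rs Cphi; split; first exact: stopped_measurable.
by have [_ [M bM]] := Cphi; exists M.
Qed.

Definition path_integral phi a b w := \int[leb]_(s in `[a, b]) phi (X s w).

Lemma path_integrable phi a t w : 0 <= a -> 0 <= t -> Cb phi ->
  leb.-integrable `[a, (a + t)] (EFin \o (fun s => phi (X s w))).
Proof.
move=> a0 t0 [cphi [M bM]]; apply: (@right_continuous_integrable _ _ _ _ M) => // s s0.
by apply: (comp_path_right_continuous SM) => //; exact: le_trans s0.
Qed.

Lemma path_integral_bound phi a t w M : 0 <= a -> 0 <= t -> Cb phi ->
  (forall y, `|phi y| <= M) -> `|path_integral phi a (a + t) w| <= M * t.
Proof.
move=> a0 t0 [cphi _] bM; apply: (@norm_integral_le _ (fun s => phi (X s w))) => // s s0.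
by apply: (comp_path_right_continuous SM) => //; exact: le_trans s0.
Qed.

Lemma riemann_path_integral phi a t w : 0 <= a -> 0 <= t -> Cb phi ->
  (t / n.+1%:R) * (\sum_(i < n.+1) phi (X (a + i.+1%:R * (t / n.+1%:R)) w)) @[n --> \oo]
  --> path_integral phi a (a + t) w.
Proof.
move=> a0 t0 [cphi [M bM]]; apply: (@cvg_riemann_sum _ (fun s => phi (X s w)) a t M) => // s s0.
by apply: (comp_path_right_continuous SM) => //; exact: le_trans s0.
Qed.

Lemma path_integral_bmeas phi sigma t : rst F sigma -> 0 <= t -> Cb phi ->
  bmeas (fun w => path_integral phi (sigma w) (sigma w + t) w).
Proof.
move=> rs t0 Cphi; have [_ [M bM]] := Cphi; have [s0 _] := rs; split; last first.
  by exists (M * t) => w; exact: path_integral_bound.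
apply: (@measurable_fun_cvg _ _ _ _ (fun n w => (t / n.+1%:R) *
   (\sum_(i < n.+1) phi (X (sigma w + i.+1%:R * (t / n.+1%:R)) w)))); last first.
  by move=> w _; exact: riemann_path_integral.
move=> n; apply: measurable_funM => //; apply: measurable_sum => i.
apply: (@stopped_measurable (fun w => sigma w + i.+1%:R * (t / n.+1%:R))) => //.
by apply: rst_add => //; rewrite mulr_ge0// divr_ge0.
Qed.

(* Riemann sums replace Fubini: both time integrals are limits of the same finite sums. *)
Lemma expect_path_integral phi sigma t (A : set Omega) x : rst F sigma -> measurable A ->
  (forall u, 0 <= u -> F u (A `&` [set w | sigma w <= u])) -> 0 <= t -> Cb phi ->
  \int[P x]_w (\1_A w * path_integral phi (sigma w) (sigma w + t) w) =
  \int[P x]_w (\1_A w * potential phi t (X (sigma w) w)).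
Proof.
move=> rs mA FA t0 Cphi; have [_ [M bM]] := Cphi; have [s0 _] := rs.
have M0 : 0 <= M by exact: le_trans (bM point).
have i0 n (i : nat) : 0 <= i.+1%:R * (t / n.+1%:R) by rewrite mulr_ge0// divr_ge0.
have mbound n (v : nat -> R) : (forall i, `|v i| <= M) ->
    `|t / n.+1%:R * \sum_(i < n.+1) v i| <= t * M.
  move=> vM; rewrite normrM ger0_norm ?divr_ge0// -mulrA ler_wpM2l// ler_pdivrMl ?ltr0n//.
  rewrite (le_trans (ler_norm_sum _ _ _))// (@le_trans _ _ (\sum_(i < n.+1) M))//.
    by apply: ler_sum => i _; exact: vM.
  by rewrite sumr_const card_ord mulr_natl.
have bA : bmeas (\1_A : Omega -> R) by exact: bmeas_indic.
have A1 w : `|\1_A w : R| <= 1.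
  by rewrite indicE; case: (_ \in _); rewrite ?normr1 ?normr0.
have bi n i : bmeas (fun w => phi (X (sigma w + i.+1%:R * (t / n.+1%:R)) w)).
  exact: (stopped_bmeas (rst_add rs (i0 n i)) Cphi).
have bj n i : bmeas (fun w => Pt (i.+1%:R * (t / n.+1%:R)) phi (X (sigma w) w)).
  exact: stopped_bmeas rs (sgrpR_Cb (i0 n i) Cphi).
pose S n w := \1_A w * ((t / n.+1%:R) *
   (\sum_(i < n.+1) phi (X (sigma w + i.+1%:R * (t / n.+1%:R)) w))).
pose S' n w := \1_A w * ((t / n.+1%:R) *
   (\sum_(i < n.+1) Pt (i.+1%:R * (t / n.+1%:R)) phi (X (sigma w) w))).
have bsum (v : nat -> nat -> Omega -> R) n : (forall i, bmeas (v n i)) ->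
    bmeas (fun w => \1_A w * ((t / n.+1%:R) * (\sum_(i < n.+1) v n i w))).
  move=> bv; apply: bmeasM => //; apply: bmeasM; first exact: bmeas_cst.
  by apply: bmeas_sum => i.
(* The strong Markov property, applied to each term of the sum. *)
have SE n : \int[P x]_w S n w = \int[P x]_w S' n w.
  have distr (v : nat -> Omega -> R) : (forall i, bmeas (v i)) ->
      \int[P x]_w (\1_A w * ((t / n.+1%:R) * (\sum_(i < n.+1) v i w))) =
      (t / n.+1%:R) * \sum_(i < n.+1) \int[P x]_w (\1_A w * v i w).
    move=> bv; have bAv i : bmeas (fun w => \1_A w * v i w) by exact: bmeasM.
    transitivity (\int[P x]_w ((t / n.+1%:R) * \sum_(i < n.+1) (\1_A w * v i w))).
      by apply: eq_Rintegral => w _; rewrite mulrCA -mulr_sumr.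
    by rewrite expectZ ?expect_sum//; apply: bmeas_sum => i.
  apply: etrans (distr (fun i w => phi (X (sigma w + i.+1%:R * (t / n.+1%:R)) w)) (bi n)) _.
  apply: etrans (esym (distr (fun i w => Pt (i.+1%:R * (t / n.+1%:R)) phi (X (sigma w) w)) (bj n))).
  congr (_ * _); apply: eq_bigr => i _; rewrite -!Rintegral_indic.
  by apply: (strong_markov_raw SM) => //; exact: Cb_borel.
have c1 : \int[P x]_w S n w @[n --> \oo] -->
    \int[P x]_w (\1_A w * path_integral phi (sigma w) (sigma w + t) w).
  apply: (@cvg_expect _ _ _ _ _ _ (t * M)) => [n|n w|w].
  - exact: (bsum (fun n i w => phi (X (sigma w + i.+1%:R * (t / n.+1%:R)) w)) n _).1.
  - rewrite normrM -[leRHS]mul1r ler_pM//.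
    by apply: (mbound n (fun i => phi (X (sigma w + i.+1%:R * (t / n.+1%:R)) w))).
  - by apply: cvgMr; exact: riemann_path_integral.
have c2 : \int[P x]_w S n w @[n --> \oo] -->
    \int[P x]_w (\1_A w * potential phi t (X (sigma w) w)).
  under eq_fun do rewrite SE.
  apply: (@cvg_expect _ _ _ _ _ _ (t * M)) => [n|n w|w].
  - exact: (bsum (fun n i w => Pt (i.+1%:R * (t / n.+1%:R)) phi (X (sigma w) w)) n _).1.
  - rewrite normrM -[leRHS]mul1r ler_pM//.
    apply: (mbound n (fun i => Pt (i.+1%:R * (t / n.+1%:R)) phi (X (sigma w) w))) => i.
    by apply: (sgrpR_bound SM) => //; exact: Cb_borel.
  - by apply: cvgMr; exact: riemann_potential.
by rewrite -(cvg_lim (@Rhausdorff R) c1) -(cvg_lim (@Rhausdorff R) c2).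
Qed.

End Feller.

(** * Optimal stopping on a time grid *)

Section Stopping.
Context {R : realType} {E : pseudoPMetricType R} {d : measure_display}
  {Omega : measurableType d}.
Variables (P : E -> probability Omega R) (X : R -> Omega -> E)
  (F : R -> set (set Omega)).
Hypothesis PS : @paper_space R E.
Hypothesis SM : standard_markov P X F.
Hypothesis WF : weak_feller P X.
Implicit Types (phi : E -> R) (s t : R) (x : E).
Notation Pt t phi := (sgrpR P X t phi).
Notation leb := (@lebesgue_measure R).
Notation pathint := (path_integral X).
Notation pot := (potential P X).

Lemma path_integral_split phi (a b c : R) w : Cb phi -> 0 <= a -> a <= b -> b <= c ->
  pathint phi a c w = pathint phi a b w + pathint phi b c w.
Proof.
move=> Cphi a0 ab bc; have ac : a <= c := le_trans ab bc.
have iac : leb.-integrable `[a, c] (EFin \o (fun s => phi (X s w))).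
  have := path_integrable SM w a0 (_ : 0 <= c - a) Cphi.
  by rewrite subrKC subr_ge0; exact.
have := Rintegral_itvB iac (_ : (BLeft a <= BRight b)%O) (_ : (BRight b <= BRight c)%O).
rewrite !bnd_simp => /(_ ab bc); rewrite Rintegral_itv_obnd_cbnd; last first.
  apply: integrableS iac => //= s /=; rewrite !in_itv /= => /andP[bs ->]; rewrite andbT.
  by rewrite ltW// (le_lt_trans ab).
by rewrite /path_integral => <-; rewrite addrC subrK.
Qed.

Lemma measurable_mixture (kappa : Omega -> nat) (Z : nat -> Omega -> R) :
  (forall k, measurable [set w | kappa w = k]) -> (forall k, measurable_fun setT (Z k)) ->
  measurable_fun setT (fun w => Z (kappa w) w).
Proof.
move=> mk mZ _ Y mY; rewrite setTI.
rewrite (_ : _ @^-1` Y = \bigcup_k ([set w | kappa w = k] `&` Z k @^-1` Y)).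
  apply: bigcupT_measurable => k; apply: measurableI => //.
  by have := mZ k measurableT _ mY; rewrite setTI.
apply/seteqP; split => w /=; first by move=> Yw; exists (kappa w).
by move=> [k _ [/= <-]].
Qed.

Lemma path_integral_lipschitz phi (M b c : R) w : Cb phi -> (forall y, `|phi y| <= M) ->
  0 <= b -> b <= c -> `|pathint phi 0 c w - pathint phi 0 b w| <= M * (c - b).
Proof.
move=> Cphi bM b0 bc; rewrite (path_integral_split w Cphi (lexx 0) b0 bc) addrAC subrr add0r.
rewrite -[X in pathint _ _ X](subrKC b c).
by apply: (path_integral_bound SM) => //; rewrite subr_ge0.
Qed.

Lemma path_integral0_bmeas phi sigma (T : R) : rst F sigma -> (forall w, sigma w <= T) ->
  Cb phi -> bmeas (fun w => pathint phi 0 (sigma w) w).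
Proof.
move=> rs sT Cphi; have [s0 _] := rs; have [_ [M bM]] := Cphi.
have M0 : 0 <= M by exact: le_trans (bM point).
split; last first.
  exists (M * T) => w; rewrite -[X in pathint _ _ X](add0r (sigma w)).
  rewrite (le_trans (path_integral_bound SM w (lexx 0) (s0 w) Cphi bM))//.
  by rewrite ler_wpM2l.
apply: (@measurable_fun_cvg _ _ _ _ (fun n w =>
    pathint phi 0 ((ceil_grid n.+1%:R^-1 (sigma w))%:R * n.+1%:R^-1) w)).
  move=> n; have d0 : 0 < n.+1%:R^-1 :> R by rewrite invr_gt0.
  apply: (@measurable_mixture (fun w => ceil_grid n.+1%:R^-1 (sigma w))
    (fun k w => pathint phi 0 (k%:R * n.+1%:R^-1) w)) => k.
    exact: (ceil_grid_eq_measurable SM).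
  have k0 : 0 <= k%:R * n.+1%:R^-1 :> R by rewrite mulr_ge0// ltW.
  have := path_integral_bmeas SM (rst_cst SM (lexx 0)) k0 Cphi.
  by rewrite add0r => -[].
move=> w _; apply/cvgrPdist_lt => e e0.
have eM : 0 < e / (M + 1) by rewrite divr_gt0// ltr_pwDr.
have /cvgrPdist_lt/(_ _ eM) := ceil_grid_cvg (s0 w).
apply: filterS => n; have d0 : 0 < n.+1%:R^-1 :> R by rewrite invr_gt0.
set q := _ * _ => sq; have qs : sigma w <= q by exact: le_ceil_grid.
rewrite distrC (le_lt_trans (path_integral_lipschitz w Cphi bM (s0 w) qs))//.
move: sq; rewrite distrC ger0_norm ?subr_ge0// ltr_pdivlMr ?ltr_pwDr// mulrC => h.
by rewrite (le_lt_trans _ h)// ler_wpM2r ?subr_ge0// lerDl.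
Qed.

Section GridTime.
Variables (dl : R) (dl0 : 0 < dl).

Definition grid_time (kappa : Omega -> nat) :=
  forall j, F (j%:R * dl) [set w | (kappa w <= j)%N].

Let jd j : 0 <= j%:R * dl. Proof. by rewrite mulr_ge0// ltW. Qed.

Lemma grid_time_rst kappa : grid_time kappa -> rst F (fun w => (kappa w)%:R * dl).
Proof.
move=> gk; split=> // t t0.
rewrite (_ : [set _ | _] = \bigcup_j (if j%:R * dl <= t then [set w | (kappa w <= j)%N] else set0)).
  apply: (filtration_bigcup SM t0) => j; case: ifPn => jt; last exact: (filtration0 SM).
  exact: (filtration_mono SM _ jt).
apply/seteqP; split => w /=; first by move=> kt; exists (kappa w) => //; rewrite kt /= leqnn.
by move=> [j _]; case: ifPn => // jt /= kj; rewrite (le_trans _ jt)// ler_pM2r// ler_nat.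
Qed.

Lemma grid_time_ceil sigma : rst F sigma -> grid_time (fun w => ceil_grid dl (sigma w)).
Proof.
move=> [s0 sF] j; rewrite (_ : [set _ | _] = [set w | sigma w <= j%:R * dl]); first exact: sF.
by apply/seteqP; split => w /=; rewrite ceil_grid_le.
Qed.

Lemma grid_time_min kappa N : grid_time kappa -> grid_time (fun w => minn (kappa w) N).
Proof.
move=> gk j; have [Nj|jN] := leqP N j.
  rewrite (_ : [set _ | _] = setT); first exact: (filtrationT SM (jd j)).
  by apply/seteqP; split => // w _ /=; rewrite geq_min Nj orbT.
rewrite (_ : [set _ | _] = [set w | (kappa w <= j)%N]); first exact: gk.
by apply/seteqP; split => w /=; rewrite geq_min [(N <= j)%N]leqNgt jN orbF.
Qed.

Lemma grid_time_gt kappa j : grid_time kappa -> F (j%:R * dl) [set w | (j < kappa w)%N].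
Proof.
move=> gk; rewrite (_ : [set _ | _] = ~` [set w | (kappa w <= j)%N]).
  exact: (filtrationC SM (jd j)).
by apply/seteqP; split => w /=; rewrite ltnNge => /negP.
Qed.

Lemma grid_time_gt_measurable kappa j : grid_time kappa -> measurable [set w | (j < kappa w)%N].
Proof. by move=> gk; apply: (filtration_measurable SM (jd j)); exact: grid_time_gt. Qed.

Lemma telescope_stopped (u : nat -> R) (k N : nat) : (k <= N)%N ->
  u k = u 0%N + \sum_(j < N) (j < k)%N%:R * (u j.+1 - u j).
Proof.
elim: N => [|N IH]; first by rewrite leqn0 => /eqP ->; rewrite big_ord0 addr0.
rewrite leq_eqVlt => /predU1P[->|]; last first.
  by rewrite ltnS => kN; rewrite big_ord_recr /= ltnNge kN mul0r addr0 -IH.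
rewrite (eq_bigr (fun j : 'I_N.+1 => u j.+1 - u j)).
  by rewrite -(big_mkord predT (fun j => u j.+1 - u j)) telescope_sumr// subrKC.
by move=> j _; rewrite ltn_ord mul1r.
Qed.

(** The event [j < kappa] is known at time [j dl], so the Markov property replaces each increment by
    its conditional mean. The functions [u j] depend on time so that the same formula serves for the
    values of backward induction and, with [u = 0], for path integrals alone. *)
Lemma dynkin_grid phi (u : nat -> E -> R) kappa N x : Cb phi -> (forall j, Cb (u j)) ->
  grid_time kappa -> (forall w, (kappa w <= N)%N) ->
  \int[P x]_w (pathint phi 0 ((kappa w)%:R * dl) w + u (kappa w) (X ((kappa w)%:R * dl) w)) =
  u 0%N x + \sum_(j < N) \int[P x]_w (\1_[set w | (j < kappa w)%N] w *
    (pot phi dl (X (j%:R * dl) w) + Pt dl (u j.+1) (X (j%:R * dl) w) - u j (X (j%:R * dl) w))).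
Proof.
move=> Cphi Cu gk kN.
have S_dl j : j.+1%:R * dl = j%:R * dl + dl by rewrite -addn1 natrD mulrDl mul1r.
have bS j : bmeas (fun w => pathint phi (j%:R * dl) (j%:R * dl + dl) w).
  exact: (path_integral_bmeas SM (rst_cst SM (jd j)) (ltW dl0) Cphi).
have bu j i : bmeas (fun w => u j (X (i%:R * dl) w)).
  by apply: (bmeas_comp SM) => //; exact: Cb_borel.
have bI j : bmeas (\1_[set w | (j < kappa w)%N] : Omega -> R).
  by apply: bmeas_indic; exact: grid_time_gt_measurable.
pose D j w := pathint phi (j%:R * dl) (j%:R * dl + dl) w +
  (u j.+1 (X (j.+1%:R * dl) w) - u j (X (j%:R * dl) w)).
have bD j : bmeas (D j) by apply: bmeasD => //; exact: bmeasB.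
transitivity (\int[P x]_w (u 0%N (X 0 w) +
    \sum_(j < N) \1_[set w | (j < kappa w)%N] w * D j w)).
  apply: eq_Rintegral => w _.
  pose v j := pathint phi 0 (j%:R * dl) w + u j (X (j%:R * dl) w).
  rewrite -/(v (kappa w)) (telescope_stopped v (kN w)) {1}/v mul0r.
  rewrite [pathint phi 0 0 w](_ : _ = 0) ?add0r; last first.
    by rewrite /path_integral set_itv1 Rintegral_set1.
  congr (_ + _); apply: eq_bigr => j _; congr (_ * _).
    by rewrite indicE; congr (nat_of_bool _)%:R; apply/idP/idP; rewrite inE.
  rewrite /v /D S_dl (path_integral_split w Cphi (lexx 0) (jd j)) ?lerDl ?ltW//.
  by ring.
have b0 : bmeas (fun w => u 0%N (X 0 w)).
  by apply: (bmeas_comp SM) => //; exact: Cb_borel.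
have bID j : bmeas (fun w => \1_[set w | (j < kappa w)%N] w * D j w) by exact: bmeasM.
rewrite expectD//; last exact: bmeas_sum.
rewrite expect_sum; last by move=> j; exact: bID.
congr (_ + _); first by rewrite -[RHS](sgrpR0 PS SM)//; exact: Cb_borel.
apply: eq_bigr => j _.
have bp : bmeas (fun w => pot phi dl (X (j%:R * dl) w)).
  by apply: (bmeas_comp SM) => //; apply: Cb_borel; exact: (potential_Cb PS SM WF (ltW dl0) Cphi).
have bPu : bmeas (fun w => Pt dl (u j.+1) (X (j%:R * dl) w)).
  by apply: (bmeas_comp SM) => //; apply: (sgrpR_borel SM (ltW dl0)); exact: Cb_borel.
pose I w : R := \1_[set w | (j < kappa w)%N] w.
have bI' : bmeas I by exact: bI.
transitivity (\int[P x]_w (I w * pathint phi (j%:R * dl) (j%:R * dl + dl) w) +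
   (\int[P x]_w (I w * u j.+1 (X (j%:R * dl + dl) w)) - \int[P x]_w (I w * u j (X (j%:R * dl) w)))).
  have buS : bmeas (fun w => u j.+1 (X (j%:R * dl + dl) w)) by rewrite -S_dl.
  rewrite -expectB; [|exact: bmeasM|exact: bmeasM].
  rewrite -expectD; [|exact: bmeasM|by apply: bmeasB; exact: bmeasM].
  by apply: eq_Rintegral => w _; rewrite /D S_dl -mulrBr -mulrDr.
have FI : F (j%:R * dl) [set w | (j < kappa w)%N] by exact: grid_time_gt.
rewrite (markov SM x (jd j) (ltW dl0) FI (Cb_borel (Cu j.+1))).
have -> : \int[P x]_w (I w * pathint phi (j%:R * dl) (j%:R * dl + dl) w) =
    \int[P x]_w (I w * pot phi dl (X (j%:R * dl) w)).
  apply: (expect_path_integral PS SM WF (sigma := fun=> j%:R * dl)) => //.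
  - exact: (rst_cst SM (jd j)).
  - exact: grid_time_gt_measurable.
  - move=> v v0 /=; have [jv|vj] := leP (j%:R * dl) v.
      by rewrite (_ : [set w : Omega | true] = setT) ?setIT; [exact: (filtration_mono SM _ jv)|apply/seteqP].
    rewrite (_ : [set w : Omega | false] = set0) ?setI0; first exact: (filtration0 SM).
    by apply/seteqP; split.
  - exact: ltW.
rewrite addrA -expectD; [|exact: bmeasM|exact: bmeasM].
rewrite -expectB; [|by apply: bmeasD; exact: bmeasM|exact: bmeasM].
by apply: eq_Rintegral => w _; rewrite -mulrDr -mulrBr.
Qed.

End GridTime.

Section Reward.
Variables f g : E -> R.
Hypotheses (Cf : Cb f) (Cg : Cb g).

Definition reward x (sigma : Omega -> R) : R :=
  \int[P x]_w (pathint f 0 (sigma w) w + g (X (sigma w) w)).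

Lemma reward_bmeas sigma (T : R) : rst F sigma -> (forall w, sigma w <= T) ->
  bmeas (fun w => pathint f 0 (sigma w) w + g (X (sigma w) w)).
Proof.
move=> rs sT; apply: bmeasD; first exact: path_integral0_bmeas sT Cf.
exact: (stopped_bmeas SM).
Qed.

Section GridValue.
Variables (dl : R) (dl0 : 0 < dl).

(** Bellman's recursion, with [n] counting the steps that remain. *)
Fixpoint grid_value (n : nat) : E -> R :=
  if n is n'.+1 then fun x => Num.max (g x) (pot f dl x + Pt dl (grid_value n') x) else g.

Lemma grid_value_Cb n : Cb (grid_value n).
Proof.
elim: n => [//|n IH] /=; apply: Cb_max => //; apply: CbD.
  exact: (potential_Cb PS SM WF (ltW dl0)).
exact: (sgrpR_Cb PS SM WF (ltW dl0)).
Qed.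

Lemma le_grid_value n x : g x <= grid_value n x.
Proof. by case: n => //= n; rewrite le_max lexx. Qed.

Let jd j : 0 <= j%:R * dl. Proof. by rewrite mulr_ge0// ltW. Qed.

(** By the recursion all increments in Dynkin's formula for the remaining values are nonpositive,
    and the reward [g] lies below the value at the stopping time. *)
Lemma reward_le_grid_value kappa N x : grid_time dl kappa -> (forall w, (kappa w <= N)%N) ->
  reward x (fun w => (kappa w)%:R * dl) <= grid_value N x.
Proof.
move=> gk kN; have rk := grid_time_rst dl0 gk.
have kb w : (kappa w)%:R * dl <= N%:R * dl by rewrite ler_wpM2r ?(ltW dl0)// ler_nat.
pose u j := grid_value (N - j)%N.
have Cu j : Cb (u j) by exact: grid_value_Cb.
have := dynkin_grid dl0 x Cf Cu gk kN; rewrite {2}/u subn0 => e.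
rewrite (@le_trans _ _ (grid_value N x + 0))//; last by rewrite addr0.
apply: le_trans (_ : _ <= _) _; last first.
  apply: (lerD (lexx (grid_value N x))).
  apply: (@sumr_le0 _ _ (index_enum 'I_N) xpredT (fun j : 'I_N =>
    \int[P x]_w (\1_[set w | (j < kappa w)%N] w *
    (pot f dl (X (j%:R * dl) w) + Pt dl (u j.+1) (X (j%:R * dl) w) - u j (X (j%:R * dl) w))))).
  move=> j _; apply: expect_le => [|w].
    apply: bmeasM.
      by apply: bmeas_indic; exact: grid_time_gt_measurable gk.
    apply: bmeasB; last by apply: (bmeas_comp SM) => //; exact: Cb_borel.
    apply: bmeasD; apply: (bmeas_comp SM) => //; apply: Cb_borel.
      exact: (potential_Cb PS SM WF (ltW dl0)).
    exact: (sgrpR_Cb PS SM WF (ltW dl0)).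
  have eN : (N - j = (N - j.+1).+1)%N by rewrite subnSK.
  by rewrite indicE mulr_ge0_le0// /u subr_le0 eN /= le_max lexx orbT.
rewrite -e; apply: le_expect.
- exact: reward_bmeas rk kb.
- apply: bmeasD; first exact: path_integral0_bmeas rk kb Cf.
  split; last first.
    have h j : exists M : R, forall y, `|u j y| <= M by have [_] := Cu j.
    have [M MP] := choice h.
    exists (\sum_(j < N.+1) `|M j|) => w.
    have kN1 : (kappa w < N.+1)%N by rewrite ltnS.
    rewrite (le_trans (MP (kappa w) _))// (le_trans (ler_norm _))//.
    by rewrite (bigD1 (Ordinal kN1))//= lerDl sumr_ge0.
  apply: (@measurable_mixture kappa (fun k w => u k (X (k%:R * dl) w))) => k.
    rewrite (_ : [set _ | _] = [set w | ceil_grid dl ((kappa w)%:R * dl) = k]).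
      exact: (ceil_grid_eq_measurable SM).
    by apply/seteqP; split => w /=; rewrite ceil_grid_natmul.
  by apply: (borel_comp_measurable SM) => //; exact: (Cb_borel (Cu k)).1.
- by move=> w; rewrite lerD2l le_grid_value.
Qed.

End GridValue.
End Reward.
End Stopping.

(** * Attainment of the grid values; reduction to bounded stopping times *)

Section Values.
Context {R : realType} {E : pseudoPMetricType R} {d : measure_display}
  {Omega : measurableType d}.
Variables (P : E -> probability Omega R) (X : R -> Omega -> E)
  (F : R -> set (set Omega)).
Hypothesis PS : @paper_space R E.
Hypothesis SM : standard_markov P X F.
Hypothesis WF : weak_feller P X.
Implicit Types (phi : E -> R) (s t : R) (x : E).
Notation Pt t phi := (sgrpR P X t phi).
Notation pathint := (path_integral X).
Notation pot := (potential P X).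
Variables f g : E -> R.
Hypotheses (Cf : Cb f) (Cg : Cb g).
Notation J := (reward P X f g).
Notation V dl := (grid_value P X f g dl).

(** The optimal rule stops at the first grid point where the value does not exceed [g], and at step
    [N] at the latest. Before it the maximum in the recursion is the continuation term, so the
    increments in Dynkin's formula vanish. *)
Lemma grid_value_attained (dl : R) N x : 0 < dl -> exists2 kappa, grid_time F dl kappa &
  (forall w, (kappa w <= N)%N) /\ J x (fun w => (kappa w)%:R * dl) = V dl N x.
Proof.
move=> dl0; have jd j : 0 <= j%:R * dl by rewrite mulr_ge0// ltW.
have CV n : Cb (V dl n) by exact: (grid_value_Cb PS SM WF Cf Cg dl0).
pose p w j := (N <= j)%N || (V dl (N - j)%N (X (j%:R * dl) w) <= g (X (j%:R * dl) w)).
have ex w : exists j, p w j by exists N; rewrite /p leqnn.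
pose kappa w := ex_minn (ex w).
have kp w : p w (kappa w) by rewrite /kappa; case: ex_minnP.
have kmin w j : p w j -> (kappa w <= j)%N by rewrite /kappa; case: ex_minnP => m _; apply.
have kN w : (kappa w <= N)%N by apply: kmin; rewrite /p leqnn.
have Vk w : V dl (N - kappa w)%N (X ((kappa w)%:R * dl) w) = g (X ((kappa w)%:R * dl) w).
  apply/eqP; rewrite eq_le le_grid_value andbT.
  case/orP: (kp w) => // Nk; have -> : (N - kappa w = 0)%N by apply/eqP; rewrite subn_eq0.
  by [].
have gk : grid_time F dl kappa.
  move=> j; rewrite (_ : [set _ | _] = \bigcup_i (if (i <= j)%N then [set w | p w i] else set0)).
    apply: (filtration_bigcup SM (jd j)) => i; case: ifPn => ij; last exact: (filtration0 SM (jd j)).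
    have ijd : i%:R * dl <= j%:R * dl by rewrite ler_wpM2r ?(ltW dl0)// ler_nat.
    apply: (filtration_mono SM (jd i) ijd); rewrite /p.
    case: (leqP N i) => Ni /=.
      by rewrite (_ : [set w | true] = setT); [exact: (filtrationT SM (jd i))|apply/seteqP].
    rewrite (_ : [set w | _] = X (i%:R * dl) @^-1` [set y | V dl (N - i)%N y <= g y])//.
    apply: (adapted SM (jd i)).
    have [mD _] : borel_bounded (fun y => g y - V dl (N - i)%N y) by apply: Cb_borel; exact: CbB.
    have := mD measurableT _ (measurable_itv `[0, +oo[); rewrite setTI.
    congr measurable; apply/seteqP; split => y /=; rewrite in_itv /= andbT subr_ge0//.
  apply/seteqP; split => w /=; first by move=> kj; exists (kappa w) => //; rewrite kj; exact: kp.
  by move=> [i _]; case: ifPn => // ij /= /kmin /leq_trans; apply.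
exists kappa => //; split => //.
pose u j := V dl (N - j)%N.
have := dynkin_grid PS SM WF dl0 x Cf (fun j => CV (N - j)%N : Cb (u j)) gk kN.
rewrite {2}/u subn0 big1 ?addr0 => [|j _].
  move=> <-; apply: eq_Rintegral => w _; congr (_ + _); exact/esym/Vk.
rewrite -[RHS](expect_cst (P x) 0); apply: eq_Rintegral => w _; rewrite indicE.
case: (boolP (_ \in _)); rewrite ?mul0r// inE /= => jk; rewrite mul1r.
have : ~~ p w j by apply/negP => /kmin; rewrite leqNgt jk.
rewrite negb_or -ltnNge -ltNge => /andP[jN].
have eN : (N - j = (N - j.+1).+1)%N by rewrite subnSK.
by rewrite /u eN /= lt_max ltxx /= => gl; rewrite max_r ?subrr// ltW.
Qed.

Lemma rst_stopping_time sigma : rst F sigma -> stopping_time F (EFin \o sigma).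
Proof.
by move=> [s0 sF]; split => [w|t t0]; [rewrite /= lee_fin|exact: sF].
Qed.

Lemma stopT_rst tau (T : R) : stopping_time F tau -> 0 <= T ->
  rst F (stopT tau T) /\ forall w, stopT tau T w <= T.
Proof.
move=> [tau0 tauF] T0.
have sE w : (stopT tau T w)%:E = Order.min (tau w) T%:E.
  rewrite /stopT fineK// fin_numElt; apply/andP; split.
    by rewrite lt_min ltNyr andbT (lt_le_trans _ (tau0 w)).
  by rewrite gt_min ltry orbT.
have sT w : stopT tau T w <= T by rewrite -lee_fin sE ge_min lexx orbT.
split => //; split => [w|t t0]; first by rewrite -lee_fin sE le_min tau0 lee_fin.
have [Tt|tT] := leP T t.
  rewrite (_ : [set _ | _] = setT); first exact: (filtrationT SM t0).
  by apply/seteqP; split => // w _ /=; exact: le_trans (sT w) Tt.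
rewrite (_ : [set _ | _] = [set w | (tau w <= t%:E)%E]); first exact: tauF.
by apply/seteqP; split => w /=; rewrite -lee_fin sE ge_min lee_fin [T <= t]leNgt tT orbF.
Qed.

Lemma payoffE x tau (T : R) : stopping_time F tau -> 0 <= T ->
  payoff P X f g x tau T = (J x (stopT tau T))%:E.
Proof.
move=> st T0; have [rs sT] := stopT_rst st T0; have [s0 _] := rs.
rewrite /reward -EFin_expect; last exact: (reward_bmeas SM Cf Cg rs sT).
apply: eq_integral => w _; rewrite EFinD /path_integral /Rintegral fineK//.
apply: integrable_fin_num => //.
by have := path_integrable SM w (lexx 0) (s0 w) Cf; rewrite add0r.
Qed.

(** Truncation at a large horizon leaves a bounded stopping time unchanged, so the payoff is
    eventually constant and equals its upper limit. *)
Lemma reward_le_value x sigma (T : R) : rst F sigma -> (forall w, sigma w <= T) ->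
  ((J x sigma)%:E <= value_fun P X F f g x)%E.
Proof.
move=> rs sT; have [s0 _] := rs; have T0 : 0 <= T by exact: le_trans (s0 point) (sT point).
apply: (@le_trans _ _ (limf_esup (payoff P X f g x (EFin \o sigma)) +oo%R)); last first.
  by apply: ereal_sup_ubound; exists (EFin \o sigma) => //; exact: rst_stopping_time.
apply: le_ereal_inf_tmp => _ [A [M [_ MA]] <-].
pose S := Num.max T (Num.max 0 M) + 1.
have [TS S0 MS] : [/\ T <= S, 0 <= S & M < S].
  have : T <= Num.max T (Num.max 0 M) by rewrite le_max lexx.
  have : 0 <= Num.max T (Num.max 0 M) by rewrite !le_max lexx !orbT.
  have : M <= Num.max T (Num.max 0 M) by rewrite !le_max lexx !orbT.
  by rewrite /S; split; lra.
apply: ereal_sup_ubound; exists S; first exact: MA.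
rewrite (payoffE x (rst_stopping_time rs) S0).
congr (J x _)%:E; apply/funext => w.
by rewrite /stopT /= min_l// lee_fin (le_trans (sT w)).
Qed.

(** An upper limit is at most the supremum over all horizons [T >= 0], and each truncated payoff is
    the reward of a bounded stopping time. *)
Lemma value_le x (c : R) :
  (forall sigma T, rst F sigma -> (forall w, sigma w <= T) -> J x sigma <= c) ->
  (value_fun P X F f g x <= c%:E)%E.
Proof.
move=> Jc; apply: ge_ereal_sup => _ [tau st <-].
apply: (@le_trans _ _ (ereal_sup [set payoff P X f g x tau T | T in [set T | 0 <= T]])).
  apply: ereal_inf_lbound; exists [set T | 0 <= T] => //.
  by exists 0; split => // T /= /ltW.
apply: ge_ereal_sup => _ [T /= T0 <-]; have [rs sT] := stopT_rst st T0.
by rewrite payoffE// lee_fin; exact: Jc sT.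
Qed.

End Values.

(** * Time discretization *)

Section GridApproximation.
Context {R : realType} {E : pseudoPMetricType R} {d : measure_display}
  {Omega : measurableType d}.
Variables (P : E -> probability Omega R) (X : R -> Omega -> E)
  (F : R -> set (set Omega)).
Hypothesis PS : @paper_space R E.
Hypothesis SM : standard_markov P X F.
Hypothesis WF : weak_feller P X.
Implicit Types (phi : E -> R) (s t : R) (x : E).
Notation Pt t phi := (sgrpR P X t phi).
Notation pathint := (path_integral X).
Notation pot := (potential P X).
Notation leb := (@lebesgue_measure R).

(** By Dini's theorem [1 - eta n < 1] on [K] for all large [n]; thus [eta n] is positive there,
    which happens only inside [C n]. *)
Lemma cutoffs_absorb (C : nat -> set E) (eta : nat -> E -> R) (K : set E) :
  cutoffs C eta -> compact K -> exists N, forall n, (N <= n)%N -> K `<=` C n.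
Proof.
move=> [_ ceta _ eta0 [etaS eta1]] cK.
have [|n x|x Kx|N NP] := @dini _ _ K (fun n x => 1 - eta n x) 1 cK ltr01.
- by move=> n x; apply: cvgB; [exact: cvg_cst|exact: ceta].
- by rewrite lerD2l lerN2.
- by rewrite -(subrr (1 : R)); apply: cvgB; [exact: cvg_cst|exact: eta1].
exists N => n Nn x Kx; apply: contrapT => nC.
by have := NP n x Nn Kx; rewrite (eta0 _ _ nC) subr0 ltxx.
Qed.

(** A sequence that violates the claim leaves every compact set, so [Pt s phi] tends to 0 along it
    for every [s]; bounded convergence in [s] gives the contradiction. *)
Lemma potential_vanish phi t : 0 <= t -> Cb phi -> vanish_at_infinity phi ->
  vanish_at_infinity (pot phi t).
Proof.
move=> t0 Cphi v0 e e0; have [C [eta cut]] := exists_cutoffs PS.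
have [cC _ _ _ _] := cut; have [_ [M bM]] := Cphi.
apply: contrapT => nC.
have ex n : exists y, ~ C n y /\ e <= `|pot phi t y|.
  apply: contrapT => ny; apply: nC; exists (C n); split => // y nCy.
  by rewrite ltNge; apply/negP => ey; apply: ny; exists y.
have [y yP] := choice ex.
have cv : pot phi t (y n) @[n --> \oo] --> \int[leb]_(s in `[0, t]) 0.
  apply: (@bounded_cvg_Rintegral _ _ _ leb `[0, t] _ _ M) => //.
  - exact: lebesgue_itv_fin.
  - by move=> n; apply/measurable_EFinP; exact: measurable_int (sgrpR_path_integrable SM _ t0 Cphi).
  - move=> n s; rewrite /= in_itv /= => /andP[s0 _].
    by apply: (sgrpR_bound SM) => //; exact: Cb_borel.
  - move=> s; rewrite /= in_itv /= => /andP[s0 _].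
    have [_ _ vs] : C0 (Pt s phi) by apply: WF => //; case: Cphi.
    apply/cvgrPdist_lt => r r0; have [K [cK KP]] := vs r r0.
    have [N NP] := cutoffs_absorb cut cK.
    exists N => // n /= Nn; rewrite sub0r normrN; apply: KP => Ky.
    by apply: (yP n).1; exact: NP Nn _ Ky.
have /cvgrPdist_lt/(_ e e0)[N _ /(_ N (leqnn N))/=] := cv.
rewrite Rintegral_cst// mul0r sub0r normrN ltNge.
by rewrite (yP N).2.
Qed.

Lemma expect_path_integralT phi sigma t x : rst F sigma -> 0 <= t -> Cb phi ->
  \int[P x]_w pathint phi (sigma w) (sigma w + t) w = \int[P x]_w pot phi t (X (sigma w) w).
Proof.
move=> rs t0 Cphi.
have := expect_path_integral PS SM WF x rs measurableT _ t0 Cphi.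
rewrite -!Rintegral_indic; apply=> u u0.
by rewrite setTI; exact: rs.2.
Qed.

Lemma expect_path_integral0 phi t x : 0 <= t -> Cb phi ->
  \int[P x]_w pathint phi 0 t w = pot phi t x.
Proof.
move=> t0 Cphi; have := expect_path_integralT x (rst_cst SM (lexx 0)) t0 Cphi.
rewrite add0r => ->; rewrite -[RHS](sgrpR0 PS SM)//.
by apply: Cb_borel; exact: (potential_Cb PS SM WF).
Qed.

(** A barrier argument. By Dini's theorem the time spent during [[0, T + 1]], weighted by
    [1 - eta k], has expectation below [e / 2] for all starting points in [L]. From a point off [K]
    this weighted time exceeds [1 / 2] in expectation already over the next unit of time, and
    [sigma + 1 <= T + 1]; so [X] at time [sigma] lies off [K] with probability at most [e]. *)
Lemma containment (L : set E) (T e : R) : compact L -> 0 <= T -> 0 < e ->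
  exists2 C : set E, compact C & forall x sigma a (B c : R), L x -> rst F sigma ->
    (forall w, sigma w <= T) -> Cb a -> 0 <= B -> 0 <= c -> (forall y, a y <= B) ->
    (forall y, C y -> a y <= c) -> \int[P x]_w a (X (sigma w) w) <= c + e * B.
Proof.
move=> cL T0 e0; have [C [eta cut]] := exists_cutoffs PS.
have [cC ceta eta01 eta0 [etaS eta1]] := cut.
have T1 : 0 <= T + 1 by rewrite addr_ge0.
have Ceta k : Cb (eta k).
  by split => //; exists 1 => y; have /andP[? ?] := eta01 k y; rewrite ger0_norm.
have eta1' k y : `|eta k y| <= 1.
  by have /andP[? ?] := eta01 k y; rewrite ger0_norm.
have e2 : 0 < e / 2 by rewrite divr_gt0.
have [|k x|x Lx|k kP] := @dini _ _ L (fun k x => T + 1 - pot (eta k) (T + 1) x) _ cL e2.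
- move=> k x; apply: cvgB; first exact: cvg_cst.
  exact: (potential_Cb PS SM WF T1 (Ceta k)).1.
- rewrite lerD2l lerN2; apply: le_Rintegral => //.
  + exact: (sgrpR_path_integrable SM).
  + exact: (sgrpR_path_integrable SM).
  + move=> s; rewrite /= in_itv /= => /andP[s0 _].
    by apply: (le_sgrpR SM) => //; exact: Cb_borel.
- have -> : 0 = T + 1 - \int[leb]_(s in `[0, T + 1]) 1 :> R.
    by rewrite Rintegral_cst// mul1r fine_lebesgue_itv// subr0 subrr.
  apply: cvgB; first exact: cvg_cst.
  apply: (@bounded_cvg_Rintegral _ _ _ leb `[0, T + 1] _ _ 1) => //.
  + exact: lebesgue_itv_fin.
  + by move=> n; apply/measurable_EFinP; exact: measurable_int (sgrpR_path_integrable SM _ T1 (Ceta n)).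
  + move=> n s; rewrite /= in_itv /= => /andP[s0 _].
    by apply: (sgrpR_bound SM) => //; exact: Cb_borel.
  + move=> s; rewrite /= in_itv /= => /andP[s0 _].
    rewrite -[X in _ --> X](@sgrpR_cst _ _ _ _ P X s 1 x).
    by apply: (cvg_sgrpR (M := 1) SM) => // n; exact: (Cb_borel (Ceta n)).1.
have veta : vanish_at_infinity (eta k).
  move=> r r0; exists (C k); split => // y nC.
  by rewrite eta0// normr0.
have half0 : 0 < 2^-1 :> R by rewrite invr_gt0.
have [K [cK KP]] := potential_vanish ler01 (Ceta k) veta half0.
exists K => // x sigma a B c Lx rs sT Ca B0 c0 aB ac; have [s0 _] := rs.
have Cbar : Cb (pot (eta k) 1) by exact: (potential_Cb PS SM WF ler01).
have bar1 y : `|pot (eta k) 1 y| <= 1.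
  by rewrite -[leRHS]mulr1; exact: (potential_bound SM).
(* Off [K] the factor [1 - pot (eta k) 1] exceeds [1 / 2], so the constant 2 lifts the added term
   above [B]. *)
have ale y : a y <= c + 2 * B * (1 - pot (eta k) 1 y).
  have := bar1 y; rewrite ler_norml => /andP[_ b1].
  have [Ky|nK] := pselect (K y).
    by rewrite (le_trans (ac y Ky))// lerDl mulr_ge0 ?mulr_ge0// subr_ge0.
  have := KP y nK; move=> /ltr_normlW bh.
  have h : 0 <= B * (2^-1 - pot (eta k) 1 y) by rewrite mulr_ge0// subr_ge0 ltW.
  by move: h (aB y) c0; rewrite mulrBr mulrBr mulr1 -mulrA; lra.
have bs := stopped_bmeas SM rs Cbar.
have bM : bmeas (fun w => 2 * B * (1 - pot (eta k) 1 (X (sigma w) w))).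
  apply: bmeasM; first exact: bmeas_cst.
  by apply: bmeasB => //; exact: bmeas_cst.
apply: (@le_trans _ _ (c + 2 * B * (1 - \int[P x]_w pot (eta k) 1 (X (sigma w) w)))).
  have b1 : bmeas (fun w => 1 - pot (eta k) 1 (X (sigma w) w)).
    by apply: bmeasB => //; exact: bmeas_cst.
  have -> : c + 2 * B * (1 - \int[P x]_w pot (eta k) 1 (X (sigma w) w)) =
      \int[P x]_w (c + 2 * B * (1 - pot (eta k) 1 (X (sigma w) w))).
    rewrite expectD ?expect_cst//; last exact: bmeas_cst.
    by rewrite expectZ// expectB ?expect_cst//; exact: bmeas_cst.
  apply: le_expect => //; first exact: (stopped_bmeas SM).
  by apply: bmeasD => //; exact: bmeas_cst.
rewrite lerD2l -(expect_path_integralT _ rs ler01 (Ceta k)).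
suff : 1 - \int[P x]_w pathint (eta k) (sigma w) (sigma w + 1) w <= e / 2.
  by move=> /(ler_wpM2l B0); move: (\int[_]_w _) => I h; lra.
have := ltW (kP k x (leqnn k) Lx); apply: le_trans.
rewrite -(expect_path_integral0 _ T1 (Ceta k)).
have bp : bmeas (fun w => pathint (eta k) (sigma w) (sigma w + 1) w).
  exact: (path_integral_bmeas SM).
have bp0 : bmeas (fun w => pathint (eta k) 0 (T + 1) w).
  by have := path_integral_bmeas SM (rst_cst SM (lexx 0)) T1 (Ceta k); rewrite add0r.
have bpT : bmeas (fun w => T + pathint (eta k) (sigma w) (sigma w + 1) w).
  by apply: bmeasD => //; exact: bmeas_cst.
suff h : \int[P x]_w pathint (eta k) 0 (T + 1) w <=
    \int[P x]_w (T + pathint (eta k) (sigma w) (sigma w + 1) w).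
  move: h; rewrite (expectD _ (bmeas_cst Omega T) bp) expect_cst.
  by set I1 := Rintegral _ _ _; set I2 := Rintegral _ _ _; move: I1 I2 => I1 I2; lra.
apply: le_expect => // w.
have sT1 : sigma w + 1 <= T + 1 by rewrite lerD2r.
have s1 : sigma w <= sigma w + 1 by rewrite lerDl.
rewrite (path_integral_split SM w (Ceta k) (lexx 0) (s0 w) (le_trans s1 sT1)).
rewrite (path_integral_split SM w (Ceta k) (s0 w) s1 sT1).
have := path_integral_bound SM w (lexx 0) (s0 w) (Ceta k) (eta1' k).
rewrite add0r => /ler_normlW.
have sT0 : 0 <= T - sigma w by rewrite subr_ge0.
have s10 : 0 <= sigma w + 1 by rewrite addr_ge0.
have := path_integral_bound SM w s10 sT0 (Ceta k) (eta1' k).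
rewrite [_ + (T - _)](_ : _ = T + 1); last by ring.
by move=> /ler_normlW; lra.
Qed.

Variable g : E -> R.
Hypothesis Cg : Cb g.

Let avg k x := k.+1%:R * pot g k.+1%:R^-1 x.

Let inv_ge0 k : 0 <= k.+1%:R^-1 :> R. Proof. by rewrite invr_ge0. Qed.

Let avg_Cb k : Cb (avg k).
Proof. by apply: CbM; [exact: Cb_cst|exact: (potential_Cb PS SM WF)]. Qed.

Let avg_bound M k x : (forall y, `|g y| <= M) -> `|avg k x| <= M.
Proof.
move=> bM; rewrite /avg normrM ger0_norm// -ler_pdivlMl ?ltr0n// mulrC.
exact: (potential_bound SM).
Qed.

Let avg_cvg x : avg ^~ x @ \oo --> g x.
Proof.
apply/cvgrPdist_le => e e0.
have := sgrpR_right_continuous SM (x := x) Cg (lexx 0); rewrite (sgrpR0 PS SM); last exact: Cb_borel.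
move=> /cvgrPdist_le/(_ e e0); rewrite near_withinE => -[r /= r0 rP].
have /cvgrPdist_lt/(_ r r0) : n.+1%:R^-1 @[n --> \oo] --> (0 : R) by exact: cvg_harmonic.
apply: filterS => k; rewrite sub0r normrN ger0_norm ?invr_ge0// => kr.
have k0 : 0 < k.+1%:R :> R by rewrite ltr0n.
have cv := riemann_potential SM (x := x) (inv_ge0 k) Cg.
have cv2 : `|g x - k.+1%:R * (k.+1%:R^-1 / n.+1%:R * \sum_(i < n.+1)
    Pt (i.+1%:R * (k.+1%:R^-1 / n.+1%:R)) g x)| @[n --> \oo] --> `|g x - avg k x|.
  by apply: cvg_norm; apply: cvgB; [exact: cvg_cst|exact: cvgMr].
rewrite -(cvg_lim (@Rhausdorff _) cv2); apply: limr_le.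
  by apply/cvg_ex; eexists; exact: cv2.
apply: nearW => n; have n0 : 0 < n.+1%:R :> R by rewrite ltr0n.
rewrite mulrA mulrA mulfV ?mul1r ?lt0r_neq0//.
have -> : g x = n.+1%:R^-1 * \sum_(i < n.+1) g x.
  by rewrite sumr_const card_ord -[X in _ * X]mulr_natl mulKf ?lt0r_neq0.
rewrite -mulrBr -sumrB normrM ger0_norm ?invr_ge0// ler_pdivrMl//.
rewrite (le_trans (ler_norm_sum _ _ _))// (@le_trans _ _ (\sum_(i < n.+1) e))//.
  apply: ler_sum => i _; apply: rP => /=; last by rewrite mulr_gt0// divr_gt0 ?invr_gt0.
  rewrite sub0r normrN ger0_norm ?mulr_ge0 ?divr_ge0//.
  rewrite (le_lt_trans _ kr)// mulrCA -[leRHS]mulr1 ler_wpM2l// ler_pdivrMr// mul1r ler_nat.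
  exact: ltn_ord.
by rewrite sumr_const card_ord mulr_natl.
Qed.

(** After the strong Markov property, two time windows of equal length are compared whose starts lie
    at most [dl] apart: they differ in two end pieces, hence the factor 2. *)
Let avg_close k x sigma sigma' M dl T : (forall y, `|g y| <= M) -> rst F sigma ->
  rst F sigma' -> (forall w, sigma w <= sigma' w) -> (forall w, sigma' w <= sigma w + dl) ->
  (forall w, sigma' w <= T) ->
  `|\int[P x]_w avg k (X (sigma w) w) - \int[P x]_w avg k (X (sigma' w) w)|
  <= k.+1%:R * (2 * M * dl).
Proof.
move=> bM rs rs' ss' sd sT; have [s0 _] := rs; have [s0' _] := rs'.
have Cp : Cb (pot g k.+1%:R^-1) by exact: (potential_Cb PS SM WF).
rewrite /avg (expectZ _ _ (stopped_bmeas SM rs Cp)) (expectZ _ _ (stopped_bmeas SM rs' Cp)).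
rewrite -mulrBr normrM ger0_norm// ler_wpM2l//.
rewrite -(expect_path_integralT _ rs)// -(expect_path_integralT _ rs')//.
have b1 := path_integral_bmeas SM rs (inv_ge0 k) Cg.
have b2 := path_integral_bmeas SM rs' (inv_ge0 k) Cg.
rewrite -expectB//; apply: norm_expect_le => [|w]; first exact: bmeasB.
have M0 : 0 <= M by exact: le_trans (bM point).
have sr : sigma w + k.+1%:R^-1 <= sigma' w + k.+1%:R^-1 by rewrite lerD2r.
have sr0 : 0 <= sigma w + k.+1%:R^-1 by rewrite addr_ge0.
have := path_integral_lipschitz SM w Cg bM (s0 w) (ss' w).
have := path_integral_lipschitz SM w Cg bM sr0 sr.
have -> : sigma' w + k.+1%:R^-1 - (sigma w + k.+1%:R^-1) = sigma' w - sigma w by ring.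
rewrite [pathint g 0 (sigma' w + _) w](path_integral_split SM w Cg (lexx 0) (s0' w)) ?lerDl//.
rewrite [pathint g 0 (sigma w + _) w](path_integral_split SM w Cg (lexx 0) (s0 w)) ?lerDl//.
have : M * (sigma' w - sigma w) <= M * dl by rewrite ler_wpM2l// lerBlDl.
move: (pathint _ _ (sigma' w) w) (pathint _ _ (sigma w) w).
move: (pathint _ _ (sigma' w + _) w) (pathint _ _ (sigma w + _) w) => A B A' B'.
by rewrite !ler_norml => h /andP[? ?] /andP[? ?]; apply/andP; split; lra.
Qed.

(* Averaging g over a short time makes E g(X_sigma) Lipschitz in sigma, and along any ultrafilter
   the averages converge to g in the sense of the limiting functional. *)
Lemma uniform_grid_approximation (L : set E) (N m0 : nat) (e : R) : compact L -> 0 < e ->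
  exists2 m, (m0 <= m)%N & forall x sigma, L x -> rst F sigma -> (forall w, sigma w <= N%:R) ->
    `|\int[P x]_w g (X (sigma w) w) -
      \int[P x]_w g (X ((ceil_grid m.+1%:R^-1 (sigma w))%:R * m.+1%:R^-1) w)| <= e.
Proof.
(* Were every mesh to fail, each [n] would supply a starting point in [L] and a stopping time with
   error above [e]. The offset [m0] makes every mesh of this sequence admissible. *)
move=> cL e0; apply: contrapT => nm; pose dl n : R := (m0 + n).+1%:R^-1.
have dl0 n : 0 < dl n by rewrite invr_gt0.
have ex n : exists xs : E * (Omega -> R), [/\ L xs.1, rst F xs.2, (forall w, xs.2 w <= N%:R) &
    e < `|\int[P xs.1]_w g (X (xs.2 w) w) -
      \int[P xs.1]_w g (X ((ceil_grid (dl n) (xs.2 w))%:R * dl n) w)|].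
  apply: contrapT => nx; apply: nm; exists (m0 + n)%N => [|x sigma]; first exact: leq_addr.
  move=> Lx rs sN.
  by rewrite leNgt; apply/negP => lt; apply: nx; exists (x, sigma).
have [xs xsP] := choice ex.
pose sig n := (xs n).2; pose x n := (xs n).1.
pose sig' n w : R := (ceil_grid (dl n) (sig n w))%:R * dl n.
have rs n : rst F (sig n) by case: (xsP n).
have Lx n : L (x n) by case: (xsP n).
have sN n w : sig n w <= N%:R by case: (xsP n) => _ _ h _; exact: h.
have rs' n : rst F (sig' n).
  by apply: (grid_time_rst SM (dl0 n)); exact: (grid_time_ceil (dl0 n) (rs n)).
(* [N] is itself a grid point of each mesh, so rounding up does not leave [[0, N]]. *)
have sN' n w : sig' n w <= N%:R.
  have Nn : N%:R = (N * (m0 + n).+1)%:R * dl n by rewrite natrM mulfK.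
  by rewrite /sig' Nn ler_wpM2r ?(ltW (dl0 n))// ler_nat ceil_grid_le//; [rewrite -Nn|case: (rs n)].
have exf (y : nat -> E) (s : nat -> Omega -> R) n : rst F (s n) ->
    expectation_functional (fun a => \int[P (y n)]_w a (X (s n w) w)).
  move=> rsn; split => [a b Ca Cb_ ab|a b Ca Cb_|c].
  - by apply: le_expect => //; exact: (stopped_bmeas SM).
  - by rewrite expectD//; exact: (stopped_bmeas SM).
  - exact: expect_cst.
have tight (s : nat -> Omega -> R) : (forall n, rst F (s n)) -> (forall n w, s n w <= N%:R) ->
    uniformly_tight (fun n a => \int[P (x n)]_w a (X (s n w) w)).
  move=> rsn sNn r r0; have [C cC CP] := containment cL (ler0n R N) r0.
  by exists C => // n a B c Ca B0 c0 aB ac; exact: CP.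
have [_ [M bM]] := Cg.
have M0 : 0 <= M by exact: le_trans (bM point).
have [|||||n] := @asymptotically_equal _ _ (fun n a => \int[P (x n)]_w a (X (sig n w) w))
  (fun n a => \int[P (x n)]_w a (X (sig' n w) w)) avg g (M + M) e
  (fun n => exf x sig n (rs n)) (fun n => exf x sig' n (rs' n))
  (tight _ rs sN) (tight _ rs' sN') Cg.
- exact: avg_Cb.
- by move=> k y; rewrite (le_trans (ler_normB _ _))// lerD//; exact: avg_bound.
- exact: avg_cvg.
- move=> k; apply/cvgrPdist_le => r r0.
  have c0 : 0 < r / (k.+1%:R * (2 * M) + 1) by rewrite divr_gt0// ltr_pwDr// mulr_ge0// mulr_ge0.
  have /cvgrPdist_lt/(_ _ c0) : n.+1%:R^-1 @[n --> \oo] --> (0 : R) by exact: cvg_harmonic.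
  apply: filterS => n; rewrite !sub0r !normrN ger0_norm ?invr_ge0// => nr'.
  have nr : dl n < r / (k.+1%:R * (2 * M) + 1).
    by apply: le_lt_trans nr'; rewrite lef_pV2 ?posrE// ler_nat ltnS leq_addl.
  apply: le_trans (avg_close k (x n) bM (rs n) (rs' n) (dl := dl n) _ _ (sN' n)) _.
  + by move=> w; apply: le_ceil_grid => //; case: (rs n).
  + by move=> w; apply: ltW; apply: ceil_grid_lt => //; case: (rs n).
  + move: nr; rewrite ltr_pdivlMr ?ltr_pwDr// ?mulr_ge0 ?mulr_ge0// => nr.
    by rewrite mulrA mulrC (le_trans _ (ltW nr))// ler_wpM2l ?(ltW (dl0 n))// lerDl.
- exact: e0.
by have [_ _ _ /lt_trans h] := xsP n => /h; rewrite ltxx.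
Qed.

End GridApproximation.

(** * Ergodicity and the corrector *)

Section Ergodicity.
Context {R : realType} {E : pseudoPMetricType R} {d : measure_display}
  {Omega : measurableType d}.
Variables (P : E -> probability Omega R) (X : R -> Omega -> E)
  (F : R -> set (set Omega)) (mu : probability (borelE E) R).
Hypothesis SM : standard_markov P X F.
Hypothesis ER : ergodic_to P X mu.
Implicit Types (phi : E -> R) (s t : R) (x : E).
Notation Pt t phi := (sgrpR P X t phi).
Notation pot := (potential P X).
Notation leb := (@lebesgue_measure R).

Lemma tv_set t x (c : R) (A : set (borelE E)) : 0 <= t -> measurable A ->
  (tv P X mu t x <= c%:E)%E -> `|fine (trans P X t x A) - fine (mu A)| <= c.
Proof.
move=> t0 mA tvc.
have mXA : measurable (X t @^-1` A) by exact: (filtration_measurable SM t0 (adapted SM t0 mA)).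
rewrite -lee_fin (le_trans _ tvc)//.
have -> : (`|fine (trans P X t x A) - fine (mu A)|%:E = `|trans P X t x A - mu A|)%E.
  rewrite -abse_EFin EFinB !fineK//; first exact: fin_num_measure.
  by apply: (fin_num_measure (P x)).
by apply: ereal_sup_ubound; exists A.
Qed.

Lemma tv_unit t x (c : R) phi : 0 <= t -> (tv P X mu t x <= c%:E)%E ->
  measurable_fun [set: borelE E] (phi : borelE E -> R) -> (forall y, 0 <= phi y <= 1) ->
  `|Pt t phi x - \int[mu]_y phi y| <= c.
Proof.
move=> t0 tvc mphi p01; pose lay n := layers (phi : borelE E -> R) n.
have mlev (n i : nat) : @measurable _ (borelE E) [set y | i%:R / n.+1%:R <= phi y].
  exact: (@measurable_level _ (borelE E)).
have bl n : borel_bounded (lay n : E -> R) by exact: (@layers_bmeas _ (borelE E)).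
have cP : Pt t (lay n) x @[n --> \oo] --> Pt t phi x.
  apply: (cvg_sgrpR (M := 2) SM) => //.
  - by move=> n; exact: (bl n).1.
  - move=> n y; have := @layers_dist _ (borelE E) R phi p01 n y; have /andP[p0 p1] := p01 y.
    have : n.+1%:R^-1 <= 1 :> R by rewrite invf_le1 ?ltr0n// ler1n.
    rewrite !ler_norml /lay; move: (layers _ _ _) (_^-1) p0 p1 => a b p0 p1 n1 /andP[? ?].
    by apply/andP; split; lra.
  - by move=> y; exact: (@layers_cvg _ (borelE E)).
have cm : \int[mu]_y lay n y @[n --> \oo] --> \int[mu]_y phi y.
  exact: (@cvg_expect_layers _ (borelE E)).
have cd : `|Pt t (lay n) x - \int[mu]_y lay n y| @[n --> \oo] -->
    `|Pt t phi x - \int[mu]_y phi y|.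
  by apply: cvg_norm; exact: cvgB.
rewrite -(cvg_lim (@Rhausdorff _) cd); apply: limr_le.
  by apply/cvg_ex; eexists; exact: cd.
apply: nearW => n; rewrite (expect_layers mphi mu n).
have -> : Pt t (lay n) x =
    n.+1%:R^-1 * \sum_(i < n.+1) fine (trans P X t x [set y | i.+1%:R / n.+1%:R <= phi y]).
  have bi i : bmeas (fun w => \1_[set y | i%:R / n.+1%:R <= phi y] (X t w) : R).
    by apply: (bmeas_comp SM t0 (phi := \1__)); apply: (@bmeas_indic _ (borelE E)).
  rewrite sgrpRE /lay /layers expectZ; last by apply: bmeas_sum => i; exact: bi.
  rewrite expect_sum; last by move=> i; exact: bi.
  congr (_ * _); apply: eq_bigr => i _; rewrite /trans.
  by rewrite -expect_indic//; exact: (filtration_measurable SM t0 (adapted SM t0 (mlev _ _))).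
rewrite -mulrBr -sumrB normrM ger0_norm ?invr_ge0// ler_pdivrMl ?ltr0n//.
rewrite (le_trans (ler_norm_sum _ _ _))// (@le_trans _ _ (\sum_(i < n.+1) c))//.
  by apply: ler_sum => i _; exact: tv_set.
by rewrite sumr_const card_ord mulr_natl.
Qed.

Lemma tv_bounded t x (c M : R) phi : 0 <= t -> (tv P X mu t x <= c%:E)%E ->
  measurable_fun [set: borelE E] (phi : borelE E -> R) -> 0 < M -> (forall y, `|phi y| <= M) ->
  `|Pt t phi x - \int[mu]_y phi y| <= 2 * M * c.
Proof.
move=> t0 tvc mphi M0 bM.
pose psi y := (2 * M)^-1 * (phi y + M).
have bphi : borel_bounded phi by split => //; exists M.
have bpM : borel_bounded (fun y => phi y + M).
  by apply: (@bmeasD _ (borelE E)) => //; exact: (@bmeas_cst _ (borelE E)).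
have mpsi : measurable_fun [set: borelE E] (psi : borelE E -> R).
  by apply: measurable_funM => //; exact: measurable_funD.
have p01 y : 0 <= psi y <= 1.
  have := bM y; rewrite ler_norml => /andP[h1 h2].
  rewrite mulr_ge0 ?invr_ge0 ?mulr_ge0 ?(ltW M0)//=; last lra.
  by rewrite /psi mulrC ler_pdivrMr ?mulr_gt0// mul1r; lra.
have := tv_unit t0 tvc mpsi p01.
have -> : Pt t psi x = (2 * M)^-1 * (Pt t phi x + M).
  by rewrite (sgrpRZ SM)// (sgrpRD SM)// ?sgrpR_cst//; exact: (@bmeas_cst _ (borelE E)).
have -> : \int[mu]_y psi y = (2 * M)^-1 * (\int[mu]_y phi y + M).
  rewrite (@expectZ _ (borelE E) R mu _ (fun y => phi y + M))//.
  by rewrite (@expectD _ (borelE E)) ?expect_cst//; exact: (@bmeas_cst _ (borelE E)).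
rewrite -mulrBr opprD addrACA subrr addr0 normrM ger0_norm ?invr_ge0 ?mulr_ge0 ?(ltW M0)//.
by rewrite ler_pdivrMl ?mulr_gt0.
Qed.

Lemma ergodic_cvg phi x (e : R) : borel_bounded phi -> 0 < e ->
  exists T : R, forall t, 0 <= t -> T <= t -> `|Pt t phi x - \int[mu]_y phi y| <= e.
Proof.
move=> [mphi [M0 bM0]] e0; pose M := `|M0| + 1; have M_gt0 : 0 < M by rewrite ltr_pwDr.
have bM y : `|phi y| <= M by rewrite (le_trans (bM0 y))// /M (le_trans (ler_norm _))// lerDl.
pose c := e / (2 * M).
have c0 : 0 < c by rewrite divr_gt0// mulr_gt0.
have := ER x; move=> /(_ [set y | y < c%:E]%E).
have nb : nbhs (0 : \bar R)%E [set y | (y < c%:E)%E] by apply: lt_nbhsl; exact: c0.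
move=> /(_ nb) [T [_ TP]]; exists (T + 1) => t t0 Tt.
have lt : (tv P X mu t x < c%:E)%E by apply: TP; lra.
rewrite (le_trans (tv_bounded t0 (ltW lt) mphi M_gt0 bM))//.
by rewrite /c mulrC divfK// lt0r_neq0// mulr_gt0.
Qed.

(** [P_{u+t} phi] and [P_u (P_t phi)] agree at any point; as [u] grows, ergodicity sends the former
    to [mu phi] and the latter to [mu (P_t phi)]. *)
Lemma invariance t phi : 0 <= t -> borel_bounded phi ->
  \int[mu]_y Pt t phi y = \int[mu]_y phi y.
Proof.
move=> t0 bphi; apply/eqP; rewrite -subr_eq0 -normr_eq0 eq_le normr_ge0 andbT.
suff H (e : R) : 0 < e -> `|\int[mu]_y Pt t phi y - \int[mu]_y phi y| <= e.
  by apply/ler_addgt0Pl => e e0; rewrite addr0; exact: H.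
move=> e0; have e2 : 0 < e / 2 by rewrite divr_gt0.
have [T1 h1] := ergodic_cvg point bphi e2.
have [T2 h2] := ergodic_cvg point (sgrpR_borel SM t0 bphi) e2.
pose u := `|T1| + `|T2|.
have u0 : 0 <= u by rewrite addr_ge0.
have uT1 : T1 <= u + t by rewrite (le_trans (ler_norm _))// /u -addrA lerDl addr_ge0.
have uT2 : T2 <= u by rewrite (le_trans (ler_norm _))// /u lerDr.
have := h1 _ (addr_ge0 u0 t0) uT1; have := h2 _ u0 uT2.
rewrite [Pt (u + t) _ _](sgrpR_comp SM)//; move: (Pt u (Pt t phi) point) (\int[mu]_y Pt t phi y) (\int[mu]_y phi y) => a b c.
by rewrite !ler_norml => /andP[? ?] /andP[? ?]; apply/andP; split; lra.
Qed.

(** By invariance the discrepancy of a set [A] at time [s + u] is that of the function [P_u 1_A],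
    with values in [[0, 1]], at time [s]. *)
Lemma tv_mono s u x (c : R) : 0 <= s -> 0 <= u ->
  (tv P X mu s x <= c%:E)%E -> (tv P X mu (s + u) x <= c%:E)%E.
Proof.
move=> s0 u0 tvc; apply: ge_ereal_sup => _ [A mA <-].
have su0 : 0 <= s + u by rewrite addr_ge0.
have mXA : measurable (X (s + u) @^-1` A).
  exact: (filtration_measurable SM su0 (adapted SM su0 mA)).
have bA : borel_bounded (\1_A : E -> R) by exact: (@bmeas_indic _ (borelE E)).
have bPA := sgrpR_borel SM u0 bA.
have p01 y : 0 <= Pt u (\1_A : E -> R) y <= 1.
  apply/andP; split.
    rewrite -[leLHS](@sgrpR_cst _ _ _ _ P X u 0 y); apply: (le_sgrpR SM) => //.
    exact: (@bmeas_cst _ (borelE E)).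
  rewrite -[leRHS](@sgrpR_cst _ _ _ _ P X u 1 y); apply: (le_sgrpR SM) => //.
  exact: (@bmeas_cst _ (borelE E)).
have := tv_unit s0 tvc bPA.1 p01.
rewrite -(sgrpR_comp SM)// invariance// sgrpRE.
have -> : \int[P x]_w (\1_A (X (s + u) w) : R) = fine (trans P X (s + u) x A).
  by rewrite /trans -expect_indic.
rewrite (expect_indic mu mA) => h.
have fx : trans P X (s + u) x A \is a fin_num by apply: (fin_num_measure (P x)).
have fm : mu A \is a fin_num by exact: fin_num_measure.
by rewrite -(fineK fx) -(fineK fm) -EFinB abse_EFin lee_fin.
Qed.

Variables (K : E -> R) (h : R -> R).
Hypothesis K_gt0 : forall x, 0 < K x.
Hypothesis h_ge0 : forall t, 0 <= t -> 0 <= h t.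
Hypothesis h_int : leb.-integrable `[0, +oo[ (EFin \o h).
Hypothesis D1 : forall x t, 0 <= t -> (tv P X mu t x < (K x * h t)%:E)%E.

(** As [h] is merely integrable, its values at integers need not be summable; its masses over unit
    intervals are. *)
Definition unit_mass (k : nat) : R := \int[leb]_(s in `[k%:R, k.+1%:R]) h s.

Let h_int_itv (a b : R) : 0 <= a -> leb.-integrable `[a, b] (EFin \o h).
Proof.
move=> a0; apply: integrableS h_int => //= s /=; rewrite !in_itv /= andbT => /andP[h1 _].
exact: le_trans h1.
Qed.

Lemma unit_mass_ge0 k : 0 <= unit_mass k.
Proof.
apply: Rintegral_ge0 => s; rewrite /= in_itv /= => /andP[ks _]; apply: h_ge0.
exact: le_trans ks.
Qed.

(** The distance to [mu] does not increase with time, so at [k + 1] it is at most [K x * h s] for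
    every [s] in [[k, k + 1]]; this is integrated over [s]. *)
Lemma tv_unit_mass k x : (tv P X mu k.+1%:R x <= (K x * unit_mass k)%:E)%E.
Proof.
have tvfin : tv P X mu k.+1%:R x \is a fin_num.
  rewrite fin_numElt; apply/andP; split; last exact: lt_trans (D1 x (ler0n R k.+1)) (ltry _).
  apply: (@lt_le_trans _ _ 0%E); first by rewrite ltNy0.
  apply: le_trans (abse_ge0 (trans P X k.+1%:R x set0 - mu set0)) _.
  by apply: ereal_sup_ubound; exists set0 => //; exact: measurable0.
rewrite -(fineK tvfin) lee_fin; set c := fine _.
have ch s : k%:R <= s <= k.+1%:R -> c <= K x * h s.
  move=> /andP[ks sk]; have s0 : 0 <= s by exact: le_trans ks.
  have sk0 : 0 <= k.+1%:R - s by rewrite subr_ge0.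
  have := tv_mono s0 sk0 (ltW (D1 x s0)).
  by rewrite addrC subrK -(fineK tvfin) lee_fin.
have kk : k%:R <= k.+1%:R :> R by rewrite ler_nat.
have ihx := h_int_itv k.+1%:R (ler0n R k).
rewrite /unit_mass -RintegralZl//.
have -> : c = \int[leb]_(s in `[k%:R, k.+1%:R]) c.
  rewrite Rintegral_cst// fine_lebesgue_itv// -natrB// subSnn mulr1//.
apply: le_Rintegral => //.
- apply: (@bounded_integrable _ _ _ _ _ _ `|c|) => //.
  exact: lebesgue_itv_fin.
- rewrite (_ : _ \o _ = (fun s => ((K x)%:E * (EFin \o h) s))%E); first exact: integrableZl.
  by apply/funext => s /=; rewrite EFinM.
Qed.

Lemma unit_mass_sum N : \sum_(k < N) unit_mass k = \int[leb]_(s in `[0, N%:R]) h s.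
Proof.
elim: N => [|N IH]; first by rewrite big_ord0 set_itv1 Rintegral_set1.
rewrite big_ord_recr /= IH /unit_mass.
have NN : N%:R <= N.+1%:R :> R by rewrite ler_nat.
have := Rintegral_itvB (h_int_itv N.+1%:R (lexx 0)) (_ : (BLeft 0 <= BRight N%:R)%O)
  (_ : (BRight N%:R <= BRight N.+1%:R)%O).
rewrite !bnd_simp => /(_ (ler0n R N) NN); rewrite Rintegral_itv_obnd_cbnd; last first.
  apply: integrableS (h_int_itv N.+1%:R (ler0n R N)) => //; exact: subset_itv_oc_cc.
by move=> <-; rewrite subrKC.
Qed.

Definition total_mass : R := \int[leb]_(s in `[0, +oo[) h s.

Lemma unit_mass_sum_le N : \sum_(k < N) unit_mass k <= total_mass.
Proof.
rewrite unit_mass_sum /total_mass; apply: fine_le.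
- by apply: integrable_fin_num => //; exact: h_int_itv.
- exact: integrable_fin_num.
apply: ge0_subset_integral => //.
- by apply: measurable_int h_int.
- by move=> s; rewrite /= in_itv /= andbT lee_fin; exact: h_ge0.
- by move=> s; rewrite /= !in_itv /= andbT => /andP[].
Qed.

Lemma unit_mass_tail (e : R) : 0 < e ->
  exists T, forall m n, (T <= m)%N -> (m <= n)%N -> \sum_(m <= k < n) unit_mass k <= e.
Proof.
move=> e0; pose S n := \sum_(0 <= k < n) unit_mass k.
have Sle n : S n <= total_mass by rewrite /S big_mkord unit_mass_sum_le.
have ndS : nondecreasing_seq S.
  by apply/nondecreasing_seqP => n; rewrite /S big_nat_recr//= lerDl unit_mass_ge0.
have cS : cvgn S by apply: nondecreasing_is_cvgn => //; exists total_mass => _ [n _ <-].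
have /cvgrPdist_le/(_ e e0)[T _ TP] := cS.
exists T => m n Tm mn.
have := TP m Tm; rewrite /= ger0_norm ?subr_ge0; last exact: nondecreasing_cvgn_le.
have := nondecreasing_cvgn_le ndS cS n.
have -> : S n = S m + \sum_(m <= k < n) unit_mass k by rewrite /S -big_cat_nat.
lra.
Qed.

End Ergodicity.

(** * The corrector and the Poisson equation *)

Section Corrector.
Context {R : realType} {E : pseudoPMetricType R} {d : measure_display}
  {Omega : measurableType d}.
Variables (P : E -> probability Omega R) (X : R -> Omega -> E)
  (F : R -> set (set Omega)) (mu : probability (borelE E) R).
Hypothesis PS : @paper_space R E.
Hypothesis SM : standard_markov P X F.
Hypothesis WF : weak_feller P X.
Hypothesis ER : ergodic_to P X mu.
Implicit Types (s t : R) (x : E).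
Notation Pt t phi := (sgrpR P X t phi).
Notation leb := (@lebesgue_measure R).
Variables (K : E -> R) (h : R -> R).
Hypothesis K_gt0 : forall x, 0 < K x.
Hypothesis K_compact : forall C : set E, compact C -> exists M : R, forall x, C x -> K x <= M.
Hypothesis h_ge0 : forall t, 0 <= t -> 0 <= h t.
Hypothesis h_int : leb.-integrable `[0, +oo[ (EFin \o h).
Hypothesis D1 : forall x t, 0 <= t -> (tv P X mu t x < (K x * h t)%:E)%E.
Hypothesis D2 : forall x (T : R), 0 <= T -> (\int[P x]_w (K (X T w))%:E < +oo)%E.
Variables (phi : E -> R) (M : R) (B : set E).
Hypothesis Cphi : Cb phi.
Hypothesis M_gt0 : 0 < M.
Hypothesis phiM : forall x, `|phi x| <= M.
Hypothesis phi_mean0 : \int[mu]_x phi x = 0.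
Hypothesis B_compact : compact B.
Hypothesis phi_off : forall x, ~ B x -> 0 <= phi x.
Notation c := (unit_mass h).
Notation H := (total_mass h).

Let bphi : borel_bounded phi := Cb_borel Cphi.

(** Partial sums of the Neumann series for the Poisson equation [Q - P_1 Q = phi]. Finite [N] keeps
    them bounded and continuous, which the limit need not be. *)
Definition corrector (N : nat) x : R := \sum_(0 <= k < N) Pt k%:R phi x.
Let Q := corrector.

Lemma corrector_Cb N : Cb (Q N).
Proof.
elim: N => [|N IH].
  rewrite (_ : Q 0%N = fun=> 0); first exact: Cb_cst.
  by apply/funext => x; rewrite /Q /corrector big_geq.
rewrite (_ : Q N.+1 = fun x => Q N x + Pt N%:R phi x).
  by apply: CbD => //; exact: (sgrpR_Cb PS SM WF).
by apply/funext => x; rewrite /Q /corrector big_nat_recr.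
Qed.

Lemma decay k x : `|Pt k.+1%:R phi x| <= 2 * M * (K x * c k).
Proof.
have := tv_bounded SM (ler0n R k.+1) (tv_unit_mass SM ER h_int D1 k x)
  bphi.1 M_gt0 phiM.
by rewrite phi_mean0 subr0.
Qed.

Lemma sum_norm_le N x : \sum_(0 <= k < N) `|Pt k%:R phi x| <= M + 2 * M * H * K x.
Proof.
have H0 : 0 <= H by have := unit_mass_sum_le h_ge0 h_int 0; rewrite big_ord0.
have b0 : 0 <= 2 * M * H * K x by rewrite !mulr_ge0// ltW.
case: N => [|N]; first by rewrite big_geq// addr_ge0// ltW.
rewrite big_nat_recl// lerD//; first exact: (sgrpR_bound SM).
rewrite (@le_trans _ _ (\sum_(0 <= k < N) 2 * M * (K x * c k)))//.
  by apply: ler_sum => k _; exact: decay.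
rewrite -mulr_sumr -mulr_sumr -!mulrA ler_wpM2l// ler_wpM2l ?(ltW M_gt0)// mulrC.
by rewrite ler_wpM2r ?(ltW (K_gt0 x))// big_mkord; exact: unit_mass_sum_le.
Qed.

Lemma corrector_bound N x : `|Q N x| <= M + 2 * M * H * K x.
Proof. exact: le_trans (ler_norm_sum _ _ _) (sum_norm_le N x). Qed.

Lemma corrector_shift m N x : Pt m%:R (Q N) x = Q (m + N)%N x - Q m x.
Proof.
have bk k : bmeas (fun w => Pt k%:R phi (X m%:R w)).
  by apply: (bmeas_comp SM) => //; exact: (sgrpR_borel SM).
rewrite /Q /corrector (big_cat_nat (n := m)) ?leq_addr//= addrAC subrr add0r.
rewrite -{2}[m]add0n big_addn addKn sgrpRE expect_sum//.
by apply: eq_bigr => k _; rewrite addnC natrD (sgrpR_comp SM).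
Qed.

Lemma corrector_succ N x : Q N.+1 x = phi x + Pt 1 (Q N) x.
Proof.
rewrite (corrector_shift 1) add1n /Q {3}/corrector big_nat1 (sgrpR0 PS SM)//.
by rewrite subrKC.
Qed.

(* Minimum principle: outside B the function phi is nonnegative, so the corrector
   cannot be smaller there than its infimum over B. *)
Lemma corrector_lower_bound : exists2 C : R, 0 <= C & forall N x, - C <= Q N x.
Proof.
have [KB KBP] := K_compact B_compact.
have H0 : 0 <= H by have := unit_mass_sum_le h_ge0 h_int 0; rewrite big_ord0.
(* The bound of [corrector_bound] over [B]; the absolute value covers an empty [B], for which [KB]
   may be negative. *)
pose C := M + 2 * M * H * `|KB|.
have C0 : 0 <= C by rewrite addr_ge0 ?(ltW M_gt0)// !mulr_ge0// ltW.
exists C => // N; elim: N => [|N IH] x; first by rewrite /Q /corrector big_geq// oppr_le0.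
have [Bx|nBx] := pselect (B x).
  rewrite lerNl (le_trans (ler_norm _))// normrN (le_trans (corrector_bound _ _))//.
  rewrite lerD2l ler_wpM2l ?mulr_ge0 ?(ltW M_gt0)//.
  exact: le_trans (KBP x Bx) (ler_norm _).
rewrite corrector_succ ler_wpDl ?phi_off//.
rewrite -[leLHS](@sgrpR_cst _ _ _ _ P X 1 (- C) x); apply: (le_sgrpR SM) => //.
  exact: Cb_borel (Cb_cst _).
exact: Cb_borel (corrector_Cb N).
Qed.

Lemma sum_norm_cvg x : cvgn (fun N => \sum_(0 <= k < N) `|Pt k%:R phi x|).
Proof.
apply: nondecreasing_is_cvgn.
  by apply/nondecreasing_seqP => n; rewrite big_nat_recr//= lerDl.
by exists (M + 2 * M * H * K x) => _ [n _ <-]; exact: sum_norm_le.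
Qed.

Lemma corrector_cvg x : cvgn (Q ^~ x).
Proof. exact: (@normed_cvg R R (fun k => Pt k%:R phi x) (@sum_norm_cvg x)). Qed.

(** A measurable majorant of all correctors at once, to serve as the dominating function where [K]
    might not be measurable. *)
Let S x := limn (fun N => \sum_(0 <= k < N) `|Pt k%:R phi x|).

Let S_measurable : measurable_fun [set: borelE E] (S : borelE E -> R).
Proof.
apply: (@measurable_fun_cvg _ (borelE E) R setT (fun N x => \sum_(0 <= k < N) `|Pt k%:R phi x|)).
  move=> N; apply: measurable_sum => k; apply: measurableT_comp => //.
  exact: (sgrpR_borel SM (ler0n R k) bphi).1.
by move=> x _; exact: sum_norm_cvg.
Qed.

Let sum_norm_le_S N x : \sum_(0 <= k < N) `|Pt k%:R phi x| <= S x.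
Proof.
apply: (@nondecreasing_cvgn_le _ (fun N => \sum_(0 <= k < N) `|Pt k%:R phi x|)).
  by apply/nondecreasing_seqP => n; rewrite big_nat_recr//= lerDl.
exact: sum_norm_cvg.
Qed.

Let S_ge0 x : 0 <= S x.
Proof. by have := sum_norm_le_S 0 x; rewrite big_geq. Qed.

Let S_le x : S x <= M + 2 * M * H * K x.
Proof.
apply: limr_le; first exact: sum_norm_cvg.
by apply: nearW => N; exact: sum_norm_le.
Qed.

(* K need not be measurable: its lower integral controls the measurable minorant of S. *)
Let S_integrable (y : E) (m : nat) : (P y).-integrable setT (EFin \o (fun w => S (X m%:R w))).
Proof.
have H0 : 0 <= H by have := unit_mass_sum_le h_ge0 h_int 0; rewrite big_ord0.
(* The summand 1 keeps [b] positive. [Z] is built to satisfy both [S <= M + b Z] and [Z <= K] at the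
   position at time [m]. *)
pose b := 2 * M * H + 1.
have b0 : 0 < b by rewrite ltr_wpDl// !mulr_ge0// ltW.
pose Z w := b^-1 * Num.max (S (X m%:R w) - M) 0.
have mS : measurable_fun setT (fun w => S (X m%:R w)).
  exact: (borel_comp_measurable SM (ler0n R m) S_measurable).
have mZ : measurable_fun setT Z.
  by apply: measurable_funM => //; apply: measurable_maxr => //; exact: measurable_funB.
have Z0 w : 0 <= Z w by rewrite mulr_ge0 ?invr_ge0 ?(ltW b0)// le_max lexx orbT.
have ZK w : Z w <= K (X m%:R w).
  rewrite /Z ler_pdivrMl// ge_max mulr_ge0 ?(ltW b0) ?(ltW (K_gt0 _))// andbT.
  rewrite lerBlDl (le_trans (S_le _))// lerD2l ler_wpM2r ?(ltW (K_gt0 _))//.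
  by rewrite /b lerDl.
have iZ : (P y).-integrable setT (EFin \o Z).
  apply/integrableP; split; first exact/measurable_EFinP.
  apply: le_lt_trans (D2 y (ler0n R m)).
  apply: ge0_le_nonmeasurable_integral => w; first exact: abse_ge0.
  by rewrite /= lee_fin ger0_norm.
have iMZ : (P y).-integrable setT (EFin \o (fun w => M + b * Z w)).
  rewrite (_ : _ \o _ = (EFin \o (fun=> M)) \+ (fun w => b%:E * (EFin \o Z) w))%E.
    apply: integrableD => //; last exact: integrableZl.
    exact: bmeas_integrable (bmeas_cst _ _).
  by apply/funext => w /=; rewrite EFinD EFinM.
apply: le_integrable iMZ => //; first exact/measurable_EFinP.
move=> w _ /=; rewrite lee_fin ger0_norm//.
rewrite (le_trans _ (ler_norm _))// /Z mulrA mulfV ?mul1r ?lt0r_neq0//.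
by rewrite -lerBlDl le_max lexx.
Qed.

Let Qoo x := limn (Q ^~ x).

Let corrector_le_S N x : `|Q N x| <= S x.
Proof. exact: le_trans (ler_norm_sum _ _ _) (sum_norm_le_S N x). Qed.

Let Qoo_le_S x : `|Qoo x| <= S x.
Proof.
have cv : `|Q N x| @[N --> \oo] --> `|Qoo x| by apply: cvg_norm; exact: corrector_cvg.
rewrite -(cvg_lim (@Rhausdorff _) cv); apply: limr_le.
  by apply/cvg_ex; eexists; exact: cv.
by apply: nearW => N; exact: corrector_le_S.
Qed.

Let Qoo_measurable : measurable_fun [set: borelE E] (Qoo : borelE E -> R).
Proof.
apply: (@measurable_fun_cvg _ (borelE E) R setT Q).
  by move=> N; exact: (Cb_borel (corrector_Cb N)).1.
by move=> x _; exact: corrector_cvg.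
Qed.

Section LowerBound.
Variables (CB : R).
Hypothesis CB0 : 0 <= CB.
Hypothesis Q_ge : forall N x, - CB <= Q N x.

Let W N x := Q N x + CB.
Let Woo x := Qoo x + CB.

Let W_ge0 N x : 0 <= W N x.
Proof. by rewrite /W -lerBlDr sub0r. Qed.

Let W_cvg x : W ^~ x @ \oo --> Woo x.
Proof. by apply: cvgD; [exact: corrector_cvg|exact: cvg_cst]. Qed.

Let W_Cb N : Cb (W N).
Proof. by apply: CbD; [exact: corrector_Cb|exact: Cb_cst]. Qed.

Let Woo_ge0 x : 0 <= Woo x.
Proof.
rewrite -(cvg_lim (@Rhausdorff _) (@W_cvg x)); apply: limr_ge.
  by apply/cvg_ex; eexists; exact: W_cvg.
by apply: nearW.
Qed.

Let Woo_measurable : measurable_fun [set: borelE E] (Woo : borelE E -> R).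
Proof. exact: measurable_funD. Qed.

Let cvg_min_nat (a : R) : 0 <= a -> Num.min a n%:R @[n --> \oo] --> a.
Proof.
move=> a0; apply: cvg_near_cst; exists (Num.truncn a).+1 => // n /= an.
by rewrite min_l// ltW// (lt_le_trans (truncnS_gt _))// ler_nat.
Qed.

Let S_CB_integrable (y : E) (m : nat) :
  (P y).-integrable setT (EFin \o (fun w => S (X m%:R w) + CB)).
Proof.
rewrite (_ : _ \o _ = (EFin \o (fun w => S (X m%:R w))) \+ (EFin \o (fun=> CB)))%E.
  apply: integrableD => //; first exact: S_integrable.
  exact: bmeas_integrable (bmeas_cst _ _).
by apply/funext => w /=; rewrite EFinD.
Qed.

(** The limit of [corrector_shift] as [N] grows, dominated by [S + CB]. The right-hand side is [CB]
    plus the tail of the corrector from [m] on, so it tends to [CB] with [m]. *)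
Let expect_Woo y m : \int[P y]_w Woo (X m%:R w) = Woo y - Q m y.
Proof.
have c1 : Pt m%:R (W N) y @[N --> \oo] --> \int[P y]_w Woo (X m%:R w).
  apply: (@dominated_cvg_Rintegral _ _ _ _ _ _ _ (fun w => S (X m%:R w) + CB)) => //.
  - exact: S_CB_integrable.
  - by move=> N; apply: (borel_comp_measurable SM) => //; exact: (Cb_borel (W_Cb N)).1.
  - by move=> N w _; rewrite (le_trans (ler_normD _ _))// lerD// ger0_norm.
have c2 : Pt m%:R (W N) y @[N --> \oo] --> Woo y - Q m y.
  under eq_fun => N.
    rewrite (sgrpRD SM)// ?sgrpR_cst ?corrector_shift; [|exact: Cb_borel (corrector_Cb N)|exact: Cb_borel (Cb_cst _)].
    over.
  rewrite /Woo addrAC; apply: cvgD; last exact: cvg_cst.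
  apply: cvgB; last exact: cvg_cst.
  under eq_fun do rewrite addnC.
  apply: (cvg_comp (fun N => (N + m)%N) (Q ^~ y)); first exact: cvg_addnr.
  exact: corrector_cvg.
by rewrite -(cvg_lim (@Rhausdorff R) c1) -(cvg_lim (@Rhausdorff R) c2).
Qed.

Let min_borel (V : E -> R) (n : nat) : measurable_fun [set: borelE E] (V : borelE E -> R) ->
  (forall x, 0 <= V x) -> borel_bounded (fun x => Num.min (V x) n%:R).
Proof.
move=> mV V0; split; first exact: (@measurable_minr _ (borelE E)).
by exists n%:R => x; rewrite ger0_norm ?ge_min ?lexx ?orbT// le_min V0 ler0n.
Qed.

Let cvg_min_Woo y m : Pt m%:R (fun x => Num.min (Woo x) n%:R) y @[n --> \oo] --> Woo y - Q m y.
Proof.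
rewrite -expect_Woo.
apply: (@dominated_cvg_Rintegral _ _ _ _ _ _ _ (fun w => S (X m%:R w) + CB)) => //.
- exact: S_CB_integrable.
- move=> n; apply: (borel_comp_measurable SM (ler0n R m) (phi := fun x => Num.min (Woo x) n%:R)).
  exact: (min_borel n Woo_measurable Woo_ge0).1.
- move=> n w _; rewrite ger0_norm ?le_min ?Woo_ge0 ?ler0n// ge_min /Woo lerD2r.
  by rewrite (le_trans (ler_norm _) (Qoo_le_S _)).
- by move=> w _; exact: cvg_min_nat.
Qed.

(* Fatou along P_m Woo = CB + (tail of the corrector) -> CB, since mu is invariant. *)
Lemma mean_min_limit (e : R) : 0 < e ->
  exists n : nat, CB - e < \int[mu]_x Num.min (Woo x) n%:R.
Proof.
move=> e0; apply: contrapT => nn.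
have le_n n : \int[mu]_x Num.min (Woo x) n%:R <= CB - e.
  by rewrite leNgt; apply/negP => lt; apply: nn; exists n.
(* A second truncation, at a level above [CB]: it gives access to bounded convergence under [mu] and
   leaves the limit [CB] intact. *)
pose p := (Num.truncn CB).+1.
have CBp : CB <= p%:R by rewrite ltW// truncnS_gt.
pose u m x := Num.min (Woo x - Q m x) p%:R.
have um_ge0 m x : 0 <= Woo x - Q m x.
  rewrite -(cvg_lim (@Rhausdorff _) (@cvg_min_Woo x m)); apply: limr_ge.
    by apply/cvg_ex; eexists; exact: cvg_min_Woo.
  apply: nearW => n; apply: expect_ge => [|w]; last by rewrite le_min Woo_ge0 ler0n.
  by apply: (bmeas_comp SM (ler0n R m) (min_borel n Woo_measurable Woo_ge0)).
have bPm m n := sgrpR_borel SM (ler0n R m) (min_borel n Woo_measurable Woo_ge0).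
have Pm_ge0 m n x : 0 <= Pt m%:R (fun x => Num.min (Woo x) n%:R) x.
  apply: expect_ge => [|w]; last by rewrite le_min Woo_ge0 ler0n.
  exact: (bmeas_comp SM (ler0n R m) (min_borel n Woo_measurable Woo_ge0)).
(* By invariance [P_m min(Woo, n)] has the same mean as [min(Woo, n)], at most [CB - e] for every
   [n]; then [n] tends to infinity under the truncation at [p]. *)
have le_u m : \int[mu]_x u m x <= CB - e.
  have cv : \int[mu]_x Num.min (Pt m%:R (fun x => Num.min (Woo x) n%:R) x) p%:R @[n --> \oo]
      --> \int[mu]_x u m x.
    apply: (@cvg_expect _ (borelE E) R mu _ _ p%:R).
    - by move=> n; exact: (min_borel p (bPm m n).1 (Pm_ge0 m n)).1.
    - by move=> n x; rewrite ger0_norm ?ge_min ?lexx ?orbT// le_min Pm_ge0 ler0n.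
    - move=> x; apply: (@continuous_cvg _ _ _ _ _ _ (fun r : R => Num.min r p%:R)).
        by move=> A; apply: (@continuous_min _ _ id (cst (p%:R : R)) _ _ _) => //; exact: cvg_cst.
      exact: cvg_min_Woo.
  rewrite -(cvg_lim (@Rhausdorff _) cv); apply: limr_le.
    by apply/cvg_ex; eexists; exact: cv.
  apply: nearW => n; apply: le_trans (le_n n).
  rewrite -(invariance SM ER (ler0n R m) (min_borel n Woo_measurable Woo_ge0)).
  apply: le_expect; [exact: (min_borel p (bPm m n).1 (Pm_ge0 m n))|exact: (bPm m n)|].
  by move=> x; rewrite ge_min lexx.
have cu : \int[mu]_x u m x @[m --> \oo] --> CB.
  rewrite -[X in _ --> X](expect_cst mu).
  apply: (@cvg_expect _ (borelE E) R mu _ _ p%:R).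
  - move=> m; apply: (min_borel p _ (um_ge0 m)).1; apply: measurable_funB => //.
    exact: (Cb_borel (corrector_Cb m)).1.
  - by move=> m x; rewrite ger0_norm ?ge_min ?lexx ?orbT// le_min um_ge0 ler0n.
  - move=> x; rewrite -[X in _ --> X](min_l CBp).
    apply: (@continuous_cvg _ _ _ _ _ _ (fun r : R => Num.min r p%:R)).
      by move=> A; apply: (@continuous_min _ _ id (cst (p%:R : R)) _ _ _) => //; exact: cvg_cst.
    rewrite [X in _ --> X](_ : CB = Woo x - Qoo x); last first.
      by rewrite /Woo addrAC subrr add0r.
    by apply: cvgB; [exact: cvg_cst|exact: corrector_cvg].
have : CB <= CB - e.
  rewrite -{1}(cvg_lim (@Rhausdorff _) cu); apply: limr_le.
    by apply/cvg_ex; eexists; exact: cu.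
  by apply: nearW.
by rewrite lerBrDr gerDl leNgt e0.
Qed.

(** For large [T] one has [P_T W_N <= CB + e/4], as only a tail of the corrector remains, whereas
    [P_T min(W_N, n) >= mu (min(W_N, n)) - e/4] by total variation. This mean is within [e/4] of
    that for [Woo], which exceeds [CB - e/4] by [mean_min_limit]. *)
Lemma corrector_uniformly_integrable (L : set E) (e : R) : compact L -> 0 < e ->
  exists (n : nat) N0 T0, forall x T N, L x -> (T0 <= T)%N -> (N0 <= N)%N ->
    Pt T%:R (W N) x - Pt T%:R (fun y => Num.min (W N y) n%:R) x <= e.
Proof.
move=> cL e0; have e4 : 0 < e / 4 by rewrite divr_gt0.
have [n nP] := mean_min_limit e4.
have cm : \int[mu]_x Num.min (W N x) n%:R @[N --> \oo] --> \int[mu]_x Num.min (Woo x) n%:R.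
  apply: (@cvg_expect _ (borelE E) R mu _ _ n%:R).
  - by move=> N; exact: (min_borel n (Cb_borel (W_Cb N)).1 (W_ge0 N)).1.
  - by move=> N x; rewrite ger0_norm ?ge_min ?lexx ?orbT// le_min W_ge0 ler0n.
  - move=> x; apply: (@continuous_cvg _ _ _ _ _ _ (fun r : R => Num.min r n%:R)).
      by move=> A; apply: (@continuous_min _ _ id (cst (n%:R : R)) _ _ _) => //; exact: cvg_cst.
    exact: W_cvg.
have /cvgrPdist_lt/(_ _ e4)[N0 _ N0P] := cm.
have [KL KLP] := K_compact cL.
pose KM := `|KL| + 1.
have KM0 : 0 < KM by rewrite ltr_pwDr.
have KLM x : L x -> K x <= KM.
  by move=> Lx; rewrite (le_trans (KLP x Lx))// (le_trans (ler_norm _))// lerDl.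
(* Chosen so that [2 M KM r1] and [2 (n+1) KM r2] both equal [e / 4]; [n.+1] stands in for [n]
   because [tv_bounded] wants a positive bound. *)
have r1 : 0 < e / 4 / (2 * M * KM) by rewrite divr_gt0// mulr_gt0// mulr_gt0.
have r2 : 0 < e / 4 / (2 * n.+1%:R * KM) by rewrite divr_gt0// mulr_gt0// mulr_gt0.
have [T1 T1P] := unit_mass_tail h_ge0 h_int r1.
have [T2 T2P] := unit_mass_tail h_ge0 h_int r2.
(* The successor appears because time [k + 1] is controlled by the mass of the unit interval
   starting at [k]. *)
exists n, N0, (maxn T1 T2).+1 => x [//|T] N Lx; rewrite ltnS geq_max => /andP[T1T T2T] N0N.
have hW : Pt T.+1%:R (W N) x <= CB + e / 4.
  rewrite (sgrpRD SM)// ?sgrpR_cst ?corrector_shift; [|exact: Cb_borel (corrector_Cb N)|exact: Cb_borel (Cb_cst _)].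
  rewrite addrC lerD2l /Q /corrector (big_cat_nat (n := T.+1)) ?leq_addr//= addrAC subrr add0r.
  rewrite big_add1 /= (@le_trans _ _ (\sum_(T <= k < T + N) 2 * M * (K x * c k)))//.
    by apply: ler_sum => k _; rewrite (le_trans (ler_norm _))//; exact: decay.
  rewrite -mulr_sumr -mulr_sumr (@le_trans _ _ (2 * M * (KM * (e / 4 / (2 * M * KM)))))//.
    rewrite ler_wpM2l ?mulr_ge0 ?(ltW M_gt0)// ler_pM ?(ltW (K_gt0 x)) ?KLM//.
      by apply: sumr_ge0 => k _; exact: unit_mass_ge0.
    by apply: T1P => //; rewrite leq_addr.
  by rewrite mulrA mulrC divfK// lt0r_neq0// mulr_gt0// mulr_gt0.
have hm : \int[mu]_y Num.min (W N y) n%:R - e / 4 <= Pt T.+1%:R (fun y => Num.min (W N y) n%:R) x.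
  have := tv_bounded SM (ler0n R T.+1) (tv_unit_mass SM ER h_int D1 T x)
    (min_borel n (Cb_borel (W_Cb N)).1 (W_ge0 N)).1 (ltr0Sn R n) _.
  have nb y : `|Num.min (W N y) n%:R| <= n.+1%:R.
    by rewrite ger0_norm ?le_min ?W_ge0 ?ler0n// ge_min ler_nat leqnSn orbT.
  move=> /(_ nb); rewrite ler_norml => /andP[+ _].
  have : 2 * n.+1%:R * (K x * c T) <= e / 4.
    rewrite (@le_trans _ _ (2 * n.+1%:R * (KM * (e / 4 / (2 * n.+1%:R * KM)))))//.
      rewrite ler_wpM2l// ler_pM ?(ltW (K_gt0 x)) ?KLM ?unit_mass_ge0//.
      by have := T2P T T.+1 T2T (leqnSn T); rewrite big_nat1.
    by rewrite mulrA mulrC divfK// lt0r_neq0// mulr_gt0.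
  move: (_ * (K x * c T)) (Pt _ _ _) (\int[mu]_y _) => a b q; lra.
have hN := N0P N N0N; move: hN; rewrite /= ltr_norml => /andP[hN1 hN2].
move: nP hW hm hN1 hN2; move: (\int[mu]_x _) (\int[mu]_x _) (Pt _ _ _) (Pt _ _ _) => a b q r.
lra.
Qed.

End LowerBound.
End Corrector.

(** * Truncation of the horizon *)

Section HorizonTruncation.
Context {R : realType} {E : pseudoPMetricType R} {d : measure_display}
  {Omega : measurableType d}.
Variables (P : E -> probability Omega R) (X : R -> Omega -> E)
  (F : R -> set (set Omega)) (mu : probability (borelE E) R).
Hypothesis PS : @paper_space R E.
Hypothesis SM : standard_markov P X F.
Hypothesis WF : weak_feller P X.
Hypothesis ER : ergodic_to P X mu.
Implicit Types (s t : R) (x : E).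
Notation Pt t phi := (sgrpR P X t phi).
Notation pathint := (path_integral X).
Notation pot := (potential P X).
Notation leb := (@lebesgue_measure R).
Variables f g : E -> R.
Hypotheses (Cf : Cb f) (Cg : Cb g).
Notation J := (reward P X f g).

(** Invariance gives every term of the Riemann sums the mean of [phi]. *)
Lemma mean_potential phi t : 0 <= t -> Cb phi ->
  \int[mu]_x pot phi t x = t * \int[mu]_x phi x.
Proof.
move=> t0 Cphi; have [_ [M bM]] := Cphi.
have i0 n (i : nat) : 0 <= i.+1%:R * (t / n.+1%:R) by rewrite mulr_ge0// divr_ge0.
have bP n i : borel_bounded (Pt (i.+1%:R * (t / n.+1%:R)) phi).
  by apply: (sgrpR_borel SM) => //; exact: Cb_borel.
have bS n : borel_bounded (fun x => \sum_(i < n.+1) Pt (i.+1%:R * (t / n.+1%:R)) phi x).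
  by apply: (@bmeas_sum _ (borelE E)) => i; exact: bP.
have c1 : \int[mu]_x ((t / n.+1%:R) * (\sum_(i < n.+1) Pt (i.+1%:R * (t / n.+1%:R)) phi x))
    @[n --> \oo] --> \int[mu]_x pot phi t x.
  apply: (@cvg_expect _ (borelE E) R mu _ _ (t * M)).
  - by move=> n; apply: measurable_funM => //; exact: (bS n).1.
  - move=> n x; rewrite normrM ger0_norm ?divr_ge0// -mulrA ler_wpM2l// ler_pdivrMl ?ltr0n//.
    rewrite (le_trans (ler_norm_sum _ _ _))// (@le_trans _ _ (\sum_(i < n.+1) M))//.
      by apply: ler_sum => i _; apply: (sgrpR_bound SM) => //; exact: Cb_borel.
    by rewrite sumr_const card_ord mulr_natl.
  - by move=> x; exact: (riemann_potential SM).
rewrite -(cvg_lim (@Rhausdorff R) c1); apply/cvg_lim; first exact: Rhausdorff.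
apply: cvg_near_cst; apply: nearW => n.
rewrite (@expectZ _ (borelE E) R mu _ _ (bS n)) (@expect_sum _ (borelE E)); last by move=> i; exact: bP.
rewrite (eq_bigr (fun=> \int[mu]_x phi x)).
  by rewrite sumr_const card_ord -[X in _ * X]mulr_natl mulrA divfK// pnatr_eq0.
by move=> i _; rewrite (invariance SM ER)//; exact: Cb_borel.
Qed.

Lemma expect_grid_path kappa N x : grid_time F 1 kappa -> (forall w, (kappa w <= N)%N) ->
  \int[P x]_w pathint f 0 (kappa w)%:R w =
  \sum_(0 <= j < N) \int[P x]_w (\1_[set w | (j < kappa w)%N] w * pot f 1 (X j%:R w)).
Proof.
move=> gk kN; have := dynkin_grid PS SM WF ltr01 x Cf (fun=> Cb_cst 0) gk kN.
rewrite add0r big_mkord.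
under eq_Rintegral do rewrite mulr1 addr0.
move=> ->; apply: eq_bigr => j _; apply: eq_Rintegral => w _.
by rewrite mulr1 sgrpR_cst addr0 subr0.
Qed.

Section Gap.
Variables (phi : E -> R) (c0 CB : R).
Hypothesis Cphi : Cb phi.
Hypothesis pot_le : forall y, pot f 1 y <= phi y - c0.
Notation Q := (corrector P X phi).
Let W N x := Q N x + CB.
Hypothesis W_ge0 : forall N x, 0 <= W N x.
Variables (kappa : Omega -> nat) (N : nat) (x : E).
Hypothesis kappa_grid : grid_time F 1 kappa.
Hypothesis kappa_le : forall w, (kappa w <= N)%N.
Let I j (w : Omega) : R := \1_[set w | (j < kappa w)%N] w.

Definition survival j : R := \int[P x]_w \1_[set w | (j < kappa w)%N] w.

(** The potential still available at time [j]: by [one_step] it drops at each step by at least the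
    running reward collected plus [c0] times the survival probability. The index [N - j] follows the
    recursion of the corrector, which uses up one summand per step. *)
Definition residual j : R :=
  \int[P x]_w (\1_[set w | (j < kappa w)%N] w * (Q (N - j)%N (X j%:R w) + CB)).

Notation prob := survival.
Notation rest := residual.

Let probE j : prob j = \int[P x]_w I j w. Proof. by []. Qed.

Let restE j : rest j = \int[P x]_w (I j w * W (N - j)%N (X j%:R w)). Proof. by []. Qed.

Let W_Cb n : Cb (W n).
Proof. by apply: CbD; [exact: (corrector_Cb PS SM WF)|exact: Cb_cst]. Qed.

Let I_bmeas j : bmeas (I j).
Proof. by apply: bmeas_indic; exact: (grid_time_gt_measurable SM ltr01 _ kappa_grid). Qed.

Let I_ge0 j w : 0 <= I j w. Proof. by rewrite /I indicE. Qed.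

Let I_mono j w : I j.+1 w <= I j w.
Proof.
rewrite /I !indicE ler_nat; case: (boolP (w \in [set w | (j.+1 < kappa w)%N])) => //.
by rewrite inE /= => /ltnW jk; rewrite mem_set.
Qed.

Let comp_bmeas psi j : Cb psi -> bmeas (fun w => psi (X j%:R w)).
Proof. by move=> Cpsi; apply: (bmeas_comp SM) => //; exact: Cb_borel. Qed.

Let prob_mono j : prob j.+1 <= prob j.
Proof. exact: (le_expect (P x) (I_bmeas j.+1) (I_bmeas j) (I_mono j)). Qed.

Let rest_ge0 j : 0 <= rest j.
Proof.
apply: expect_ge => [|w]; last exact: mulr_ge0 (I_ge0 j w) (W_ge0 _ _).
exact: (bmeasM (I_bmeas j) (comp_bmeas j (W_Cb _))).
Qed.

(** The recursion [W (n+1) = phi + P_1 (W n)] pays for one step. Since [W >= 0], shrinking the event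
    from [j < kappa] to [j + 1 < kappa] can only lower the residual; this is what the shift by [CB]
    is for. *)
Let one_step j : (j < N)%N ->
  \int[P x]_w (I j w * pot f 1 (X j%:R w)) <= rest j - rest j.+1 - c0 * prob j.
Proof.
move=> jN; have eN : (N - j = (N - j.+1).+1)%N by rewrite subnSK.
have Cpot : Cb (pot f 1) by exact: (potential_Cb PS SM WF ler01).
have CPW n : Cb (Pt 1 (W n)) by exact: (sgrpR_Cb PS SM WF ler01).
have WS n y : W n.+1 y = phi y + Pt 1 (W n) y.
  rewrite /W (corrector_succ PS SM)// (sgrpRD SM)// ?sgrpR_cst ?addrA//.
    by apply: Cb_borel; exact: (corrector_Cb PS SM WF).
  exact: Cb_borel (Cb_cst _).
have bIW n : bmeas (fun w => I j w * W n (X j%:R w)).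
  by apply: bmeasM => //; exact: comp_bmeas.
have bIPW n : bmeas (fun w => I j w * Pt 1 (W n) (X j%:R w)).
  by apply: bmeasM => //; exact: comp_bmeas.
have bcI : bmeas (fun w => c0 * I j w) by apply: bmeasM => //; exact: bmeas_cst.
have le1 : \int[P x]_w (I j w * pot f 1 (X j%:R w)) <=
    rest j - \int[P x]_w (I j w * Pt 1 (W (N - j.+1)%N) (X j%:R w)) - c0 * prob j.
  rewrite restE probE -expectZ// -!expectB//; last exact: bmeasB.
  apply: le_expect; first by apply: bmeasM => //; exact: comp_bmeas.
    by apply: bmeasB => //; exact: bmeasB.
  move=> w; rewrite eN WS [c0 * _]mulrC -!mulrBr ler_wpM2l//.
  by rewrite addrK.
apply: le_trans le1 _; rewrite lerD2r lerD2l lerN2.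
have FI : F j%:R [set w | (j < kappa w)%N].
  by have := grid_time_gt SM ltr01 j kappa_grid; rewrite mulr1.
rewrite -(markov SM x (ler0n R j) ler01 FI (Cb_borel (W_Cb _))) restE.
have -> : j%:R + 1 = j.+1%:R :> R by rewrite -natr1.
apply: le_expect.
- exact: bmeasM (I_bmeas j.+1) (comp_bmeas j.+1 (W_Cb _)).
- exact: bmeasM (I_bmeas j) (comp_bmeas j.+1 (W_Cb _)).
- by move=> w; rewrite ler_wpM2r.
Qed.

Lemma gap_path T : (T <= N)%N ->
  \sum_(T <= j < N) \int[P x]_w (I j w * pot f 1 (X j%:R w)) <=
  rest T - c0 * \sum_(T <= j < N) prob j.
Proof.
move=> TN; rewrite mulr_sumr.
apply: (@le_trans _ _ (\sum_(T <= j < N) (rest j - rest j.+1 - c0 * prob j))).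
  by rewrite ler_sum_nat// => j /andP[_ jN]; exact: one_step.
rewrite sumrB lerD2r (eq_bigr (fun j => - (rest j.+1 - rest j))); last first.
  by move=> j _; rewrite opprB.
by rewrite sumrN telescope_sumr// opprB gerBl.
Qed.

Variables (sigma : Omega -> R) (Mf Mg : R).
Hypothesis sigma_rst : rst F sigma.
Hypothesis kappaE : forall w, kappa w = ceil_grid 1 (sigma w).
Hypothesis Mf_bound : forall y, `|f y| <= Mf.
Hypothesis Mg_bound : forall y, `|g y| <= Mg.

(** On [T < kappa], rounding [sigma] up to the grid costs at most [Mf], as less than one unit of
    time is added, and exchanging the terminal rewards costs at most [2 Mg]. Elsewhere the two
    rewards agree. The inequality is applied both at [T = 0] and at a large [T]. *)
Lemma reward_gap T : (T <= N)%N ->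
  J x sigma - J x (fun w => Num.min (sigma w) T%:R) <=
  (Mf + 2 * Mg) * prob T + rest T - c0 * \sum_(T <= j < N) prob j.
Proof.
move=> TN; have [s0 _] := sigma_rst.
have Mf0 : 0 <= Mf by exact: le_trans (Mf_bound point).
have sk w : sigma w <= (kappa w)%:R by rewrite kappaE -[leRHS]mulr1 le_ceil_grid.
have ks w : (kappa w)%:R < sigma w + 1.
  by rewrite kappaE -[ltLHS]mulr1 ceil_grid_lt.
have sN w : sigma w <= N%:R by rewrite (le_trans (sk w))// ler_nat.
have rT := rst_min SM (ler0n R T) sigma_rst.
have mT w : Num.min (sigma w) T%:R <= T%:R by rewrite ge_min lexx orbT.
have gkT := grid_time_min SM ltr01 T kappa_grid.
have kT w : (minn (kappa w) T <= T)%N by rewrite geq_minr.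
have bk (k : Omega -> nat) : grid_time F 1 k -> forall n, (forall w, (k w <= n)%N) ->
    bmeas (fun w => pathint f 0 (k w)%:R w).
  move=> gk n kn; have := grid_time_rst SM ltr01 gk => rk.
  have kb w : (k w)%:R * 1 <= n%:R :> R by rewrite mulr1 ler_nat.
  have := path_integral0_bmeas SM rk kb Cf.
  by congr bmeas; apply/funext => w; rewrite mulr1.
have b1 := bk _ kappa_grid N kappa_le.
have b2 := bk _ gkT T kT.
have bIc : bmeas (fun w => (Mf + 2 * Mg) * I T w) by apply: bmeasM => //; exact: bmeas_cst.
have le1 : J x sigma - J x (fun w => Num.min (sigma w) T%:R) <=
    \int[P x]_w ((Mf + 2 * Mg) * I T w + (pathint f 0 (kappa w)%:R w -
      pathint f 0 (minn (kappa w) T)%:R w)).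
  have br1 := reward_bmeas SM Cf Cg sigma_rst sN.
  have br2 := reward_bmeas SM Cf Cg rT mT.
  rewrite /reward -expectB//; apply: le_expect; first exact: bmeasB.
    by apply: bmeasD => //; exact: bmeasB.
  move=> w; have [sT|Ts] := leP (sigma w) T%:R.
    have kTw : (kappa w <= T)%N by rewrite kappaE ceil_grid_le// mulr1.
    rewrite (minn_idPl kTw) !subrr addr0 mulr_ge0//.
    by rewrite addr_ge0// mulr_ge0// (le_trans _ (Mg_bound point)).
  have Tk : (T < kappa w)%N by rewrite ltnNge kappaE ceil_grid_le// mulr1 -ltNge.
  rewrite (minn_idPr (ltnW Tk)) /I indicE mem_set//= mulr1.
  have := path_integral_lipschitz SM w Cf Mf_bound (s0 w) (sk w).
  have : Mf * ((kappa w)%:R - sigma w) <= Mf.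
    by rewrite -[leRHS]mulr1 ler_wpM2l// lerBlDl ltW.
  have := Mg_bound (X (sigma w) w); have := Mg_bound (X T%:R w).
  move: (pathint f 0 _ w) (pathint f 0 _ w) (pathint f 0 _ w) (g _) (g _) => A B C D D'.
  by rewrite !ler_norml => /andP[? ?] /andP[? ?] ? /andP[? ?]; lra.
apply: le_trans le1 _; rewrite expectD//; last exact: bmeasB.
rewrite expectZ// expectB// -addrA lerD2l.
rewrite (expect_grid_path x kappa_grid kappa_le) (expect_grid_path x gkT kT).
rewrite (big_cat_nat (n := T))//= addrAC.
rewrite [X in _ - X](eq_big_nat _ _ (F2 := fun j =>
   \int[P x]_w (\1_[set w | (j < kappa w)%N] w * pot f 1 (X j%:R w)))).
  by rewrite subrr add0r; exact: gap_path.
move=> j /andP[_ jT]; apply: eq_Rintegral => w _; congr (_ * _).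
rewrite !indicE; congr (nat_of_bool _)%:R; apply/idP/idP; rewrite !inE /= leq_min.
  by case/andP.
by move=> ->.
Qed.

Lemma prob_sum_ge T : T%:R * prob T <= \sum_(0 <= j < T) prob j.
Proof.
elim: T => [|T IH]; first by rewrite mul0r big_geq.
rewrite big_nat_recr//= -natr1 mulrDl mul1r lerD// (le_trans _ IH)//.
by rewrite ler_wpM2l.
Qed.

(** [W] is split into [min(W, n)], at most [n] on the event of survival, and the excess above [n],
    for which the event is dropped. *)
Lemma rest_le T n (e : R) : (T <= N)%N ->
  Pt T%:R (W (N - T)%N) x - Pt T%:R (fun y => Num.min (W (N - T)%N y) n%:R) x <= e ->
  rest T <= n%:R * prob T + e.
Proof.
move=> TN he.
have Cmin : Cb (fun y => Num.min (W (N - T)%N y) n%:R) by apply: Cb_min => //; exact: Cb_cst.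
have b1 : bmeas (fun w => I T w * W (N - T)%N (X T%:R w)).
  by apply: bmeasM => //; exact: comp_bmeas.
have b2 : bmeas (fun w => W (N - T)%N (X T%:R w) - Num.min (W (N - T)%N (X T%:R w)) n%:R).
  by apply: bmeasB; [exact: comp_bmeas|exact: (comp_bmeas T Cmin)].
have b3 : bmeas (fun w => n%:R * I T w) by apply: bmeasM => //; exact: bmeas_cst.
rewrite restE probE (le_trans _ (lerD (lexx _) he))// -expectZ// !sgrpRE -expectB; last 2 first.
- exact: comp_bmeas.
- exact: (comp_bmeas T Cmin).
rewrite -expectD//; apply: le_expect => //; first exact: bmeasD.
move=> w; rewrite /I indicE; case: (_ \in _); rewrite ?mul1r ?mul0r ?mulr1 ?mulr0 ?add0r.
  have : Num.min (W (N - T)%N (X T%:R w)) n%:R <= n%:R by rewrite ge_min lexx orbT.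
  by set a := Num.min _ _; set b := W _ _; move: a b => a b; lra.
by rewrite subr_ge0 ge_min lexx.
Qed.

End Gap.
End HorizonTruncation.

(** * Approximation of the value and its continuity *)

Section Continuity.
Context {R : realType} {E : pseudoPMetricType R} {d : measure_display}
  {Omega : measurableType d}.
Variables (P : E -> probability Omega R) (X : R -> Omega -> E)
  (F : R -> set (set Omega)) (mu : probability (borelE E) R).
Hypothesis PS : @paper_space R E.
Hypothesis SM : standard_markov P X F.
Hypothesis WF : weak_feller P X.
Hypothesis ER : ergodic_to P X mu.
Implicit Types (s t : R) (x : E).
Notation Pt t phi := (sgrpR P X t phi).
Notation pathint := (path_integral X).
Notation pot := (potential P X).
Notation leb := (@lebesgue_measure R).
Variables f g : E -> R.
Hypotheses (Cf : Cb f) (Cg : Cb g).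
Hypothesis f_mean_lt0 : \int[mu]_x f x < 0.
Variables (K : E -> R) (h : R -> R).
Hypothesis K_gt0 : forall x, 0 < K x.
Hypothesis K_compact : forall C : set E, compact C -> exists M : R, forall x, C x -> K x <= M.
Hypothesis h_ge0 : forall t, 0 <= t -> 0 <= h t.
Hypothesis h_int : leb.-integrable `[0, +oo[ (EFin \o h).
Hypothesis D1 : forall x t, 0 <= t -> (tv P X mu t x < (K x * h t)%:E)%E.
Hypothesis D2 : forall x (T : R), 0 <= T -> (\int[P x]_w (K (X T w))%:E < +oo)%E.
Notation J := (reward P X f g).

(* Outside a large compact set the unit-time reward is raised to at least |f|, keeping its mean
   negative: the centred majorant phi is then nonnegative off that compact set. *)
Lemma drift_majorant : exists (phi : E -> R) (c0 M : R) (B : set E),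
  [/\ Cb phi, 0 < c0, forall y, pot f 1 y <= phi y - c0, 0 < M &
      [/\ forall y, `|phi y| <= M, \int[mu]_y phi y = 0, compact B & forall y, ~ B y -> 0 <= phi y]].
Proof.
have [C [eta [cC ceta eta01 eta0 [_ eta1]]]] := exists_cutoffs PS.
have [_ [Mf bMf]] := Cf; have Mf0 : 0 <= Mf by exact: le_trans (bMf point).
have Ceta k : Cb (eta k).
  by split => //; exists 1 => y; have /andP[? ?] := eta01 k y; rewrite ger0_norm.
have Cpot : Cb (pot f 1) by exact: (potential_Cb PS SM WF ler01).
have potM y : `|pot f 1 y| <= Mf.
  by rewrite -[leRHS]mulr1; exact: (potential_bound SM).
have Cb1 k : Cb (fun y => 1 - eta k y) by apply: CbB => //; exact: Cb_cst.
pose b k y := pot f 1 y + 2 * Mf * (1 - eta k y).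
have Cbk k : Cb (b k) by apply: CbD => //; apply: CbM => //; exact: Cb_cst.
have mb k : \int[mu]_y b k y = \int[mu]_y f y + 2 * Mf * (1 - \int[mu]_y eta k y).
  rewrite (@expectD _ (borelE E) R mu); [|exact: Cb_borel|].
    rewrite (mean_potential SM ER ler01 Cf) mul1r (@expectZ _ (borelE E) R mu); last exact: Cb_borel.
    rewrite (@expectB _ (borelE E) R mu) ?expect_cst//; last exact: Cb_borel.
    exact: Cb_borel (Cb_cst _).
  by apply: Cb_borel; apply: CbM => //; exact: Cb_cst.
(* The added term has vanishing [mu]-mean as the cutoffs increase to 1, so the mean tends to
   [mu f < 0]; its negative becomes the drift [c0]. *)
have [k kP] : exists k, \int[mu]_y b k y < 0.
  have cv : \int[mu]_y b k y @[k --> \oo] --> \int[mu]_y f y + 2 * Mf * (1 - 1).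
    under eq_fun do rewrite mb.
    apply: cvgD; first exact: cvg_cst.
    apply: cvgMr; apply: cvgB; first exact: cvg_cst.
    rewrite -[X in _ --> X](expect_cst mu).
    apply: (@cvg_expect _ (borelE E) R mu _ _ 1) => //.
      by move=> n; exact: (Cb_borel (Ceta n)).1.
    by move=> n y; have /andP[? ?] := eta01 n y; rewrite ger0_norm.
  move: cv; rewrite subrr mulr0 addr0 => /cvgr_lt/(_ _ f_mean_lt0)[n _ nP].
  by exists n; exact: (nP n (leqnn n)).
pose c0 := - \int[mu]_y b k y; pose phi y := b k y + c0.
have Cphi : Cb phi by apply: CbD => //; exact: Cb_cst.
have [_ [M0 bM0]] := Cphi.
exists phi, c0, (`|M0| + 1), (C k); split => //; first by rewrite /c0 oppr_gt0.
- move=> y; rewrite /phi addrK /b lerDl mulr_ge0 ?mulr_ge0// subr_ge0.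
  by case/andP: (eta01 k y).
split => //.
- by move=> y; rewrite (le_trans (bM0 y))// (le_trans (ler_norm _))// lerDl.
- rewrite (@expectD _ (borelE E) R mu) ?expect_cst ?/c0 ?subrr//; first exact: Cb_borel.
  exact: Cb_borel (Cb_cst _).
- move=> y nC; rewrite /phi /b (eta0 _ _ nC) subr0 mulr1 addr_ge0//.
    have := potM y; rewrite ler_norml => /andP[+ _]; lra.
  by rewrite /c0 oppr_ge0 ltW.
Qed.

(** A stopping time no better than immediate stopping falls into the first alternative. Otherwise
    [reward_gap] at time 0 bounds [c0] times the sum of the survival probabilities by [CL],
    uniformly on [L]; these decrease, so survival beyond [T] has probability at most [CL / (c0 T)],
    and [reward_gap] at [T] bounds the loss. *)
Lemma horizon_truncation (L : set E) (e : R) : compact L -> 0 < e ->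
  exists T : nat, forall x sigma (S : R), L x -> rst F sigma -> (forall w, sigma w <= S) ->
    J x sigma <= g x \/ J x sigma <= J x (fun w => Num.min (sigma w) T%:R) + e.
Proof.
move=> cL e0; have [_ [Mf bMf]] := Cf; have [_ [Mg bMg]] := Cg.
have Mf0 : 0 <= Mf by exact: le_trans (bMf point).
have Mg0 : 0 <= Mg by exact: le_trans (bMg point).
have [phi [c0 [M [B [Cphi c0_gt0 pot_le M_gt0 [phiM phi0 cB phi_off]]]]]] := drift_majorant.
have [CB CB0 Q_ge] := corrector_lower_bound PS SM WF ER K_gt0 K_compact h_ge0 h_int D1
  Cphi M_gt0 phiM phi0 cB phi_off.
have W_ge0 N x : 0 <= corrector P X phi N x + CB by have := Q_ge N x; lra.
have e2 : 0 < e / 2 by rewrite divr_gt0.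
have [n [N0 [T0 UI]]] := corrector_uniformly_integrable PS SM WF ER K_gt0 K_compact h_ge0 h_int
  D1 D2 Cphi M_gt0 phiM phi0 CB0 Q_ge cL e2.
have [KL KLP] := K_compact cL.
have H0 : 0 <= total_mass h by have := unit_mass_sum_le h_ge0 h_int 0; rewrite big_ord0.
pose A := Mf + 2 * Mg.
have A0 : 0 <= A by rewrite addr_ge0// mulr_ge0.
(* At time 0 the gap inequality costs [A] and the initial residual; the latter is bounded on [L]
   through [K <= KL]. *)
pose CL := A + (M + 2 * M * total_mass h * `|KL| + CB).
have CL0 : 0 <= CL.
  by rewrite addr_ge0// addr_ge0// addr_ge0 ?(ltW M_gt0)// !mulr_ge0 ?(ltW M_gt0).
(* Beyond this threshold [(A + n) CL / (c0 T) <= e / 2]; the other half of [e] goes to the excess of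
   the corrector above [n]. *)
pose D := (A + n%:R) * CL / (c0 * (e / 2)).
pose T := maxn T0 (Num.truncn D).+1.
have DT : D < T%:R.
  by rewrite (lt_le_trans (truncnS_gt _))// ler_nat leq_maxr.
exists T => x sigma S Lx rs sS.
have [|gJ] := leP (J x sigma) (g x); [by left|right].
pose kappa w := ceil_grid 1 (sigma w).
have [s0 _] := rs.
(* [N] has to exceed [S], so that [kappa <= N], and to leave [N - T >= N0], so that uniform
   integrability applies to the corrector of index [N - T]. *)
pose N := (T + N0 + (Num.truncn S).+1)%N.
have kN w : (kappa w <= N)%N.
  rewrite ceil_grid_le// mulr1 (le_trans (sS w))// (le_trans (ltW (truncnS_gt S)))//.
  by rewrite ler_nat leq_addl.
have gk : grid_time F 1 kappa by exact: grid_time_ceil.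
have TN : (T <= N)%N by rewrite /N -addnA leq_addr.
have gap := reward_gap PS SM WF Cf Cg Cphi pot_le W_ge0 x gk kN rs (fun=> erefl) bMf bMg.
have J0 : J x (fun w => Num.min (sigma w) 0%:R) = g x.
  rewrite -[RHS](sgrpR0 PS SM); last exact: Cb_borel.
  rewrite sgrpRE; apply: eq_Rintegral => w _; rewrite mulr0n min_r//.
  by rewrite /path_integral set_itv1 Rintegral_set1 add0r.
have surv_le j : survival P kappa x j <= 1.
  apply: expect_le => [|w]; last by rewrite indicE; case: (_ \in _).
  by apply: bmeas_indic; exact: (grid_time_gt_measurable SM ltr01 j gk).
have surv_ge j : 0 <= survival P kappa x j.
  apply: expect_ge => [|w]; last by rewrite indicE.
  by apply: bmeas_indic; exact: (grid_time_gt_measurable SM ltr01 j gk).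
have res0 : residual P X phi CB kappa N x 0 <= M + 2 * M * total_mass h * `|KL| + CB.
  have bI : bmeas (\1_[set w | (0 < kappa w)%N] : Omega -> R).
    by apply: bmeas_indic; exact: (grid_time_gt_measurable SM ltr01 0%N gk).
  have CW : Cb (fun y => corrector P X phi (N - 0)%N y + CB).
    by apply: CbD; [exact: (corrector_Cb PS SM WF)|exact: Cb_cst].
  have bW := bmeas_comp SM (lexx 0) (Cb_borel CW).
  rewrite (@le_trans _ _ (Pt 0 (fun y => corrector P X phi (N - 0)%N y + CB) x))//.
    apply: le_expect => //; first exact: bmeasM.
    by move=> w; rewrite ler_piMl// indicE; case: (_ \in _).
  rewrite (sgrpR0 PS SM); last exact: Cb_borel.
  rewrite lerD2r (le_trans (ler_norm _))//.
  rewrite (le_trans (corrector_bound SM ER K_gt0 h_ge0 h_int D1 Cphi M_gt0 phiM phi0 _ _))//.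
  rewrite lerD2l ler_wpM2l ?mulr_ge0 ?(ltW M_gt0)//.
  exact: le_trans (KLP x Lx) (ler_norm _).
have sum_le : c0 * (T%:R * survival P kappa x T) <= CL.
  have := gap 0%N (leq0n N); rewrite J0 => gap0.
  have le1 : c0 * (T%:R * survival P kappa x T) <= c0 * \sum_(0 <= j < N) survival P kappa x j.
    rewrite ler_wpM2l ?(ltW c0_gt0)// (le_trans (prob_sum_ge SM x gk T))//.
    by rewrite (big_cat_nat (n := T) (p := N))//= lerDl sumr_ge0.
  apply: le_trans le1 _.
  have : A * survival P kappa x 0 <= A by rewrite ler_piMr.
  move: gap0 res0 gJ; rewrite -/A /CL.
  move: (c0 * _) (survival _ _ _ _) (residual _ _ _ _ _ _ _ _) (J _ _) (_ + CB) => a p r j b.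
  by move=> ? ? ? ?; lra.
have surv_small : (A + n%:R) * survival P kappa x T <= e / 2.
  have T_gt0 : 0 < T%:R :> R by rewrite ltr0n (leq_trans _ (leq_maxr _ _)).
  have : survival P kappa x T <= CL / (c0 * T%:R).
    by rewrite ler_pdivlMr ?mulr_gt0// mulrC -mulrA.
  move=> /(ler_wpM2l (addr_ge0 A0 (ler0n R n)))/le_trans; apply.
  rewrite mulrA ler_pdivrMr ?mulr_gt0//.
  move: (ltW DT); rewrite /D ler_pdivrMr ?mulr_gt0// => hD.
  by rewrite (le_trans hD)// mulrC -mulrA mulrCA mulrA mulrC mulrA.
have rest := rest_le PS SM WF Cphi gk TN (UI x T (N - T)%N Lx _ _).
have {}rest : residual P X phi CB kappa N x T <= n%:R * survival P kappa x T + e / 2.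
  apply: rest; first exact: leq_maxl.
  by rewrite /N -addnA addKn leq_addr.
have sum_ge0 : 0 <= c0 * \sum_(T <= j < N) survival P kappa x j.
  by rewrite mulr_ge0 ?(ltW c0_gt0)// sumr_ge0.
have := gap T TN; rewrite -/A.
move: surv_small rest sum_ge0; rewrite mulrDl.
move: (A * survival P kappa x T) (n%:R * survival P kappa x T) (c0 * _) (residual _ _ _ _ _ _ _ _) (J _ _) (J _ _).
by move=> a b c' r j1 j2 ? ? ? ?; lra.
Qed.

Lemma reward_grid_approximation (L : set E) (T : nat) (e : R) : compact L -> 0 < e ->
  exists m, forall x sigma, L x -> rst F sigma -> (forall w, sigma w <= T%:R) ->
    J x sigma <= grid_value P X f g m.+1%:R^-1 (T * m.+1) x + e.
Proof.
move=> cL e0; have [_ [Mf bMf]] := Cf.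
have Mf0 : 0 <= Mf by exact: le_trans (bMf point).
have e2 : 0 < e / 2 by rewrite divr_gt0.
(* The lower bound on [m] makes the mesh so fine that rounding up also changes the running reward by
   at most [e / 2]. *)
have [m mP hm] := uniform_grid_approximation PS SM WF Cg T (Num.truncn (Mf / (e / 2))).+1 cL e2.
have dl0 : 0 < m.+1%:R^-1 :> R by rewrite invr_gt0.
have dle : Mf * m.+1%:R^-1 <= e / 2.
  rewrite ler_pdivrMr// mulrC -ler_pdivrMr// (le_trans (ltW (truncnS_gt _)))//.
  by rewrite ler_nat (leq_trans mP).
exists m => x sigma Lx rs sT; have [s0 _] := rs.
pose kappa w := ceil_grid m.+1%:R^-1 (sigma w).
have gk : grid_time F m.+1%:R^-1 kappa by exact: grid_time_ceil.
have Tm : T%:R = (T * m.+1)%:R * m.+1%:R^-1 :> R by rewrite natrM mulfK.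
have kN w : (kappa w <= T * m.+1)%N by rewrite ceil_grid_le// -Tm.
have rk := grid_time_rst SM dl0 gk.
have kT w : (kappa w)%:R * m.+1%:R^-1 <= T%:R :> R by rewrite Tm ler_wpM2r ?(ltW dl0)// ler_nat.
have := reward_le_grid_value PS SM WF Cf Cg dl0 x gk kN.
suff : J x sigma <= J x (fun w => (kappa w)%:R * m.+1%:R^-1) + e by lra.
have b1 := path_integral0_bmeas SM rs sT Cf.
have b2 := path_integral0_bmeas SM rk kT Cf.
have bg1 := stopped_bmeas SM rs Cg.
have bg2 := stopped_bmeas SM rk Cg.
rewrite /reward !expectD//.
have := hm x sigma Lx rs sT; rewrite ler_norml => /andP[_ le_g].
have le_f : \int[P x]_w pathint f 0 (sigma w) w <=
    \int[P x]_w pathint f 0 ((kappa w)%:R * m.+1%:R^-1) w + e / 2.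
  rewrite -lerBlDl -expectB//; apply: expect_le => [|w]; first exact: bmeasB.
  have sk := le_ceil_grid dl0 (s0 w).
  have := path_integral_lipschitz SM w Cf bMf (s0 w) sk.
  rewrite distrC => /ler_normlW/le_trans; apply; apply: le_trans dle.
  by rewrite ler_wpM2l// lerBlDl ltW// ceil_grid_lt.
move: le_g le_f; rewrite -/(kappa _).
set a := Rintegral _ _ _; set b := Rintegral _ _ _.
set a' := Rintegral _ _ _; set b' := Rintegral _ _ _; move: a b a' b' => a b a' b' ? ?; lra.
Qed.

(** One grid value serves all of [L]. It lies below the value because a bounded stopping time
    attains it; the upper estimate splits [e] between truncation and discretization, and the
    alternative [J <= g] is absorbed since [g] lies below every grid value. *)
Lemma value_approximation (L : set E) (e : R) : compact L -> 0 < e ->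
  exists2 v : E -> R, Cb v & forall x, L x ->
    ((v x)%:E <= value_fun P X F f g x)%E /\ (value_fun P X F f g x <= (v x + e)%:E)%E.
Proof.
move=> cL e0; have e2 : 0 < e / 2 by rewrite divr_gt0.
have [T TP] := horizon_truncation cL e2.
have [m mP] := reward_grid_approximation T cL e2.
have dl0 : 0 < m.+1%:R^-1 :> R by rewrite invr_gt0.
exists (grid_value P X f g m.+1%:R^-1 (T * m.+1)); first exact: (grid_value_Cb PS SM WF).
move=> x Lx; split.
  have [kappa gk [kN <-]] := grid_value_attained PS SM WF Cf Cg (T * m.+1) x dl0.
  apply: (reward_le_value SM Cf Cg x (grid_time_rst SM dl0 gk) (T := (T * m.+1)%:R * m.+1%:R^-1)).
  by move=> w; rewrite ler_wpM2r ?(ltW dl0)// ler_nat.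
apply: (value_le SM Cf Cg) => sigma S rs sS.
have [Jg|JT] := TP x sigma S Lx rs sS.
  apply: le_trans Jg _; have := le_grid_value P X f g m.+1%:R^-1 (T * m.+1) x.
  by move: (grid_value _ _ _ _ _ _ _) (g x) => a b; lra.
have rT := rst_min SM (ler0n R T) rs.
have mT w : Num.min (sigma w) T%:R <= T%:R by rewrite ge_min lexx orbT.
by have := mP x _ Lx rT mT; move: JT; lra.
Qed.

(** Closed unit balls are compact neighbourhoods of their centres, so the value is locally a uniform
    limit of continuous functions; the same squeeze shows that it is finite. *)
Lemma value_continuous : continuous (value_fun P X F f g).
Proof.
have [_ _ _ cball] := PS.
have Bx (y : E) : metric_closed_ball y (1 : R) y by move=> r r1; apply: ballxx; exact: lt_trans r1.
have [w wE] : exists w : E -> R, forall x, value_fun P X F f g x = (w x)%:E.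
  exists (fun x => fine (value_fun P X F f g x)) => x.
  have [v _ /(_ x (Bx x))[vle lev]] := value_approximation (cball x 1) ltr01.
  rewrite fineK// fin_numElt.
  by rewrite (lt_le_trans (ltNyr _) vle) (le_lt_trans lev (ltry _)).
have w_near x (e : R) : 0 < e -> \forall y \near x, `|w x - w y| < e.
  move=> e0; have e4 : 0 < e / 4 by rewrite divr_gt0.
  have [v [cv _] vP] := value_approximation (cball x 1) e4.
  have vw y : metric_closed_ball x 1 y -> v y <= w y <= v y + e / 4.
    by move=> /vP; rewrite wE !lee_fin => -[-> ->].
  have /cvgrPdist_lt/(_ _ e4) near_v := cv x.
  near=> y.
  have By : metric_closed_ball x 1 y.
    move=> r r1; apply: (le_ball (ltW r1)); near: y; exact: nbhsx_ballx.
  have dv : `|v x - v y| < e / 4 by near: y; exact: near_v.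
  move: (vw _ (Bx x)) (vw _ By) dv; rewrite !ltr_norml.
  by move=> /andP[? ?] /andP[? ?] /andP[? ?]; apply/andP; split; lra.
rewrite (_ : value_fun P X F f g = EFin \o w); last by apply/funext => y; rewrite wE.
move=> x; apply: cvg_EFin; first exact: nearW.
by apply/cvgrPdist_lt => e e0; exact: w_near.
Unshelve. all: by end_near. Qed.

End Continuity.

Unset Implicit Arguments.
Set Strict Implicit.

Theorem theorem2p29 (R : realType) (E : pseudoPMetricType R) (d : measure_display)
  (Omega : measurableType d) (P : E -> probability Omega R) (X : R -> Omega -> E)
  (F : R -> set (set Omega)) (mu : probability (borelE E) R) (f g : E -> R)
  (K : E -> R) (h : R -> R) :
  @paper_space R E ->
  standard_markov P X F ->
  weak_feller P X ->
  ergodic_to P X mu ->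
  continuous f -> bdd_fun f ->
  continuous g -> bdd_fun g ->
  (\int[mu]_x (f x)%:E < 0)%E ->
  (* (D1) *)
  (forall x, 0 < K x) ->
  (forall C : set E, compact C -> exists M : R, forall x, C x -> K x <= M) ->
  (forall t, 0 <= t -> 0 <= h t) ->
  (@lebesgue_measure R).-integrable `[0, +oo[ (EFin \o h) ->
  (forall x t, 0 <= t -> (tv P X mu t x < (K x * h t)%:E)%E) ->
  (* (D2) *)
  (forall x T, 0 <= T -> (\int[P x]_w (K (X T w))%:E < +oo)%E) ->
  (* (a) or (b) *)
  (strong_feller P X \/
   (forall L : set E, compact L -> exists alpha : R, 0 < alpha /\
      exists M : R, forall x T, L x -> 0 <= T ->
        (\int[P x]_w ((K (X T w)) `^ (1 + alpha))%:E <= M%:E)%E)) ->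
  continuous (value_fun P X F f g).
Proof.
move=> PS SM WF ER cf bf cg bg mean_lt0 K_gt0 K_compact h_ge0 h_int D1 D2 _.
have mf : @bmeas _ (borelE E) R f := Cb_borel (conj cf bf).
have mean : \int[mu]_x f x < 0 by rewrite -lte_fin -(@EFin_expect _ (borelE E) R mu f).
exact: (value_continuous PS SM WF ER (conj cf bf) (conj cg bg) mean
  K_gt0 K_compact h_ge0 h_int D1 D2).
Qed.
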